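(* In the setting described in the context, assume that conditions (H1), (H2) and (L1) listed there hold. Then there is a constant $C>0$ such that for every $u\in W_0^{1,\mathcal T}(\Omega)$, $$\left|\int_\Omega\int_\Omega\frac{F(x,u(x))F(y,u(y))}{|x-y|^{d(x,y)}}\,dx\,dy\right|\le C\max\left(\|u\|^{2\alpha_1^-},\ \|u\|^{2\alpha_3^+}\right).$$
   Context: $\Omega\subset\mathbb R^N$ is a bounded domain with smooth boundary; $C_+(\overline\Omega)=\{s\in C(\overline\Omega): s(x)>1\ \forall x\in\overline\Omega\}$; for a continuous function $s$ on a compact set, $s^-$ and $s^+$ are its minimum and maximum; $s^*(x)=\frac{Ns(x)}{N-s(x)}$ for $s(x)<N$. $p,q,r,\gamma\in C_+(\overline\Omega)$; $a_1,a_2\in L^\infty(\Omega)$ are nonnegative a.e.; $f:\Omega\times\mathbb R\to\mathbb R$ is continuous and $F(x,t)=\int_0^tf(x,s)\,ds$; $d:\overline\Omega\times\overline\Omega\to\mathbb R$ is continuous with $0<d^-\le d^+<N$. $\mathcal T(x,t)=t^{p(x)}+a_1(x)t^{q(x)}+a_2(x)t^{r(x)}$; $L^{\mathcal T}(\Omega)$ is the space of measurable $u$ with $\int_\Omega\mathcal T(x,|u|)dx<\infty$, with norm $\|u\|_{\mathcal T}=\inf\{\Lambda>0:\int_\Omega\mathcal T(x,|u/\Lambda|)dx\le1\}$; $W^{1,\mathcal T}(\Omega)=\{u\in L^{\mathcal T}(\Omega):|\nabla u|\in L^{\mathcal T}(\Omega)\}$ with norm $\|u\|_{\mathcal T}+\|\nabla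 u\|_{\mathcal T}$; $W_0^{1,\mathcal T}(\Omega)$ is the completion of $C_c^\infty(\Omega)$ in it, with equivalent norm $\|u\|=\|\nabla u\|_{\mathcal T}$. (H1) $p(x)<N$ and $\gamma(x)<p(x)<q(x)<r(x)<p^*(x)$ for all $x\in\overline\Omega$. (H2) $p,q,r\in C^{0,1}(\overline\Omega)$, $p(x)<q(x)<r(x)<N$, $0\le a_1,a_2\in C^{0,1}(\overline\Omega)$, and $\frac{r^+}{p^-}<1+\frac1N$. (L1) There are $c>0$ and $\alpha_1,\alpha_2,\alpha_3\in C_+(\overline\Omega)$ such that for all $x\in\Omega$, $t\in\mathbb R$, $$|f(x,t)|\le c\left(|t|^{\alpha_1(x)-1}+a_1(x)^{\frac{\alpha_2(x)}{q(x)}}|t|^{\alpha_2(x)-1}+a_2(x)^{\frac{\alpha_3(x)}{r(x)}}|t|^{\alpha_3(x)-1}\right),$$ with $1<\alpha_1(\cdot)<\alpha_2(\cdot)<\alpha_3(\cdot)$, $\alpha_1^->\frac{r^+}{2}$, and $\alpha_i\in M_i(\Omega)$, where, with $s_1=p,\ s_2=q,\ s_3=r$, $M_i(\Omega)=\{s\in C_+(\overline\Omega):1<s(x)\frac{2N}{2N-d^-}\le s(x)\frac{2N}{2N-d^+}<s_i^*(x)\ \forall x\}$. *)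

(* Defs.v *)
From HB Require Import structures.
From mathcomp Require Import all_boot all_order all_algebra.
From mathcomp Require Import all_classical all_reals all_analysis.

Set Implicit Arguments.
Unset Strict Implicit.
Unset Printing Implicit Defensive.

Import Order.TTheory GRing.Theory Num.Theory.
Import numFieldNormedType.Exports.

Local Open Scope classical_set_scope.
Local Open Scope ring_scope.

Fact rV_display : measure_display. Proof. exact: default_measure_display. Qed.

Section rV_measurable.
Variables (R : realType) (n : nat).

Definition rV_coord (i : 'I_n) (x : 'rV[R]_n) : measurableTypeR R := x ord0 i.

(* The sigma-algebra generated by the coordinates, i.e., the Borel sets. *)
HB.instance Definition _ := @isMeasurable.Build rV_display 'rV[R]_n
  (g_sigma_preimage rV_coord) (@sigma_algebra0 _ _ _)
  (@sigma_algebraC _ _) (@sigma_algebra_bigcup _ _ _).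

End rV_measurable.

Section rV_lebesgue.
Variable R : realType.

Lemma measurable_fun_rV d (T : measurableType d) n (f : T -> 'rV[R]_n) :
  (forall i, measurable_fun [set: T] (@rV_coord R n i \o f)) ->
  measurable_fun [set: T] f.
Proof.
move=> mf; have sub : g_sigma_preimage (fun i => @rV_coord R n i \o f)
    `<=` @measurable _ T.
  apply: smallest_sub; first exact: sigma_algebra_measurable.
  elim/big_ind: _ => [//|A B sA sB|i _]; first by rewrite subUset.
  by move=> _ [B mB <-]; exact: mf.
move: sub; rewrite g_sigma_preimage_comp => sub _ A mA.
by apply: sub; exists A.
Qed.

Lemma measurable_rV_coord n (i : 'I_n) :
  measurable_fun [set: 'rV[R]_n] (@rV_coord R n i).
Proof.
move=> _ Y mY; rewrite setTI; apply: sub_sigma_algebra => /=.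
rewrite -bigcup_seq/=; exists i => /=; first by rewrite mem_index_enum.
by exists Y => //; rewrite setTI.
Qed.

Definition rV_cons n (z : measurableTypeR R * 'rV[R]_n) : 'rV[R]_n.+1 :=
  \row_i (if unlift ord0 i is Some j then z.2 ord0 j else z.1).

Definition rV_uncons n (x : 'rV[R]_n.+1) : measurableTypeR R * 'rV[R]_n :=
  (x ord0 ord0, \row_j x ord0 (lift ord0 j)).

Lemma rV_consK n : cancel (@rV_cons n) (@rV_uncons n).
Proof.
move=> [a x]; rewrite /rV_uncons /rV_cons; congr pair; first by rewrite mxE unlift_none.
by apply/rowP => j; rewrite !mxE liftK.
Qed.

Lemma measurable_rV_cons n : measurable_fun setT (@rV_cons n).
Proof.
apply: measurable_fun_rV => i; rewrite /rV_coord.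
case: (unliftP ord0 i) => [j ->|->].
  rewrite (_ : _ \o _ = @rV_coord R n j \o snd); last first.
    by apply/funext => z; rewrite /= !mxE liftK.
  by apply: measurableT_comp => //; exact: measurable_rV_coord.
rewrite (_ : _ \o _ = fst) //.
by apply/funext => z; rewrite /= !mxE unlift_none.
Qed.

Lemma measurable_rV_uncons n : measurable_fun setT (@rV_uncons n).
Proof.
apply/measurable_fun_pairP; split.
  exact: (@measurable_rV_coord n.+1 ord0).
apply: measurable_fun_rV => j.
rewrite (_ : _ \o _ = @rV_coord R n.+1 (lift ord0 j)).
  exact: measurable_rV_coord.
by apply/funext => x; rewrite /rV_coord/= mxE.
Qed.


Section step.
Variables (n : nat) (m : {sigma_finite_measure set 'rV[R]_n -> \bar R}).
Local Open Scope ereal_scope.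

Definition lebesgue_rV_step : set 'rV[R]_n.+1 -> \bar R :=
  pushforward (lebesgue_measure \x m) (@rV_cons n).

HB.instance Definition _ := Measure.copy lebesgue_rV_step
  (measure_function_pushforward__canonical__measure_function_Measure
     [the measure _ _ of lebesgue_measure \x m] (@measurable_rV_cons n)).

Let lebesgue_rV_step_sigma_finite : sigma_finite setT lebesgue_rV_step.
Proof.
have [F FT Ffin] := sigma_finiteT (@lebesgue_measure R).
have [G GT Gfin] := sigma_finiteT m.
pose H k := if unpickle k is Some (i, j) then F i `*` G j else set0.
have mH k : measurable (H k).
  rewrite /H; case: unpickle => [[i j]|//].
  by apply: measurableX; [have [] := Ffin i|have [] := Gfin j].
exists (fun k => @rV_uncons n @^-1` H k).
  rewrite -preimage_bigcup; apply/seteqP; split => // x _ /=.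
  have [i _ Fi] : (\bigcup_i F i) (rV_uncons x).1 by rewrite -FT.
  have [j _ Gj] : (\bigcup_i G i) (rV_uncons x).2 by rewrite -GT.
  by exists (pickle (i, j)) => //; rewrite /H pickleK.
move=> k; split.
  by rewrite -[X in measurable X]setTI; apply: measurable_rV_uncons.
rewrite /lebesgue_rV_step /pushforward -comp_preimage.
rewrite (_ : _ \o _ = id); last by apply/funext => z /=; rewrite rV_consK.
rewrite preimage_id /H; case: unpickle => [[i j]|]; last by rewrite measure0.
have [mF Foo] := Ffin i; have [mG Goo] := Gfin j.
by rewrite product_measure1E// lte_mul_pinfty// ge0_fin_numE.
Qed.

HB.instance Definition _ := Measure_isSigmaFinite.Build _ _ _
  lebesgue_rV_step lebesgue_rV_step_sigma_finite.

End step.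

(* Under the identification of R^(n+1) with R x R^n, Lebesgue measure is the
   product of the one-dimensional one with that on R^n; R^0 is a point of
   mass one. See lebesgue_rV_box for the normalization. *)
Fixpoint lebesgue_rV_rec n : {sigma_finite_measure set 'rV[R]_n -> \bar R} :=
  if n is k.+1 then lebesgue_rV_step (lebesgue_rV_rec k)
  else dirac (0 : 'rV[R]_0).

Definition lebesgue_rV n : set 'rV[R]_n -> \bar R := lebesgue_rV_rec n.
HB.instance Definition _ n :=
  SigmaFiniteMeasure.copy (@lebesgue_rV n) (lebesgue_rV_rec n).

Lemma lebesgue_rV_box n (A : 'I_n -> set (measurableTypeR R)) :
  (forall i, measurable (A i)) ->
  lebesgue_rV [set x : 'rV[R]_n | forall i, A i (x ord0 i)] =
  (\prod_(i < n) lebesgue_measure (A i))%E.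
Proof.
rewrite /lebesgue_rV; elim: n A => [|n IHn] A mA.
  rewrite big_ord0 [LHS]diracE mem_set//= => -[].
  by [].
rewrite big_ord_recl -IHn//=.
rewrite /lebesgue_rV_step /pushforward -product_measure1E//; last first.
  rewrite (_ : [set _ | _] = \bigcap_(i in [set: 'I_n])
      (@rV_coord R n i @^-1` A (lift ord0 i))); last first.
    by apply/seteqP; split => [x xA i _|x xA i]; [exact: xA|exact: (xA i)].
  apply: fin_bigcap_measurable => //.
  by move=> i _; rewrite -[X in measurable X]setTI; exact: measurable_rV_coord.
congr (_ _); apply/seteqP; split => -[a x] /=.
  move=> H; split => [|i]; first by have := H ord0; rewrite mxE unlift_none.
  by have := H (lift ord0 i); rewrite mxE liftK.
by move=> [Aa Ax] i; rewrite mxE; case: unliftP => [j ->|->].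
Qed.

End rV_lebesgue.

Section domains.
Variables (R : realType) (N : nat).
Implicit Types (x : 'rV[R]_N) (U Omega : set 'rV[R]_N) (phi : 'rV[R]_N -> R).

(* The norm `|x| of 'rV[R]_N is the sup norm; this is the Euclidean one. *)
Definition enorm x : R := Num.sqrt (\sum_(i < N) x ord0 i ^+ 2).

Definition partial (i : 'I_N) phi : 'rV[R]_N -> R :=
  fun x => 'D_(delta_mx ord0 i) phi x.

Fixpoint Ck U (k : nat) phi : Prop :=
  {in U, continuous phi} /\
  if k is j.+1 then forall i : 'I_N,
    {in U, forall x, derivable phi x (delta_mx ord0 i)} /\ Ck U j (partial i phi)
  else True.

Definition smooth_on U phi := forall k, Ck U k phi.

(* Level-set form: since the gradient of phi does not vanish at x0, the
   boundary is near x0 the smooth hypersurface phi = 0, with Omega on one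
   side. *)
Definition smooth_boundary Omega := forall x0, (closure Omega `\` Omega°) x0 ->
  exists U phi, [/\ open U, U x0, smooth_on U phi,
    exists i, partial i phi x0 != 0 &
    Omega `&` U = [set x | U x /\ phi x < 0]].

Definition smooth_bounded_domain Omega :=
  [/\ open Omega, connected Omega, Omega !=set0, bounded_set Omega &
      smooth_boundary Omega].

Definition test_function Omega phi :=
  [/\ smooth_on setT phi, compact (closure [set x | phi x != 0]) &
      closure [set x | phi x != 0] `<=` Omega].

End domains.

Section exponents.
Variables (R : realType) (N : nat) (Omega : set 'rV[R]_N).
Implicit Types (s : 'rV[R]_N -> R).

Definition C_plus s :=
  {within closure Omega, continuous s} /\ forall x, closure Omega x -> 1 < s x.

Definition C01 s := [lipschitz s x | x in closure Omega].

(* Only used for continuous functions on nonempty compact sets, where these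
   bounds are attained. *)
Definition minf (T : Type) (K : set T) (s : T -> R) : R := inf [set s x | x in K].
Definition maxf (T : Type) (K : set T) (s : T -> R) : R := sup [set s x | x in K].

Definition sobolev_conj s : 'rV[R]_N -> R :=
  fun x => N%:R * s x / (N%:R - s x).

(* The class M_i, where si is the i-th exponent of the modular function, and
   dm, dM are the minimum and the maximum of d. *)
Definition exponent_class (dm dM : R) (si s : 'rV[R]_N -> R) :=
  C_plus s /\ forall x, closure Omega x ->
    [/\ 1 < s x * (2 * N%:R / (2 * N%:R - dm)),
        s x * (2 * N%:R / (2 * N%:R - dm)) <=
        s x * (2 * N%:R / (2 * N%:R - dM)) &
        s x * (2 * N%:R / (2 * N%:R - dM)) < sobolev_conj si x].

End exponents.

Section musielak_sobolev.
Variables (R : realType) (N : nat) (Omega : set 'rV[R]_N).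
Variable T : 'rV[R]_N -> R -> R.
Implicit Types (u v : 'rV[R]_N -> R) (G : 'rV[R]_N -> 'rV[R]_N).

Local Notation mu := (@lebesgue_rV R N).

Definition modular u : \bar R := (\int[mu]_(x in Omega) (T x `|u x|)%:E)%E.

Definition musielak_space u :=
  measurable_fun Omega (u : 'rV[R]_N -> measurableTypeR R) /\
  (modular u < +oo)%E.

(* Meaningful for u in the Musielak space, where the set below is not empty;
   elsewhere it may be empty, and then the value is inf set0 = 0. *)
Definition luxemburg u : R :=
  inf [set L : R | 0 < L /\ (modular (fun x => u x / L)%R <= 1)%E].

Definition loc_integrable u := forall K : set 'rV[R]_N,
  compact K -> K `<=` Omega -> mu.-integrable K (EFin \o u).

Definition weak_gradient u G :=
  [/\ loc_integrable u,
      forall i, loc_integrable (fun x => G x ord0 i) &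
      forall i phi, test_function Omega phi ->
        \int[mu]_(x in Omega) (u x * partial i phi x) =
        - \int[mu]_(x in Omega) (G x ord0 i * phi x)].

(* A representative of the weak gradient, which is unique up to a.e. equality;
   0 if there is none. *)
Definition wgrad u : 'rV[R]_N -> 'rV[R]_N :=
  xget (fun=> 0) [set G | weak_gradient u G].

Definition norm_wgrad u : 'rV[R]_N -> R := fun x => enorm (wgrad u x).

Definition W1 u := [/\ musielak_space u, exists G, weak_gradient u G &
  musielak_space (norm_wgrad u)].

Definition W1_norm u : R := luxemburg u + luxemburg (norm_wgrad u).

(* The completion of the test functions inside W1, i.e., their closure. *)
Definition W10 u := W1 u /\ forall e : R, 0 < e ->
  exists2 phi, test_function Omega phi & W1_norm (u \- phi) < e.

Definition W10_norm u : R := luxemburg (norm_wgrad u).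

End musielak_sobolev.

Section nonlinearity.
Variables (R : realType) (N : nat).

Definition triple_phase (p q r a1 a2 : 'rV[R]_N -> R)
    (x : 'rV[R]_N) (t : R) : R :=
  t `^ p x + a1 x * t `^ q x + a2 x * t `^ r x.

Definition primitive (f : 'rV[R]_N -> R -> R) (x : 'rV[R]_N) (t : R) : R :=
  if 0 <= t then \int[lebesgue_measure]_(s in `[0, t]) f x s
  else - \int[lebesgue_measure]_(s in `[t, 0]) f x s.

(* On the null set x = y the kernel 1 / |x - y|^d takes the value 0, by the
   convention 0^-1 = 0. Since d is positive this is the only exceptional set. *)
Definition choquard (F : 'rV[R]_N -> R -> R) (d : 'rV[R]_N -> 'rV[R]_N -> R)
    (u : 'rV[R]_N -> R) (z : 'rV[R]_N * 'rV[R]_N) : R :=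
  F z.1 (u z.1) * F z.2 (u z.2) / enorm (z.1 - z.2) `^ d z.1 z.2.

End nonlinearity.

(* Main.v *)
Require Import Defs.
From HB Require Import structures.
From mathcomp Require Import all_boot all_order all_algebra.
From mathcomp Require Import all_classical all_reals all_analysis.
From mathcomp Require Import measurable_realfun.
From mathcomp Require Import ring lra.

(** Homogeneity reduces the estimate to a bound that does not depend on u. Let
    L be admissible in the definition of the norm of u, that is, let the modular
    of the gradient of v = u / L be at most 1. The growth condition gives
    |F(x, u)| <= c * max(L^alpha1^-, L^alpha3^+) * H(x), where H is the sum of
    |v|^alpha1, a1^(alpha2/q) |v|^alpha2 and a2^(alpha3/r) |v|^alpha3. If the
    double integral of H(x) H(y) |x - y|^(-d^+) is bounded, the theorem follows by
    letting L tend to the norm (le_max_powR_inf, choquard_bound).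

    The kernel. For t slightly larger than t0 = 2N / (2N - d^+), the weighted
    inequality between geometric and arithmetic means bounds H(x) H(y) k by
    H(x)^t H(y)^t + H(x)^t k^s + H(y)^t k^s with s = t / (2 (t - 1)). The kernel
    k^s is integrable in each variable, uniformly in the other one, so only the
    integral of H^t is needed (double_integral_riesz_le). Because the exponents
    alpha_i t0 are strictly less than the Sobolev conjugates s_i' of p, q and r on
    a compact set, t > t0 and kap < 1 can be chosen with alpha_i t <= kap s_i'
    (subcritical_ratio, exponent_choice). What remains is a bound for the
    integrals of (a^(1/s) |v|)^(kap s'), where the pair (a, s) is (1, p), (a1, q)
    or (a2, r) and s' is the Sobolev conjugate of s.

    The embedding. Put N' = N / (N - 1), and for a test function phi consider
    g = a^m |phi|^th with m = kap (N - 1) / (N - s) and th = m s. Then g^N' is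
    (a^(1/s) |phi|)^(kap s'); let I be its integral. The Gagliardo inequality
    (gagliardo) bounds I by a power of the integrals of the partial derivatives
    of g. The derivative of phi contributes th (g^N')^((th - 1)/(th N'))
    (a |d phi|^s)^(1/s). The Lipschitz functions a, m and th contribute terms of
    lower order with logarithms, which are dominated by a^(m - 1) |phi|^(th + e).
    For a = 1 these are controlled by the Gagliardo inequality for |phi|; for the
    weights a1 and a2 they are controlled by the result for p, and this is where
    r^+/p^- < 1 + 1/N is used. In all cases I <= C I^z with z < 1, which bounds I
    (weighted_power_bound, phase_one, phase_next). As a, m and th are only
    Lipschitz and a may vanish, g is not differentiable; a calculus of pointwise
    Lipschitz bounds on lines replaces the chain rule (le_integral_line).

    Density. A function of W_0 is a limit of test functions in norm, hence in
    modular (modular_lt_of_luxemburg), and almost everywhere along a rapidly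
    converging sequence, so that the bounds pass to the limit by Fatou's lemma
    (integral_conj_energy_le). Comparing the gradients uses that weak gradients
    are unique almost everywhere (weak_gradient_unique). *)

Set Implicit Arguments.
Unset Strict Implicit.
Unset Printing Implicit Defensive.

Import Order.TTheory GRing.Theory Num.Theory.
Import numFieldNormedType.Exports.

Local Open Scope classical_set_scope.
Local Open Scope ring_scope.

(** * Boxes, measurability and Fubini in R^n *)

Section boxes.
Variables (R : realType) (n : nat).
Implicit Types (l u x y : 'rV[R]_n) (U : set 'rV[R]_n).

Definition cbox l u := [set x : 'rV[R]_n | forall i, x ord0 i \in `[l ord0 i, u ord0 i]].
Definition obox l u := [set x : 'rV[R]_n | forall i, x ord0 i \in `]l ord0 i, u ord0 i[].

Lemma cbox_compact l u : compact (cbox l u).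
Proof.
have := @rV_compact R n (fun i => [set` `[l ord0 i, u ord0 i]]) (fun i => @segment_compact _ _ _).
by congr compact; apply/seteqP; split => x xA i; have := xA i.
Qed.

Lemma measurable_coord_set (A : 'I_n -> set (measurableTypeR R)) :
  (forall i, measurable (A i)) ->
  measurable [set x : 'rV[R]_n | forall i, A i (x ord0 i)].
Proof.
move=> mA; rewrite (_ : [set _ | _] = \bigcap_(i in [set: 'I_n])
      (@rV_coord R n i @^-1` A i)); last first.
  by apply/seteqP; split => [x xA i _|x xA i]; [exact: xA|exact: (xA i)].
apply: fin_bigcap_measurable => //.
by move=> i _; rewrite -[X in measurable X]setTI; exact: measurable_rV_coord.
Qed.

Lemma measurable_cbox l u : measurable (cbox l u).
Proof. exact: (measurable_coord_set (fun i => measurable_itv `[l ord0 i, u ord0 i])). Qed.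

Lemma measurable_obox l u : measurable (obox l u).
Proof. exact: (measurable_coord_set (fun i => measurable_itv `]l ord0 i, u ord0 i[)). Qed.

Lemma lebesgue_cbox_lty l u : (lebesgue_rV (cbox l u) < +oo)%E.
Proof.
rewrite /cbox (@lebesgue_rV_box R n (fun i => [set` `[l ord0 i, u ord0 i]])) //.
apply: (big_ind (fun z : \bar R => (0 <= z)%E /\ (z < +oo)%E) _ _ _).2.
- by split; rewrite ?ltry.
- move=> x y [x0 xy] [y0 yy]; split; first exact: mule_ge0.
  by apply: lte_mul_pinfty => //; rewrite ge0_fin_numE.
- move=> i _; split; first exact: measure_ge0.
  by rewrite lebesgue_measure_itv /=; case: ifP => _; rewrite ?ltry// -EFinB ltry.
Qed.

Lemma lebesgue_bounded_lty (Om : set 'rV[R]_n) (B : R) : measurable Om ->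
  (forall x, Om x -> forall i, `|x ord0 i| <= B) -> (lebesgue_rV Om < +oo)%E.
Proof.
move=> mO OB.
apply: (@le_lt_trans _ _ (lebesgue_rV (cbox (const_mx (- B)) (const_mx B)))).
  apply: le_measure; rewrite ?inE//; first exact: measurable_cbox.
  by move=> x /OB xB i; rewrite !mxE in_itv/= -ler_norml.
exact: lebesgue_cbox_lty.
Qed.

End boxes.

Lemma ball_rVE (R : realType) n (x y : 'rV[R]_n) e : 0 < e ->
  ball x e y <-> forall i, `|x ord0 i - y ord0 i| < e.
Proof.
move=> e0; split => [[_ h] i|h]; first exact: h.
by split => // i j; rewrite (ord1 i); exact: h.
Qed.

(** Boxes with rational centre and radius suffice, which makes the cover countable. *)
Lemma open_cover_boxes (R : realType) n (U : set 'rV[R]_n.+1) : open U ->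
  exists l u : nat -> 'rV[R]_n.+1, (forall k, cbox (l k) (u k) `<=` U) /\
    U `<=` \bigcup_k obox (l k) (u k).
Proof.
move=> oU.
pose lu (z : 'rV[rat]_n.+1 * nat) (s : R) : 'rV[R]_n.+1 :=
  \row_i (ratr (z.1 ord0 i) + s * z.2.+1%:R^-1).
pose ok k (z : 'rV[rat]_n.+1 * nat) := unpickle k = Some z /\
   cbox (lu z (-1)) (lu z 1) `<=` U.
pose bnd (s : R) k : 'rV[R]_n.+1 :=
  if pselect (exists z, ok k z) is left h then lu (projT1 (cid h)) s
  else const_mx (- s).
exists (bnd (-1)), (bnd 1); split.
  move=> k; rewrite /bnd; case: pselect => [h|h].
    by case: cid => z [].
  by move=> x /(_ ord0); rewrite !mxE in_itv/= opprK => /andP[h1 h2]; have := le_trans h1 h2; lra.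
move=> x Ux.
have /nbhs_ballP[e /= e0 xeU] : nbhs x U by exact: open_nbhs_nbhs.
have [k ke] : exists k : nat, 2 * k.+1%:R^-1 < e.
  have [k /= _ hk] := near_infty_natSinv_lt (PosNum (divr_gt0 e0 (ltr0n R 2))).
  by exists k; have /= := hk k (leqnn k); rewrite ltr_pdivlMr// mulrC.
have /choice[c hc] : forall i : 'I_n.+1, exists c : rat,
    `|x ord0 i - ratr c| < k.+1%:R^-1.
  move=> i; have [c] := @rat_in_itvoo R (x ord0 i - k.+1%:R^-1) (x ord0 i + k.+1%:R^-1)
    ltac:(by rewrite ltrD2l gtrN// invr_gt0).
  by rewrite in_itv/= => h; exists c; rewrite distrC ltr_distl.
pose z : 'rV[rat]_n.+1 * nat := (\row_i c i, k).
have zU : cbox (lu z (-1)) (lu z 1) `<=` U.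
  move=> y yz; apply: xeU; apply/ball_rVE => // i.
  have := yz i; have := hc i; rewrite !mxE in_itv/= ltr_distl.
  move: ke; set t := k.+1%:R^-1 => ke /andP[? ?] /andP[? ?].
  by rewrite ltr_distl; apply/andP; split; lra.
have okz : ok (pickle z) z by split => //; rewrite pickleK.
exists (pickle z) => //; rewrite /bnd; case: pselect => [h|]; last by case; exists z.
case: cid => z' [/=]; rewrite pickleK => -[<-] _ i.
have := hc i; rewrite !mxE in_itv/= ltr_distl.
set t := k.+1%:R^-1 => /andP[? ?].
by apply/andP; split; lra.
Qed.

Lemma open_measurable_rV (R : realType) n (U : set 'rV[R]_n.+1) :
  open U -> measurable U.
Proof.
move=> /open_cover_boxes[l [u [luU Ulu]]].
rewrite (_ : U = \bigcup_k cbox (l k) (u k)).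
  by apply: bigcupT_measurable => k; exact: measurable_cbox.
apply/seteqP; split => [x /Ulu[k _ xk]|x [k _ /luU//]].
by exists k => // i; have := xk i; apply: subset_itv_oo_cc.
Qed.

Lemma open_continuous_measurable_rV (R : realType) n (U : set 'rV[R]_n.+1)
    (f : 'rV[R]_n.+1 -> R) : open U -> (forall x, U x -> {for x, continuous f}) ->
  measurable_fun U (f : _ -> measurableTypeR R).
Proof.
move=> oU cf; apply: (measurability _ (RGenOpens.measurableE R)).
move=> _ [_ [a [b ->] <-]]; apply: open_measurable_rV.
rewrite openE => x [Ux fx]; apply: filterI; first exact: open_nbhs_nbhs.
exact/(cf _ Ux)/open_nbhs_nbhs.
Qed.

Lemma closed_measurable_rV (R : realType) n (U : set 'rV[R]_n.+1) :
  closed U -> measurable U.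
Proof.
move=> cU; rewrite -(setCK U); apply: measurableC; apply: open_measurable_rV.
by rewrite openC.
Qed.

Section fubini_rV.
Variables (R : realType) (n : nat).
Local Open Scope ereal_scope.
Local Notation lam := (@lebesgue_measure R).
Implicit Types f : 'rV[R]_n.+1 -> \bar R.

Lemma measurable_rV_cons_comp d (T : measurableType d) (f : 'rV[R]_n.+1 -> T) :
  measurable_fun setT f -> measurable_fun setT (f \o @rV_cons R n).
Proof. by move=> mf; apply: measurableT_comp => //; exact: measurable_rV_cons. Qed.

Lemma fubini_rV_ge0 f : (forall x, 0 <= f x) -> measurable_fun setT f ->
  \int[@lebesgue_rV R n.+1]_x f x =
  \int[lam]_a \int[@lebesgue_rV R n]_x f (rV_cons (a, x)).
Proof.
move=> f0 mf; rewrite /lebesgue_rV/= /lebesgue_rV_step.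
rewrite ge0_integral_pushforward//; last exact: measurable_rV_cons.
rewrite fubini_tonelli1//=; first exact: measurable_rV_cons_comp.
Qed.

Lemma fubini_rV_ge0C f : (forall x, 0 <= f x) -> measurable_fun setT f ->
  \int[@lebesgue_rV R n.+1]_x f x =
  \int[@lebesgue_rV R n]_x \int[lam]_a f (rV_cons (a, x)).
Proof.
move=> f0 mf; rewrite /lebesgue_rV/= /lebesgue_rV_step.
rewrite ge0_integral_pushforward//; last exact: measurable_rV_cons.
rewrite fubini_tonelli2//=; first exact: measurable_rV_cons_comp.
Qed.

Lemma measurable_rV_cons1 a : measurable_fun setT (fun x : 'rV[R]_n => rV_cons (a, x)).
Proof.
have m1 : measurable_fun setT (fun x : 'rV[R]_n => (a : measurableTypeR R, x)).
  exact: measurable_pair1.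
exact: (measurableT_comp (@measurable_rV_cons R n) m1).
Qed.

End fubini_rV.

(** * The Gagliardo inequality *)

(** Hoelder's inequality with exponents p and p / (p - 1), applied to the
    product of f `^ p^-1 and f. *)
Lemma integral_powR_interpolation d (T : measurableType d) (R : realType)
    (mu : {measure set T -> \bar R}) (f : T -> R) (p : R) :
  1 < p -> (forall x, 0 <= f x) -> measurable_fun setT f ->
  (\int[mu]_x (f x `^ (1 + p^-1))%:E <=
   (\int[mu]_x (f x)%:E) `^ p^-1 *
   (\int[mu]_x (f x `^ (1 + (p - 1)^-1))%:E) `^ (1 + (p - 1)^-1)^-1)%E.
Proof.
move=> p1 f0 mf; have p0 : 0 < p by lra.
have pE : 1 + (p - 1)^-1 = p / (p - 1) by field; lra.
have q0 : 0 < 1 + (p - 1)^-1 by rewrite pE divr_gt0//; lra.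
have mfp : measurable_fun setT (fun x => f x `^ p^-1).
  exact: (@measurableT_comp _ _ _ _ _ _ (@powR R ^~ p^-1)).
have pq : p^-1 + (1 + (p - 1)^-1)^-1 = 1 by rewrite pE; field; lra.
have -> : (\int[mu]_x (f x `^ (1 + p^-1))%:E =
    Lnorm mu 1 (EFin \o ((fun x => f x `^ p^-1) \* f)%R))%E.
  rewrite Lnorm1; apply: eq_integral => x _ /=.
  rewrite ger0_norm ?mulr_ge0 ?powR_ge0// -[X in _ * X]powRr1//.
  rewrite -powRD ?[p^-1 + 1]addrC//.
  by rewrite implybE; apply/orP; left; rewrite gt_eqF// addr_gt0// invr_gt0.
apply: (le_trans (hoelder mu mfp mf p0 q0 pq)).
rewrite unlock /= le_eqVlt; apply/orP; left; apply/eqP.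
congr (_ `^ _ * _ `^ _)%E; apply: eq_integral => x _ /=.
  rewrite ger0_norm ?powR_ge0//.
  by rewrite -powRrM mulVf ?gt_eqF// powRr1.
by rewrite ger0_norm.
Qed.

Definition upd (R : realType) n (x : 'rV[R]_n) (i : 'I_n) (t : R) : 'rV[R]_n :=
  \row_j (if j == i then t else x ord0 j).

Lemma upd_cons0 (R : realType) n (x : 'rV[R]_n) (a t : R) :
  upd (rV_cons (a, x)) ord0 t = rV_cons (t, x).
Proof.
apply/rowP => j; rewrite !mxE; case: (unliftP ord0 j) => [k ->|->].
  by rewrite eq_sym (negbTE (neq_lift _ _)).
by rewrite eqxx.
Qed.

Lemma upd_cons_lift (R : realType) n (x : 'rV[R]_n) (a t : R) (i : 'I_n) :
  upd (rV_cons (a, x)) (lift ord0 i) t = rV_cons (a, upd x i t).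
Proof.
apply/rowP => j; rewrite !mxE; case: (unliftP ord0 j) => [k ->|->].
  by rewrite (inj_eq lift_inj) mxE.
by [].
Qed.

Section gns.
Variable R : realType.
Local Open Scope ereal_scope.
Local Notation lam := (@lebesgue_measure R).

(** For f of class C^1 with compact support this holds with h i the absolute value of the i-th
    partial derivative. Only this consequence of differentiability enters the
    Gagliardo inequality, which therefore applies to functions that are not
    differentiable everywhere. *)
Definition line_dominated n (f : 'rV[R]_n -> R) (h : 'I_n -> 'rV[R]_n -> R) :=
  forall x i, (f x)%:E <= \int[lam]_t (h i (upd x i t))%:E.

Let slices n (h : 'I_n.+2 -> 'rV[R]_n.+2 -> R) (a : R) : \bar R :=
  \sum_(j < n.+1) \int[@lebesgue_rV R n.+1]_x (h (lift ord0 j) (rV_cons (a, x)))%:E.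

Lemma measurable_comp_cons1 n (g : 'rV[R]_n.+1 -> R) a : measurable_fun setT g ->
  measurable_fun setT (fun x => g (rV_cons (a, x))).
Proof. by move=> mg; exact: (measurableT_comp mg (@measurable_rV_cons1 R n a)). Qed.

Lemma line_dominated_slice n (f : 'rV[R]_n.+1 -> R)
    (h : 'I_n.+1 -> 'rV[R]_n.+1 -> R) a : line_dominated f h ->
  line_dominated (fun x => f (rV_cons (a, x)))
    (fun j x => h (lift ord0 j) (rV_cons (a, x))).
Proof.
move=> fh x i; apply: (le_trans (fh _ (lift ord0 i))).
by under eq_integral do rewrite upd_cons_lift.
Qed.

(** The integral of f over a hyperplane is controlled by the derivative that is
    transversal to it. *)
Lemma integral_slice_le n (f : 'rV[R]_n.+1 -> R)
    (h : 'I_n.+1 -> 'rV[R]_n.+1 -> R) a :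
  (forall x, (0 <= f x)%R) -> measurable_fun setT f ->
  (forall i x, (0 <= h i x)%R) -> (forall i, measurable_fun setT (h i)) ->
  line_dominated f h ->
  \int[@lebesgue_rV R n]_x (f (rV_cons (a, x)))%:E <=
  \int[@lebesgue_rV R n.+1]_x (h ord0 x)%:E.
Proof.
move=> f0 mf h0 mh fh; rewrite fubini_rV_ge0C//=.
- apply: ge0_le_integral => //.
  + by move=> x _; rewrite lee_fin.
  + by apply/measurable_EFinP; exact: measurable_comp_cons1.
  + apply: (measurable_fun_fubini_tonelli_G
      (fun z : measurableTypeR R * 'rV[R]_n => (h ord0 (rV_cons z))%:E)); last by move=> z; rewrite lee_fin.
    apply/measurable_EFinP.
    by apply: (measurableT_comp (mh ord0)); exact: measurable_rV_cons.
  + move=> x _; apply: (le_trans (fh _ ord0)).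
    by under eq_integral do rewrite upd_cons0.
- by move=> x; rewrite lee_fin.
- exact/measurable_EFinP.
Qed.

Let gns_step n (f : 'rV[R]_n.+2 -> R) (h : 'I_n.+2 -> 'rV[R]_n.+2 -> R) (e : R) :
  (0 < e)%R ->
  (forall x, (0 <= f x)%R) -> measurable_fun setT f ->
  (forall i x, (0 <= h i x)%R) -> (forall i, measurable_fun setT (h i)) ->
  (forall a, \int[@lebesgue_rV R n.+1]_x (f (rV_cons (a, x)) `^ (1 + e))%:E <=
     (\int[@lebesgue_rV R n.+2]_x (h ord0 x)%:E) `^ e * slices h a) ->
  \int[@lebesgue_rV R n.+2]_x (f x `^ (1 + e))%:E <=
  (\sum_i \int[@lebesgue_rV R n.+2]_x (h i x)%:E) `^ (1 + e).
Proof.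
move=> e0 f0 mf h0 mh H.
have mfe : measurable_fun setT (fun x => f x `^ (1 + e))%R.
  exact: (@measurableT_comp _ _ _ _ _ _ (@powR R ^~ (1 + e)%R)).
have mslice j : measurable_fun setT (fun a : measurableTypeR R =>
    \int[@lebesgue_rV R n.+1]_x (h j (rV_cons (a, x)))%:E).
  apply: (measurable_fun_fubini_tonelli_F
    (fun z : measurableTypeR R * 'rV[R]_n.+1 => (h j (rV_cons z))%:E)); last by move=> z; rewrite lee_fin.
  apply/measurable_EFinP.
  by apply: (measurableT_comp (mh j)); exact: measurable_rV_cons.
have slice0 a j : 0 <= \int[@lebesgue_rV R n.+1]_x (h j (rV_cons (a, x)))%:E.
  by apply: integral_ge0 => x _; rewrite lee_fin.
have I0 i : 0 <= \int[@lebesgue_rV R n.+2]_x (h i x)%:E.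
  by apply: integral_ge0 => x _; rewrite lee_fin.
set S := (\sum_i _); have S0 : 0 <= S by apply: sume_ge0.
rewrite fubini_rV_ge0//=; last 2 first.
- by move=> x; rewrite lee_fin powR_ge0.
- exact/measurable_EFinP.
have SE : \int[lam]_a slices h a <= S.
  rewrite /slices ge0_integral_sum//.
  rewrite /S [leRHS]big_ord_recl/= -[leLHS]add0e; apply: leeD => //.
  rewrite le_eqVlt; apply/orP; left.
  apply/eqP/eq_bigr => i _; rewrite [RHS]fubini_rV_ge0//.
    by move=> x; rewrite lee_fin.
  by apply/measurable_EFinP.
have mslices : measurable_fun setT (slices h : measurableTypeR R -> _).
  exact: emeasurable_sum.
have slices0 a : 0 <= slices h a by apply: sume_ge0.
apply: (@le_trans _ _ (\int[lam]_a ((\int[@lebesgue_rV R n.+2]_x (h ord0 x)%:E) `^ e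
    * slices h a))).
  apply: ge0_le_integral => //.
  + by move=> a _; apply: integral_ge0 => x _; rewrite lee_fin powR_ge0.
  + apply: (measurable_fun_fubini_tonelli_F
      (fun z : measurableTypeR R * 'rV[R]_n.+1 => (f (rV_cons z) `^ (1 + e))%:E));
      last by move=> z; rewrite lee_fin powR_ge0.
    apply/measurable_EFinP.
    by apply: (measurableT_comp mfe); exact: measurable_rV_cons.
  + exact: emeasurable_funM.
rewrite ge0_integralZl//; last exact: poweR_ge0.
have -> : S `^ (1 + e) = S `^ e * S.
  rewrite addrC poweRD; last by apply: add_neq0_poweRD_def; rewrite gt_eqF// addr_gt0.
  by rewrite poweRe1.
apply: lee_pmul => //; first exact: poweR_ge0.
- by apply: integral_ge0.
- apply: gt0_ler_poweR; rewrite ?in_itv/= ?andbT ?(ltW e0)//; try exact: leey.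
  + by rewrite leey I0.
  + by rewrite leey S0.
  + by rewrite /S (bigD1 ord0)//= leeDl// sume_ge0.
Qed.

(** Induction on the dimension. On a hyperplane where the first coordinate is
    constant, f is interpolated between L^1, where integral_slice_le bounds it,
    and the exponent given by the induction hypothesis; the remaining integral
    over the first coordinate is linear in the bound of the slices. *)
Lemma gagliardo n (f : 'rV[R]_n.+2 -> R) (h : 'I_n.+2 -> 'rV[R]_n.+2 -> R) :
  (forall x, (0 <= f x)%R) -> measurable_fun setT f ->
  (forall i x, (0 <= h i x)%R) -> (forall i, measurable_fun setT (h i)) ->
  line_dominated f h ->
  \int[@lebesgue_rV R n.+2]_x (f x `^ (1 + n.+1%:R^-1))%:E <=
  (\sum_i \int[@lebesgue_rV R n.+2]_x (h i x)%:E) `^ (1 + n.+1%:R^-1).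
Proof.
elim: n f h => [|n IH] f h f0 mf h0 mh fh.
  rewrite invr1; apply: gns_step => //.
  move=> a.
  have B0 : 0 <= \int[lebesgue_rV (n:=2)]_x (h ord0 x)%:E.
    by apply: integral_ge0 => x _; rewrite lee_fin.
  have s0 : 0 <= slices h a.
    by apply: sume_ge0 => i _; apply: integral_ge0 => x _; rewrite lee_fin.
  rewrite poweRe1//.
  have fs x : (f (rV_cons (a, x)))%:E <= slices h a.
    have := line_dominated_slice a fh x ord0; move/le_trans; apply.
    rewrite /slices big_ord1 fubini_rV_ge0//; last 2 first.
    - by move=> y; rewrite lee_fin.
    - by apply/measurable_EFinP; exact: measurable_comp_cons1.
    rewrite le_eqVlt; apply/orP; left; apply/eqP; apply: eq_integral => t _.
    rewrite integral_dirac//= ?diracT ?mul1e; last first.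
      apply/measurable_EFinP.
      apply: (@measurable_comp_cons1 0 (fun y => h _ (rV_cons (a, y))) t).
      exact: measurable_comp_cons1.
    congr (h _ (rV_cons (_, _)))%:E.
    by apply/rowP => j; rewrite !mxE (ord1 j)/= unlift_none.
  have [sfin|] := boolP (slices h a \is a fin_num); last first.
    rewrite ge0_fin_numE// -leNgt leye_eq => /eqP soo.
    have [/eqP B00|B00] := boolP (\int[lebesgue_rV (n:=2)]_x (h ord0 x)%:E == 0).
      have := integral_slice_le a f0 mf h0 mh fh; rewrite B00 => fa0.
      rewrite mul0e le_eqVlt; apply/orP; left; apply/eqP.
      have : {ae lebesgue_rV (n:=1), forall x, setT x -> (f (rV_cons (a, x)))%:E = 0}.
        apply/ae_eq_integral_abs => //.
          by apply/measurable_EFinP; exact: measurable_comp_cons1.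
        apply/eqP; rewrite eq_le; apply/andP; split; last exact: integral_ge0.
        by under eq_integral do rewrite gee0_abs ?lee_fin//.
      move=> ae0; rewrite -[RHS](integral0 (@lebesgue_rV R 1) setT).
      apply: ae_eq_integral => //.
        apply/measurable_EFinP.
        apply: (@measurableT_comp _ _ _ _ _ _ (@powR R ^~ (1 + 1)%R)) => //.
        exact: measurable_comp_cons1.
      apply: filterS ae0 => x /= /(_ I) -[->] _.
      by rewrite powR0// gt_eqF.
    by rewrite soo gt0_muley ?leey// lt0e B00.
  have mfa : measurable_fun setT (fun x => f (rV_cons (a, x))).
    exact: measurable_comp_cons1.
  apply: (@le_trans _ _ (\int[lebesgue_rV (n:=1)]_x
      (slices h a * (f (rV_cons (a, x)))%:E))).
    apply: ge0_le_integral => //.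
    - by move=> x _; rewrite lee_fin powR_ge0.
    - apply/measurable_EFinP.
      exact: (@measurableT_comp _ _ _ _ _ _ (@powR R ^~ (1 + 1)%R)).
    - by apply: emeasurable_funM => //; exact/measurable_EFinP.
    - move=> x _; rewrite powRD ?powRr1//; last by rewrite gt_eqF.
      by rewrite EFinM lee_wpmul2r// lee_fin.
  rewrite ge0_integralZl//=; last 2 first.
  - exact/measurable_EFinP.
  - by move=> x _; rewrite lee_fin.
  by rewrite muleC lee_wpmul2r//; exact: integral_slice_le.
apply: gns_step => // a.
have nE : (n.+2%:R - 1 = n.+1%:R :> R)%R by rewrite -[in LHS]natr1 addrK.
have := @integral_powR_interpolation _ _ _ (@lebesgue_rV R n.+2)
  (fun x => f (rV_cons (a, x))) n.+2%:R _ _ _.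
rewrite nE => /(_ _ _ _)/le_trans; apply => //.
- by rewrite ltr1n.
- exact: measurable_comp_cons1.
have e0 : (0 < 1 + n.+1%:R^-1 :> R)%R by rewrite addr_gt0// invr_gt0.
apply: lee_pmul; try exact: poweR_ge0.
  apply: gt0_ler_poweR; rewrite ?in_itv/= ?invr_ge0 ?leey ?andbT//.
  - by apply: integral_ge0 => x _; rewrite lee_fin.
  - by apply: integral_ge0 => x _; rewrite lee_fin.
  - exact: integral_slice_le.
have s0 : 0 <= slices h a.
  by apply: sume_ge0 => i _; apply: integral_ge0 => x _; rewrite lee_fin.
have -> : slices h a = (slices h a `^ (1 + n.+1%:R^-1)) `^ (1 + n.+1%:R^-1)^-1.
  by rewrite -poweRrM mulfV ?lt0r_neq0// poweRe1.
apply: gt0_ler_poweR; rewrite ?in_itv/= ?invr_ge0 ?leey ?andbT ?(ltW e0)//.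
- by apply: integral_ge0 => x _; rewrite lee_fin powR_ge0.
- exact: poweR_ge0.
- apply: IH => //.
  + exact: measurable_comp_cons1.
  + by move=> i; exact: measurable_comp_cons1.
  + exact: line_dominated_slice.
Qed.

End gns.

(** * Pointwise Lipschitz functions on a line *)

Section pt_lip.
Variable R : realType.
Implicit Types (f g h : R -> R) (x L M : R).

(** The upper derivative of g at x is at most L in absolute value. A bound of
    this kind survives composition with a Lipschitz function, which need not be
    differentiable at any given point. *)
Definition pt_lip g x L :=
  forall e : R, 0 < e -> \forall y \near x, `|g y - g x| <= (L + e) * `|y - x|.

Lemma pt_lip_cvg g x L : pt_lip g x L -> g @ x --> g x.
Proof.
move=> gL; apply/cvgrPdist_le => e e0.
have M0 : 0 < `|L| + 1 by rewrite ltr_wpDl.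
near=> y.
have : `|g y - g x| <= (L + 1) * `|y - x| by near: y; exact: gL.
rewrite distrC => /le_trans; apply.
have yx : `|y - x| <= e / (`|L| + 1).
  rewrite distrC; near: y; apply: cvgr_dist_le => //.
  exact: divr_gt0.
have : (L + 1) * `|y - x| <= (`|L| + 1) * `|y - x|.
  by rewrite ler_wpM2r// lerD2r ler_norm.
move=> /le_trans; apply; rewrite mulrC -ler_pdivlMr//.
Unshelve. all: by end_near. Qed.

Lemma pt_lipD f g x L M : pt_lip f x L -> pt_lip g x M ->
  pt_lip (fun y => f y + g y) x (L + M).
Proof.
move=> fL gM e e0; have e2 : 0 < e / 2 by rewrite divr_gt0.
near=> y.
have fy : `|f y - f x| <= (L + e / 2) * `|y - x| by near: y; exact: fL.
have gy : `|g y - g x| <= (M + e / 2) * `|y - x| by near: y; exact: gM.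
have -> : f y + g y - (f x + g x) = (f y - f x) + (g y - g x) by ring.
apply: (le_trans (ler_normD _ _)); apply: (le_trans (lerD fy gy)).
rewrite le_eqVlt; apply/orP; left; apply/eqP; field.
Unshelve. all: by end_near. Qed.

Lemma pt_lip_comp f g x L M : 0 <= L -> 0 <= M ->
  pt_lip f (g x) L -> pt_lip g x M -> pt_lip (f \o g) x (L * M).
Proof.
move=> L0 M0 fL gM e e0.
pose s := e / (L + M + 1 + e).
have s0 : 0 < s by rewrite divr_gt0//; lra.
have s1 : s <= 1 by rewrite /s ler_pdivrMr; lra.
have sE : (L + s) * (M + s) <= L * M + e.
  have -> : (L + s) * (M + s) = L * M + s * (L + M + s) by ring.
  rewrite lerD2l {1}/s mulrAC ler_pdivrMr; last by lra.
  by apply: ler_wpM2l; lra.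
have fy : \forall y \near x, `|f (g y) - f (g x)| <= (L + s) * `|g y - g x|.
  exact: (pt_lip_cvg gM (fL s s0)).
near=> y.
have : `|(f \o g) y - (f \o g) x| <= (L + s) * `|g y - g x|.
  by near: y; exact: fy.
move/le_trans; apply.
have gy : `|g y - g x| <= (M + s) * `|y - x| by near: y; exact: gM.
have Ls : 0 <= L + s by lra.
apply: (le_trans (ler_wpM2l Ls gy)); rewrite mulrA.
exact: ler_wpM2r.
Unshelve. all: by end_near. Qed.

Lemma pt_lipM f g x L M : 0 <= L -> 0 <= M -> pt_lip f x L -> pt_lip g x M ->
  pt_lip (fun y => f y * g y) x (`|f x| * M + `|g x| * L).
Proof.
move=> L0 M0 fL gM e e0.
pose s := e / (`|f x| + `|g x| + M + 1 + e).
have fx0 := normr_ge0 (f x); have gx0 := normr_ge0 (g x).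
have D0 : 0 < `|f x| + `|g x| + M + 1 + e by lra.
have s0 : 0 < s by rewrite divr_gt0.
have s1 : s <= 1 by rewrite /s ler_pdivrMr//; lra.
near=> y.
have fy : `|f y - f x| <= (L + s) * `|y - x| by near: y; exact: fL.
have gy : `|g y - g x| <= (M + s) * `|y - x| by near: y; exact: gM.
have fys : `|f y - f x| <= s.
  rewrite distrC; near: y; apply: cvgr_dist_le => //; exact: pt_lip_cvg fL.
have -> : f y * g y - f x * g x = (f y - f x) * g x + f x * (g y - g x)
   + (f y - f x) * (g y - g x) by ring.
apply: (le_trans (ler_normD _ _)); rewrite normrM.
apply: (le_trans (lerD (ler_normD _ _) (ler_wpM2r (normr_ge0 _) fys))).
rewrite !normrM.
have t0 := normr_ge0 (y - x); set t := `|y - x| in fy gy t0 *.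
apply: (le_trans (lerD (lerD (ler_wpM2r gx0 fy) (ler_wpM2l fx0 gy))
   (ler_wpM2l (ltW s0) gy))).
have -> : (L + s) * t * `|g x| + `|f x| * ((M + s) * t) + s * ((M + s) * t) =
  (`|f x| * M + `|g x| * L + s * (`|g x| + `|f x| + M + s)) * t by ring.
apply: ler_wpM2r => //; rewrite lerD2l {1}/s mulrAC ler_pdivrMr//.
by apply: ler_wpM2l; lra.
Unshelve. all: by end_near. Qed.

Lemma pt_lip_near f g x L : {near x, f =1 g} -> pt_lip f x L -> pt_lip g x L.
Proof.
move=> fg fL e e0; have fgx := nbhs_singleton fg; near=> y.
have <- : f y = g y by near: y.
rewrite -fgx; near: y; exact: fL.
Unshelve. all: by end_near. Qed.

Lemma pt_lip_deriv (f : R -> R) x (df : R) : is_derive x 1 f df -> pt_lip f x `|df|.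
Proof.
case=> dfx dfE e e0.
have : h^-1 *: ((f \o shift x) (h *: 1) - f x) @[h --> 0^'] --> df.
  by rewrite -dfE; exact: dfx.
move=> /cvgrPdist_le/(_ _ e0); rewrite near_withinE => H.
have {}H : \forall y \near x, y - x != 0 ->
    `|df - (y - x)^-1 *: (f ((y - x) *: 1 + x) - f x)| <= e.
  have /(_ _ H) : (y - x) @[y --> x] --> (0 : R).
    rewrite -[X in _ --> X](subrr x); apply: cvgB; [exact: cvg_id|exact: cvg_cst].
  by [].
near=> y; have [->|yx] := eqVneq y x.
  by rewrite !subrr normr0 mulr0.
have yx0 : y - x != 0 by rewrite subr_eq0.
have : `|df - (y - x)^-1 *: (f ((y - x) *: 1 + x) - f x)| <= e.
  by move: yx0; near: y.
rewrite /GRing.scale/= mulr1 subrK => h.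
have n0 : 0 < `|y - x| by rewrite normr_gt0.
rewrite -ler_pdivrMr// -normfV -normrM mulrC.
rewrite -lerBlDl; apply: le_trans h; rewrite distrC.
exact: lerB_dist.
Unshelve. all: by end_near. Qed.

End pt_lip.

Section line_bound.
Variable R : realType.
Local Notation lam := (@lebesgue_measure R).
Implicit Types (g h : R -> R).

Lemma integral_continuous_lower h (t s e : R) : t <= s ->
  (forall y, 0 <= h y) -> measurable_fun setT h ->
  (forall y, y \in `]t, s] -> h t - e <= h y) ->
  (((h t - e) * (s - t))%:E <= \int[lam]_(y in `]t, s]) (h y)%:E)%E.
Proof.
move=> ts h0 mh hts; have [hte|hte] := leP 0 (h t - e); last first.
  apply: (@le_trans _ _ 0%E).
    by rewrite lee_fin mulr_le0_ge0// ?subr_ge0// ltW.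
  by apply: integral_ge0 => y _; rewrite lee_fin.
have -> : ((h t - e) * (s - t))%:E = (\int[lam]_(y in `]t, s]) (h t - e)%:E)%E.
  rewrite integral_cst//= lebesgue_measure_itv/= lte_fin.
  case: ltP => st; first by rewrite EFinM.
  have -> : s = t by apply/le_anti; rewrite st ts.
  by rewrite subrr mulr0 mule0.
apply: ge0_le_integral => //; try by move=> y _; rewrite lee_fin.
by apply/measurable_EFinP; exact: measurable_funTS.
Qed.

(** The supremum of the points up to which the inequality holds, with a small
    linear error, is the right end of the interval: at any such point the
    pointwise bound and the continuity of h extend it a little further. *)
Lemma pt_lip_integral g h (s x : R) : s <= x ->
  continuous g -> (forall y, 0 <= h y) -> measurable_fun setT h ->
  (forall t, s <= t <= x -> {for t, continuous h} /\ pt_lip g t (h t)) ->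
  ((g x - g s)%:E <= \int[lam]_(t in `[s, x]) (h t)%:E)%E.
Proof.
move=> sx cg h0 mh gh; apply/lee_addgt0Pr => /= e0 e0p.
have xs1 : 0 < x - s + 1 by lra.
pose e := e0 / (x - s + 1).
have e_gt0 : 0 < e by rewrite divr_gt0.
pose P t := ((g t - g s)%:E <= \int[lam]_(y in `[s, t]) (h y)%:E + (e * (t - s))%:E)%E.
suff : P x.
  move=> /le_trans; apply; rewrite leeD2l// lee_fin /e mulrAC ler_pdivrMr//.
  by apply: ler_wpM2l; lra.
have I0 a b : (0 <= \int[lam]_(y in `[a, b]) (h y)%:E)%E.
  by apply: integral_ge0 => y _; rewrite lee_fin.
pose T := [set t | s <= t <= x /\ P t].
have Ts : T s.
  split; first by rewrite lexx.
  by rewrite /P !subrr mulr0 adde0.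
have supT : has_sup T.
  by split; [exists s|exists x => t [/andP[]]].
pose t1 := sup T.
have t1x : t1 <= x by apply: ge_sup; [exists s|move=> t [/andP[]]].
have st1 : s <= t1 by apply: sup_upper_bound.
have mono a b : a <= b -> (\int[lam]_(y in `[s, a]) (h y)%:E <=
    \int[lam]_(y in `[s, b]) (h y)%:E)%E.
  move=> ab; apply: ge0_subset_integral => //.
  - by apply/measurable_EFinP; exact: measurable_funTS.
  - by move=> y _; rewrite lee_fin.
  - by apply: subset_itvl; rewrite bnd_simp.
have Pt1 : P t1.
  apply/lee_addgt0Pr => d d0.
  have [r /= r0 gr] : exists2 r : R, 0 < r & forall y, `|t1 - y| < r -> `|g t1 - g y| <= d.
    have /cvgrPdist_le/(_ _ d0)/nbhs_ballP[r r0 rP] := cg t1.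
    by exists r.
  have [t [/andP[st tx] Pt] tt] := sup_adherent r0 supT.
  have tt1 : t <= t1 by apply: sup_upper_bound => //; split=> //; rewrite st.
  have /gr : `|t1 - t| < r by rewrite ger0_norm ?subr_ge0// ltrBlDr -ltrBlDl.
  move=> /(le_trans (ler_norm _)) gt.
  have -> : (g t1 - g s)%:E = ((g t - g s)%:E + (g t1 - g t)%:E)%E.
    by rewrite -EFinD; congr EFin; ring.
  apply: leeD; last by rewrite lee_fin.
  apply: (le_trans Pt); apply: leeD; first exact: mono.
  by rewrite lee_fin ler_pM2l// lerD2r.
have [<-//|t1x'] := eqVneq t1 x.
have {t1x'}t1x' : t1 < x by rewrite lt_neqAle t1x'.
have [ch gt1] : {for t1, continuous h} /\ pt_lip g t1 (h t1).
  by apply: gh; rewrite st1.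
have e2 : 0 < e / 2 by rewrite divr_gt0.
have [r /= r0 hr] : exists2 r : R, 0 < r & forall y, `|t1 - y| < r ->
    `|g y - g t1| <= (h t1 + e / 2) * `|y - t1| /\ h t1 - e / 2 <= h y.
  have /cvgrPdist_le/(_ _ e2) ch' := ch.
  have /nbhs_ballP[r r0 rP] : \forall y \near t1,
     `|g y - g t1| <= (h t1 + e / 2) * `|y - t1| /\ `|h t1 - h y| <= e / 2.
    by apply: filterI => //; exact: gt1.
  exists r => // y /rP[? hy]; split => //.
  by move: hy; rewrite ler_norml => /andP[]; lra.
pose t := Num.min x (t1 + r / 2).
have t1t : t1 < t by rewrite /t lt_min t1x'/= ltrDl divr_gt0.
have tx : t <= x by rewrite ge_min lexx.
have tr : t <= t1 + r / 2 by rewrite ge_min lexx orbT.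
suff : T t by move=> /(sup_upper_bound supT); rewrite -/t1 leNgt t1t.
have tr' : `|t1 - t| < r by rewrite distrC ger0_norm; lra.
split; first by apply/andP; split => //; lra.
rewrite /P.
have -> : (g t - g s)%:E = ((g t1 - g s)%:E + (g t - g t1)%:E)%E.
  by rewrite -EFinD; congr EFin; ring.
have -> : (\int[lam]_(y in `[s, t]) (h y)%:E = \int[lam]_(y in `[s, t1]) (h y)%:E
    + \int[lam]_(y in `]t1, t]) (h y)%:E)%E.
  rewrite -ge0_integral_setU//=.
  - by rewrite -itv_bndbnd_setU ?bnd_simp// ltW.
  - by apply/measurable_EFinP; exact: measurable_funTS.
  - by move=> y _; rewrite lee_fin.
  - by apply: lt_disjoint => a b /=; rewrite !in_itv/= => /andP[_ +] /andP[+ _]; exact: le_lt_trans.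
have -> : (e * (t - s))%:E = ((e * (t1 - s))%:E + (e * (t - t1))%:E)%E.
  by rewrite -EFinD; congr EFin; ring.
rewrite addeACA; apply: leeD => //.
apply: (@le_trans _ _ (((h t1 - e / 2) * (t - t1))%:E + (e * (t - t1))%:E)%E).
  rewrite -EFinD lee_fin; have [h1 _] := hr _ tr'.
  have := le_trans (ler_norm _) h1; rewrite (@ger0_norm _ (t - t1)); last by lra.
  by move=> /le_trans; apply; lra.
apply: leeD => //; apply: integral_continuous_lower => //; first exact: ltW.
move=> y; rewrite in_itv/= => /andP[t1y yt]; apply: (hr _ _).2.
by rewrite distrC ger0_norm; lra.
Qed.

(** Between x and the last zero of g before it, g is positive and the pointwise
    Lipschitz bound holds; at that zero itself nothing is known about the
    derivative, hence the limit from the right. *)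
Lemma le_integral_line g h (x x' : R) : continuous g -> (forall y, 0 <= g y) ->
  (forall y, 0 <= h y) -> measurable_fun setT h ->
  (forall t, 0 < g t -> {for t, continuous h} /\ pt_lip g t (h t)) ->
  x' <= x -> g x' = 0 ->
  ((g x)%:E <= \int[lam]_t (h t)%:E)%E.
Proof.
move=> cg g0 h0 mh gh x'x gx'; apply/lee_addgt0Pr => /= e e0.
pose Z := [set t | t <= x /\ g t = 0].
have Zx' : Z x' by [].
have supZ : has_sup Z by split; [exists x'|exists x => t []].
pose z := sup Z.
have zx : z <= x by apply: ge_sup; [exists x'|move=> t []].
have [r /= r0 gr] : exists2 r : R, 0 < r & forall y, `|z - y| < r -> `|g z - g y| <= e / 2.
  have /cvgrPdist_le/(_ _ (divr_gt0 e0 (ltr0n R 2)))/nbhs_ballP[r r0 rP] := cg z.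
  by exists r.
have [t [tx gt0] tz] := sup_adherent r0 supZ.
have tz1 : t <= z by apply: sup_upper_bound.
have gz : g z <= e / 2.
  have /gr : `|z - t| < r by rewrite ger0_norm ?subr_ge0// ltrBlDr -ltrBlDl.
  by rewrite gt0 subr0 ger0_norm.
pose s := Num.min x (z + r / 2).
have zs : z <= s by rewrite /s le_min zx/= lerDl divr_ge0// ltW.
have sx : s <= x by rewrite ge_min lexx.
have gs : g s <= e.
  have sr : s <= z + r / 2 by rewrite ge_min lexx orbT.
  have /gr : `|z - s| < r by rewrite distrC ger0_norm; lra.
  by rewrite ler_norml => /andP[]; lra.
have [zx'|xz] := ltP z x; last first.
  have xE : x = z by apply/le_anti; rewrite xz zx.
  rewrite xE; apply: (@le_trans _ _ e%:E); first by rewrite lee_fin; lra.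
  by rewrite leeDr// integral_ge0// => y _; rewrite lee_fin.
have zs' : z < s by rewrite /s lt_min zx' ltrDl divr_gt0.
have := @pt_lip_integral g h s x sx cg h0 mh.
have H u : s <= u <= x -> {for u, continuous h} /\ pt_lip g u (h u).
  move=> /andP[su ux]; apply: gh; rewrite lt_neqAle g0 andbT eq_sym.
  apply/eqP => gu; have : u <= z by apply: sup_upper_bound.
  by lra.
move=> /(_ H) H'.
have -> : (g x)%:E = ((g x - g s)%:E + (g s)%:E)%E by rewrite -EFinD subrK.
apply: leeD; last by rewrite lee_fin.
apply: (le_trans H'); apply: ge0_subset_integral => //.
- by apply/measurable_EFinP.
- by move=> y _; rewrite lee_fin.
Qed.

End line_bound.

(** * Elementary inequalities for powers *)

Section powR_facts.
Variable R : realType.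
Implicit Types a t X Y l m : R.

Lemma powR_weighted_le X Y l m : 0 <= X -> 0 <= Y -> 0 <= l -> 0 <= m ->
  l + m <= 1 -> X `^ l * Y `^ m <= X + Y + 1.
Proof.
move=> X0 Y0 l0 m0 lm1; pose M := X + Y + 1.
have M1 : 1 <= M by rewrite /M; lra.
have XM : X `^ l <= M `^ l by apply: ge0_ler_powR; rewrite ?nnegrE//; rewrite /M; lra.
have YM : Y `^ m <= M `^ m by apply: ge0_ler_powR; rewrite ?nnegrE//; rewrite /M; lra.
apply: (le_trans (ler_pM (powR_ge0 _ _) (powR_ge0 _ _) XM YM)).
rewrite -powRD; last by rewrite implybE orbC gt_eqF//; lra.
by rewrite -/M -[leRHS]powRr1; [exact: ler_powR|lra].
Qed.

(** Pulling a power of I out of the factor X `^ l makes the remaining terms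
    integrate to a constant when I is the integral of X. *)
Lemma powR_weighted_scaled I z X Y l m : 1 <= I -> 0 <= X -> 0 <= Y ->
  0 <= l -> l <= z -> 0 <= m -> l + m <= 1 ->
  X `^ l * Y `^ m <= I `^ z * (X / I + Y + 1).
Proof.
move=> I1 X0 Y0 l0 lz m0 lm.
have I0 : 0 < I by lra.
have -> : X `^ l * Y `^ m = I `^ l * ((X / I) `^ l * Y `^ m).
  rewrite mulrA -powRM ?divr_ge0 ?(ltW I0)//; congr (_ `^ _ * _).
  by rewrite mulrC divfK// gt_eqF.
have XI0 : 0 <= X / I by rewrite divr_ge0// ltW.
apply: ler_pM; rewrite ?powR_ge0 ?mulr_ge0 ?powR_ge0//.
  exact: ler_powR.
exact: powR_weighted_le.
Qed.

Lemma powR_le_linear A m1 a m : 1 <= A -> 0 <= a <= A -> 1 <= m <= m1 ->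
  a `^ m <= A `^ m1 * a.
Proof.
move=> A1 /andP[a0 aA] /andP[m_ge1 mm1].
have Am1 : 1 <= A `^ m1 by rewrite -(powRr0 A); apply: ler_powR => //; lra.
move: a0; rewrite le_eqVlt => /predU1P[<-|a0].
  by rewrite mulr0 powR0//; lra.
have [a1|a1] := leP a 1.
  have : a `^ m <= a by apply: ge1r_powR => //; rewrite a0.
  move=> /le_trans; apply; rewrite -[leLHS]mul1r.
  by apply: ler_wpM2r => //; exact: ltW.
rewrite -mulr_powRB1 ?(ltW a0)//; last by lra.
rewrite mulrC; apply: ler_wpM2r; first exact: ltW.
have : a `^ (m - 1) <= A `^ (m - 1) by apply: ge0_ler_powR; rewrite ?nnegrE; lra.
by move=> /le_trans; apply; apply: ler_powR => //; lra.
Qed.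

(** The logarithm of a weight that may vanish is harmless once multiplied by the
    weight. *)
Lemma mul_norm_ln_le A a : 1 <= A -> 0 < a <= A -> a * `|ln a| <= A ^+ 2.
Proof.
move=> A1 /andP[a0 aA].
have AA : 1 <= A ^+ 2 by rewrite expr2; nra.
have [a1|a1] := leP a 1.
  rewrite ler0_norm ?ln_le0//.
  have : ln a^-1 < a^-1 by apply: ln_sublinear; rewrite invr_gt0.
  rewrite lnV// => h; apply: (@le_trans _ _ 1) => //.
  by rewrite mulrC -ler_pdivlMr// mul1r ltW.
rewrite ger0_norm ?ln_ge0 ?ltW//.
have := ln_sublinear a0; have := ln_gt0 a1; rewrite expr2; nra.
Qed.

(** The logarithm costs an arbitrarily small loss in the exponent. *)
Lemma powR_norm_ln_le t s e : 0 < t -> 1 <= s -> 0 < e ->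
  t `^ s * `|ln t| <= (1 + e^-1) * (1 + t `^ (s + e)).
Proof.
move=> t0 s1 e0; have e1 : 0 < e^-1 by rewrite invr_gt0.
have P0 : 0 <= t `^ (s + e) by exact: powR_ge0.
have [t1|t1] := leP t 1.
  apply: (@le_trans _ _ 1); last by nra.
  have : t `^ s <= t by apply: ge1r_powR => //; rewrite t0.
  move=> ts; apply: (@le_trans _ _ (t * `|ln t|)); first exact: ler_wpM2r.
  by have := @mul_norm_ln_le 1 t (lexx 1); rewrite t0 t1 expr1n; exact.
have l0 := ln_gt0 t1; rewrite ger0_norm ?(ltW l0)//.
have : ln (t `^ e) < t `^ e by apply: ln_sublinear; exact: powR_gt0.
rewrite ln_powR mulrC => h.
have h2 : ln t <= t `^ e * e^-1 by rewrite ler_pdivlMr// ltW.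
have h3 := ler_wpM2l (powR_ge0 t s) h2; apply: (le_trans h3).
rewrite mulrA -powRD; last by rewrite implybE orbC gt_eqF.
by nra.
Qed.

End powR_facts.

Section derivative_bound.
Variable R : realType.
Implicit Types a t X Y l m : R.

(** The left-hand side bounds the derivative along a line of g = a `^ m * t `^ th
    when a, m and th have Lipschitz constants La, Lm and Lt and t has derivative
    s. The part that comes from t is an exact product of powers of g `^ N' and of
    a * s `^ q because th = m * q; everything else is of lower order, and the two
    logarithms are absorbed by a `^ (m - 1) and by the exponent e. *)
Lemma weighted_power_derivative_le (A m1 La Lm Lt th1 e a m th q t s N' : R) :
  1 <= A -> 0 < a <= A -> 1 <= m <= m1 -> 0 < q -> th = m * q -> 1 <= th <= th1 ->
  0 < t -> 0 <= s -> 0 <= La -> 0 <= Lm -> 0 <= Lt -> 0 < e -> 0 < N' ->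
  forall g D, g = a `^ m * t `^ th ->
  D = (m1 * La + Lm * A ^+ 2 + Lt * A * (1 + e^-1)) * 2 * A `^ m1 ->
  g * (m * (a `^ (-1) * La) + `|ln a| * Lm + (th * (t `^ (-1) * s) + `|ln t| * Lt))
  <= D * (1 + a `^ (m - 1) * t `^ (th + e)) +
     th1 * ((g `^ N') `^ ((th - 1) / (th * N')) * (a * s `^ q) `^ q^-1).
Proof.
move=> A1 /andP[a0 aA] /andP[m_ge1 mm1] q0 thE /andP[th_ge1 thth1] t0 s0 La0 Lm0 Lt0 e0 N0.
move=> g D gE DE; have g0 : 0 <= g by rewrite gE mulr_ge0// powR_ge0.
have aE : a `^ m = a `^ (m - 1) * a.
  by rewrite mulrC mulr_powRB1 ?(ltW a0)//; lra.
have tE : t `^ th = t `^ (th - 1) * t.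
  by rewrite mulrC mulr_powRB1 ?(ltW t0)//; lra.
set B := a `^ (m - 1); have B0 : 0 <= B by exact: powR_ge0.
have P0 : 0 <= t `^ (th + e) by exact: powR_ge0.
have Am1 : 1 <= A `^ m1 by rewrite -(powRr0 A); apply: ler_powR => //; lra.
have BA : B <= A `^ m1.
  apply: (@le_trans _ _ (A `^ (m - 1))); last by apply: ler_powR => //; lra.
  by apply: ge0_ler_powR; rewrite ?nnegrE; lra.
have T0 : t `^ th <= 1 + t `^ (th + e).
  have [t1|t1] := leP t 1.
    have : t `^ th <= 1 by rewrite -(powRr0 t); apply: ger_powR; rewrite ?t0//; lra.
    by move=> /le_trans; apply; lra.
  have : t `^ th <= t `^ (th + e) by apply: ler_powR; lra.
  by lra.
have T1 := @powR_norm_ln_le _ t th e t0 th_ge1 e0.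
have T2 := @mul_norm_ln_le _ A a A1 ltac:(by rewrite a0).
have Q : B * (1 + t `^ (th + e)) <= 2 * A `^ m1 * (1 + B * t `^ (th + e)).
  have BP : 0 <= B * t `^ (th + e) by exact: mulr_ge0.
  rewrite mulrDr mulr1; nra.
have ainv : a `^ (-1) = a^-1 by rewrite powR_inv1// ltW.
have tinv : t `^ (-1) = t^-1 by rewrite powR_inv1// ltW.
have -> : g * (m * (a `^ (-1) * La) + `|ln a| * Lm + (th * (t `^ (-1) * s) + `|ln t| * Lt))
  = (m * La) * (B * t `^ th) + Lm * (a * `|ln a|) * (B * t `^ th)
    + Lt * a * B * (t `^ th * `|ln t|) + th * (g * t^-1 * s).
  rewrite ainv tinv gE aE -/B; field; apply/andP; split; exact: lt0r_neq0.
apply: lerD.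
  set E := 1 + B * _.
  have E0 : 0 <= B * t `^ th by rewrite mulr_ge0// powR_ge0.
  have h1 : B * t `^ th <= 2 * A `^ m1 * E by apply: le_trans Q; exact: ler_wpM2l.
  have hh1 : (m * La) * (B * t `^ th) <= (m1 * La) * (2 * A `^ m1 * E).
    apply: ler_pM => //; first by apply: mulr_ge0 => //; lra.
    by apply: ler_wpM2r.
  have hh2 : Lm * (a * `|ln a|) * (B * t `^ th) <= Lm * A ^+ 2 * (2 * A `^ m1 * E).
    apply: ler_pM => //; first by rewrite !mulr_ge0// ltW.
    exact: ler_wpM2l.
  have hh3 : Lt * a * B * (t `^ th * `|ln t|) <= Lt * A * (1 + e^-1) * (2 * A `^ m1 * E).
    apply: (@le_trans _ _ (Lt * a * B * ((1 + e^-1) * (1 + t `^ (th + e))))).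
      by apply: ler_wpM2l => //; rewrite !mulr_ge0// ltW.
    have -> : Lt * a * B * ((1 + e^-1) * (1 + t `^ (th + e))) =
        Lt * a * (1 + e^-1) * (B * (1 + t `^ (th + e))) by ring.
    have ei : 0 < e^-1 by rewrite invr_gt0.
    apply: ler_pM => //; rewrite ?mulr_ge0//; try lra.
    by apply: ler_wpM2r; [lra|exact: ler_wpM2l].
  rewrite DE; apply: (le_trans (lerD (lerD hh1 hh2) hh3)).
  by rewrite le_eqVlt; apply/orP; left; apply/eqP; ring.
have -> : (g `^ N') `^ ((th - 1) / (th * N')) * (a * s `^ q) `^ q^-1 = g * t^-1 * s.
  rewrite -powRrM.
  have -> : N' * ((th - 1) / (th * N')) = (th - 1) / th by field; apply/andP; split; lra.
  rewrite powRM ?powR_ge0 ?(ltW a0)// -[(s `^ q) `^ _]powRrM mulfV ?gt_eqF// powRr1//.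
  rewrite gE powRM ?powR_ge0// -!powRrM.
  have -> : th * ((th - 1) / th) = th - 1 by field; lra.
  have -> : m * ((th - 1) / th) = m - q^-1.
    by rewrite thE; field; apply/andP; split; [lra|nra].
  rewrite mulrA; congr (_ * s).
  rewrite mulrAC -powRD; last by rewrite implybE orbC gt_eqF.
  by rewrite subrK tE mulrA -mulrA mulfV ?gt_eqF// mulr1.
by apply: ler_wpM2r => //; rewrite !mulr_ge0// invr_ge0 ltW.
Qed.

End derivative_bound.

(** * Weighted powers of compactly supported functions *)

Section real_valued_continuity.
Variables (R : realType) (T : topologicalType) (x : T).
Implicit Types f g : T -> R.
Local Notation cont f := {for x, continuous f}.

Lemma cont_cst (c : R) : cont (fun=> c). Proof. exact: cvg_cst. Qed.

Lemma contD f g : cont f -> cont g -> cont (fun y => f y + g y).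
Proof. exact: continuousD. Qed.

Lemma contM f g : cont f -> cont g -> cont (fun y => f y * g y).
Proof. exact: continuousM. Qed.

Lemma contV f : f x != 0 -> cont f -> cont (fun y => (f y)^-1).
Proof. exact: continuousV. Qed.

Lemma cont_norm f : cont f -> cont (fun y => `|f y|).
Proof. by move=> cf; apply: continuous_comp => //; exact: norm_continuous. Qed.

Lemma cont_ln f : 0 < f x -> cont f -> cont (fun y => ln (f y)).
Proof. by move=> f0 cf; apply: continuous_comp => //; exact: continuous_ln. Qed.

Lemma cont_expR f : cont f -> cont (fun y => expR (f y)).
Proof. by move=> cf; apply: continuous_comp => //; exact: continuous_expR. Qed.

Lemma cont_near f g : (\forall y \near x, f y = g y) -> cont f -> cont g.
Proof.
move=> fg; rewrite /prop_for /continuous_at (nbhs_singleton fg).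
by apply: cvg_trans; apply: near_eq_cvg; apply: filterS fg => y.
Qed.

Lemma cont_squeeze f g : (\forall y \near x, 0 <= g y <= f y) -> cont f ->
  f x = 0 -> cont g.
Proof.
move=> gf cf fx0; have := nbhs_singleton gf; rewrite fx0 => /le_anti gx0.
rewrite /prop_for /continuous_at -gx0.
apply: (squeeze_cvgr gf); first exact: cvg_cst.
by rewrite -[X in _ --> X]fx0.
Qed.

Lemma cont_lt f (c : R) : cont f -> f x < c -> \forall y \near x, f y < c.
Proof.
move=> cf fxc; apply: (cf [set z | z < c]); apply: open_nbhs_nbhs.
by split => //; exact: open_lt.
Qed.

Lemma cont_gt f (c : R) : cont f -> c < f x -> \forall y \near x, c < f y.
Proof.
move=> cf fxc; apply: (cf [set z | c < z]); apply: open_nbhs_nbhs.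
by split => //; exact: open_gt.
Qed.

Lemma cont_neq f (c : R) : cont f -> f x != c -> \forall y \near x, f y != c.
Proof.
move=> cf fxc; apply: (cf [set z | z != c]); apply: open_nbhs_nbhs.
by split => //; exact: open_neq.
Qed.

End real_valued_continuity.

Section lip_on.
Variables (R : realType) (V : normedModType R).

Definition lip_on (Om : set V) (f : V -> R) (L : R) :=
  forall x y, Om x -> Om y -> `|f x - f y| <= L * `|x - y|.

Lemma lip_on_continuous Om f L x : open Om -> lip_on Om f L -> Om x ->
  {for x, continuous f}.
Proof.
move=> oOm fL Ox; apply/cvgrPdist_le => e e0.
have L0 : 0 < `|L| + 1 by rewrite ltr_wpDl.
have e1 : 0 < e / (`|L| + 1) by rewrite divr_gt0.
near=> y.
have Oy : Om y by near: y; exact: open_nbhs_nbhs.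
apply: (le_trans (fL _ _ Ox Oy)).
have xy : `|x - y| <= e / (`|L| + 1) by near: y; apply: cvgr_dist_le.
have : L * `|x - y| <= (`|L| + 1) * `|x - y|.
  by apply: ler_wpM2r => //; have := ler_norm L; lra.
by move=> /le_trans; apply; rewrite mulrC -ler_pdivlMr.
Unshelve. all: by end_near. Qed.

End lip_on.

Section weighted_power.
Variables (R : realType) (n : nat).
Local Notation V := 'rV[R]_n.+1.
Implicit Types (Om : set V) (f phi a m th : V -> R).

Definition C1c Om phi := [/\ continuous phi,
  forall i x, derivable phi x (delta_mx ord0 i),
  forall i, continuous (partial i phi) &
  exists2 K, closed K /\ K `<=` Om & forall x, ~ K x -> phi x = 0].

Lemma upd_norm_le (x : V) i (t s : R) : `|upd x i t - upd x i s| <= `|t - s|.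
Proof.
rewrite [leLHS]mx_normrE; apply: bigmax_le => // -[j k] _ /=.
by rewrite !mxE; case: eqP => _ //; rewrite subrr normr0.
Qed.

Lemma upd_continuous (x : V) i : continuous (upd x i).
Proof.
move=> t; apply/cvgrPdist_le => e e0; near=> s.
apply: (le_trans (upd_norm_le _ _ _ _)).
by near: s; apply: cvgr_dist_le.
Unshelve. all: by end_near. Qed.

Lemma upd_shift (x : V) i (t h : R) : upd x i (h + t) = h *: delta_mx ord0 i + upd x i t.
Proof.
apply/rowP => j; rewrite !mxE eqxx/=; case: eqP => _.
  by rewrite mulr1.
by rewrite mulr0 add0r.
Qed.

Lemma pt_lip_line Om f L (x : V) i t : open Om -> lip_on Om f L -> 0 <= L ->
  Om (upd x i t) -> pt_lip (fun s => f (upd x i s)) t L.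
Proof.
move=> oOm fL L0 Ot e e0; near=> s.
have Os : Om (upd x i s).
  near: s; apply: (@upd_continuous x i t Om).
  exact: open_nbhs_nbhs.
apply: (le_trans (fL _ _ Os Ot)).
apply: (@le_trans _ _ (L * `|s - t|)); first by apply: ler_wpM2l => //; exact: upd_norm_le.
by apply: ler_wpM2r => //; lra.
Unshelve. all: by end_near. Qed.

Lemma is_derive_line phi (x : V) i t : derivable phi (upd x i t) (delta_mx ord0 i) ->
  is_derive t 1 (fun s : R => phi (upd x i s)) (partial i phi (upd x i t)).
Proof.
move=> dphi.
have E : (fun h : R => h^-1 *: (((fun s : R => phi (upd x i s)) \o shift t) (h *: 1) - phi (upd x i t)))
   = (fun h : R => h^-1 *: ((phi \o shift (upd x i t)) (h *: delta_mx ord0 i) - phi (upd x i t))).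
  apply/funext => h /=; congr (_ *: (phi _ - _)).
  by rewrite -upd_shift /GRing.scale/= mulr1.
split; first by rewrite /derivable E; exact: dphi.
by rewrite /derive E.
Qed.

Variables (Om : set V) (a m th phi : V -> R) (A La m1 Lm th1 Lt : R).
Hypotheses (oOm : open Om) (phiC : C1c Om phi).
Hypotheses (A1 : 1 <= A) (La0 : 0 <= La) (Lm0 : 0 <= Lm) (Lt0 : 0 <= Lt).
Hypotheses (a_bnd : forall x, Om x -> 0 <= a x <= A) (aL : lip_on Om a La).
Hypotheses (m_bnd : forall x, Om x -> 1 <= m x <= m1) (mL : lip_on Om m Lm).
Hypotheses (th_bnd : forall x, Om x -> 1 <= th x <= th1) (thL : lip_on Om th Lt).

Definition wpow : V -> R := (fun x => a x `^ m x * `|phi x| `^ th x) \_ Om.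

(** The formal derivative of wpow, with the Lipschitz constants in place of the
    derivatives of a, m and th. *)
Definition wpow_slope (i : 'I_n.+1) : V -> R :=
  (fun x => a x `^ m x * `|phi x| `^ th x *
    (m x * (a x `^ (-1) * La) + `|ln (a x)| * Lm +
    (th x * (`|phi x| `^ (-1) * `|partial i phi x|) + `|ln `|phi x| | * Lt))) \_ Om.

Lemma wpowE x : Om x -> wpow x = a x `^ m x * `|phi x| `^ th x.
Proof. by move=> Ox; rewrite /wpow patchE mem_set. Qed.

Lemma wpow_notin x : ~ Om x -> wpow x = 0.
Proof. by move=> Ox; rewrite /wpow patchE memNset. Qed.

Lemma wpow_ge0 x : 0 <= wpow x.
Proof.
have [Ox|Ox] := pselect (Om x); last by rewrite wpow_notin.
by rewrite wpowE// mulr_ge0// powR_ge0.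
Qed.

Lemma wpow_gt0 x : 0 < wpow x -> [/\ Om x, 0 < a x & phi x != 0].
Proof.
have [Ox|Ox] := pselect (Om x); last by rewrite wpow_notin// ltxx.
rewrite wpowE// => g0; have /andP[m_ge1 _] := m_bnd Ox; have /andP[t1 _] := th_bnd Ox.
split => //.
  have /andP[a0 _] := a_bnd Ox; rewrite lt_neqAle a0 andbT; apply/eqP => a00.
  by move: g0; rewrite -a00 powR0 ?mul0r ?ltxx//; lra.
by apply/eqP => p0; move: g0; rewrite p0 normr0 powR0 ?mulr0 ?ltxx//; lra.
Qed.

Lemma wpow_phi0 x : phi x = 0 -> wpow x = 0.
Proof.
move=> p0; have [Ox|/wpow_notin//] := pselect (Om x).
have /andP[t1 _] := th_bnd Ox.
by rewrite wpowE// p0 normr0 [X in _ * X]powR0 ?mulr0//; lra.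
Qed.

Lemma wpow_le_linear x M : Om x -> 1 <= M -> `|phi x| <= M ->
  wpow x <= (A `^ m1 * M `^ th1) * (a x * `|phi x|).
Proof.
move=> Ox M1 pM; rewrite wpowE// mulrACA; apply: ler_pM; rewrite ?powR_ge0//.
  by apply: powR_le_linear; rewrite ?a_bnd ?m_bnd.
by apply: powR_le_linear; rewrite ?normr_ge0 ?pM ?th_bnd.
Qed.

Let near_good x : Om x -> 0 < a x -> phi x != 0 ->
  \forall y \near x, [/\ Om y, 0 < a y & phi y != 0].
Proof.
move=> Ox ax px; have [cphi _ _ _] := phiC.
have ca : {for x, continuous a} by exact: lip_on_continuous aL Ox.
have nO : \forall y \near x, Om y by exact: open_nbhs_nbhs.
have na := cont_gt ca ax; have np := cont_neq (cphi x) px.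
near=> y; split; near: y => //.
Unshelve. all: by end_near. Qed.

Let wpow_expE x : Om x -> 0 < a x -> phi x != 0 ->
  wpow x = expR (m x * ln (a x) + th x * ln `|phi x|).
Proof.
move=> Ox ax px; rewrite wpowE// /powR gt_eqF// normr_eq0 (negbTE px).
by rewrite expRD.
Qed.

Lemma wpow_continuous (x : V) : {for x, continuous wpow}.
Proof.
have [cphi _ _ [K [cK KO] phiK]] := phiC.
have [Ox|Ox] := pselect (Om x); last first.
  have nK : \forall y \near x, ~ K y.
    by apply: open_nbhs_nbhs; split; [rewrite openC|move=> /KO].
  have E : \forall y \near x, 0 = wpow y.
    by near=> y; rewrite wpow_phi0// phiK//; near: y.
  exact: (@cont_near R V x (fun=> 0) wpow E (@cont_cst R V x 0)).
have ca : {for x, continuous a} by exact: lip_on_continuous aL Ox.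
have cm : {for x, continuous m} by exact: lip_on_continuous mL Ox.
have ct : {for x, continuous th} by exact: lip_on_continuous thL Ox.
have cn : {for x, continuous (fun y => `|phi y|)} by exact: cont_norm (cphi x).
have [/wpow_gt0[_ ax px]|] := ltP 0 (wpow x).
  have E : \forall y \near x, expR (m y * ln (a y) + th y * ln `|phi y|) = wpow y.
    by apply: filterS (near_good Ox ax px) => y [*]; rewrite wpow_expE.
  apply: (@cont_near R V x _ _ E); apply: cont_expR; apply: contD; apply: contM => //.
    exact: cont_ln.
  by apply: cont_ln => //; rewrite normr_gt0.
move=> wx0; have {}wx0 : wpow x = 0 by apply/le_anti; rewrite wx0 wpow_ge0.
have ap0 : a x * `|phi x| = 0.
  apply: contra_eqP wx0 => /eqP; rewrite mulf_eq0 normr_eq0 negb_or => /andP[ax px].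
  have /andP[ax0 _] := a_bnd Ox.
  have ax' : 0 < a x by rewrite lt_neqAle eq_sym ax.
  by rewrite wpow_expE// gt_eqF// expR_gt0.
pose M := `|phi x| + 1.
have nM : \forall y \near x, `|phi y| < M by apply: cont_lt => //; rewrite ltrDl.
have nO : \forall y \near x, Om y by exact: open_nbhs_nbhs.
apply: (@cont_squeeze _ _ _ (fun y => A `^ m1 * M `^ th1 * (a y * `|phi y|))).
- near=> y; rewrite wpow_ge0/=; apply: wpow_le_linear.
  + by near: y.
  + by rewrite /M lerDr.
  + by apply/ltW; near: y.
- by apply: contM; [exact: cont_cst|exact: contM].
- by rewrite ap0 mulr0.
Unshelve. all: by end_near. Qed.

Lemma wpow_slope_ge0 i x : 0 <= wpow_slope i x.
Proof.
rewrite /wpow_slope patchE; case: ifPn => // /set_mem Ox.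
have /andP[m_ge1 _] := m_bnd Ox; have /andP[t1 _] := th_bnd Ox.
apply: mulr_ge0; first by rewrite mulr_ge0// powR_ge0.
by rewrite !addr_ge0// !mulr_ge0// ?powR_ge0//; lra.
Qed.

Lemma wpow_slope_continuous i (x : V) : Om x -> 0 < a x -> phi x != 0 ->
  {for x, continuous (wpow_slope i)}.
Proof.
move=> Ox ax px; have [cphi _ cdphi _] := phiC.
have ca : {for x, continuous a} by exact: lip_on_continuous aL Ox.
have cm : {for x, continuous m} by exact: lip_on_continuous mL Ox.
have ct : {for x, continuous th} by exact: lip_on_continuous thL Ox.
have cn : {for x, continuous (fun y => `|phi y|)} by exact: cont_norm (cphi x).
have nx : 0 < `|phi x| by rewrite normr_gt0.
pose F y := wpow y *
    (m y * ((a y)^-1 * La) + `|ln (a y)| * Lm +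
    (th y * (`|phi y|^-1 * `|partial i phi y|) + `|ln `|phi y| | * Lt)).
have FE : \forall y \near x, F y = wpow_slope i y.
  apply: filterS (near_good Ox ax px) => y [Oy ay py].
  by rewrite /F wpowE// /wpow_slope patchE mem_set// !powR_inv1// ltW.
apply: (@cont_near R V x _ _ FE); apply: contM; first exact: wpow_continuous.
apply: contD; apply: contD; apply: contM => //; try exact: cont_cst.
- by apply: contM => //; [apply: contV; rewrite ?gt_eqF|exact: cont_cst].
- by apply: cont_norm; exact: cont_ln.
- by apply: contM; [apply: contV; rewrite ?gt_eqF|apply: cont_norm; exact: cdphi].
- by apply: cont_norm; exact: (@cont_ln _ _ _ (fun y => `|phi y|)).
Qed.

Lemma wpow_pt_lip (x : V) i t : 0 < wpow (upd x i t) ->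
  pt_lip (fun s => wpow (upd x i s)) t (wpow_slope i (upd x i t)).
Proof.
move=> /wpow_gt0[]; set z := upd x i t => Oz az pz; have [_ dphi _ _] := phiC.
have /andP[mz _] := m_bnd Oz; have /andP[tz _] := th_bnd Oz.
pose E y := m y * ln (a y) + th y * ln `|phi y|.
have nz : 0 < `|phi z| by rewrite normr_gt0.
have pa := pt_lip_line oOm aL La0 Oz.
have pm := pt_lip_line oOm mL Lm0 Oz.
have pt := pt_lip_line oOm thL Lt0 Oz.
have pln (u : R) : 0 < u -> pt_lip (@ln R) u u^-1.
  move=> u0; have := @pt_lip_deriv _ _ _ _ (is_derive1_ln u0).
  by rewrite ger0_norm// invr_ge0 ltW.
have pp : pt_lip (fun s => phi (upd x i s)) t `|partial i phi z|.
  by apply: pt_lip_deriv; exact: is_derive_line.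
have pnorm (u : R) : pt_lip (fun v : R => `|v|) u 1.
  move=> e e0; near=> v; apply: (le_trans (ler_dist_dist _ _)).
  by rewrite -[leLHS]mul1r; apply: ler_wpM2r => //; lra.
have pn := pt_lip_comp ler01 (normr_ge0 _) (pnorm _) pp; rewrite mul1r in pn.
have ainv : 0 <= (a z)^-1 by rewrite invr_ge0 ltW.
have ninv : 0 <= `|phi z|^-1 by rewrite invr_ge0.
have p1 := pt_lip_comp ainv La0 (pln _ az) pa.
have p2 := @pt_lip_comp _ (@ln R) (fun s => `|phi (upd x i s)|) t _ _ ninv
  (normr_ge0 _) (pln _ nz) pn.
have q1 := pt_lipM Lm0 (mulr_ge0 ainv La0) pm p1.
have q2 := pt_lipM Lt0 (mulr_ge0 ninv (normr_ge0 _)) pt p2.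
have pE := pt_lipD q1 q2.
have pexp (u : R) : pt_lip expR u (expR u).
  have := @pt_lip_deriv _ expR u (expR u) (is_derive_expR u).
  by rewrite ger0_norm ?expR_ge0.
set L := (_ + _) in pE.
have L0 : 0 <= L.
  by rewrite /L !addr_ge0// !mulr_ge0// ?normr_ge0// mulr_ge0.
have := pt_lip_comp (expR_ge0 _) L0 (pexp _) pE.
rewrite /= -/z -wpow_expE//.
have -> : wpow z * L = wpow_slope i z.
  rewrite /wpow_slope patchE mem_set// -wpowE//; congr (_ * _).
  rewrite /L /= -/z !powR_inv1 ?ltW// (ger0_norm (_ : 0 <= m z)); last by lra.
  by rewrite (ger0_norm (_ : 0 <= th z)); last by lra.
have NG : \forall s \near t,
    [/\ Om (upd x i s), 0 < a (upd x i s) & phi (upd x i s) != 0].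
  exact: (@upd_continuous x i t _ (near_good Oz az pz)).
by apply: pt_lip_near; apply: filterS NG => s [*]; rewrite /= wpow_expE.
Unshelve. all: by end_near. Qed.

Lemma measurable_wpow_slope i : measurable_fun setT (wpow_slope i : V -> measurableTypeR R).
Proof.
have [cphi _ cdphi _] := phiC.
have mO : measurable Om by exact: open_measurable_rV.
apply/(measurable_restrictT _ mO).
have ma : measurable_fun Om (a : V -> measurableTypeR R).
  by apply: open_continuous_measurable_rV => // x; exact: lip_on_continuous aL.
have mm : measurable_fun Om (m : V -> measurableTypeR R).
  by apply: open_continuous_measurable_rV => // x; exact: lip_on_continuous mL.
have mt : measurable_fun Om (th : V -> measurableTypeR R).
  by apply: open_continuous_measurable_rV => // x; exact: lip_on_continuous thL.
have mn : measurable_fun Om ((fun y => `|phi y|) : V -> measurableTypeR R).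
  by apply: open_continuous_measurable_rV => // x _; exact: cont_norm (cphi x).
have mg : measurable_fun Om ((fun x => a x `^ m x * `|phi x| `^ th x) : V -> measurableTypeR R).
  apply: (@eq_measurable_fun _ _ _ _ _ (wpow : V -> measurableTypeR R)).
    by move=> x; rewrite inE => Ox; rewrite wpowE.
  by apply: open_continuous_measurable_rV => // x _; exact: wpow_continuous.
have mdp : measurable_fun Om ((fun x => `|partial i phi x|) : V -> measurableTypeR R).
  by apply: open_continuous_measurable_rV => // x _; exact: cont_norm (cdphi i x).
have mcomp (F : R -> R) (f : V -> R) : measurable_fun setT F ->
    measurable_fun Om (f : V -> measurableTypeR R) ->
    measurable_fun Om ((fun x => F (f x)) : V -> measurableTypeR R).
  by move=> mF mf; exact: (measurableT_comp mF mf).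
apply: measurable_funM => //; apply: measurable_funD; apply: measurable_funD;
  apply: measurable_funM => //.
- apply: measurable_funM => //.
  exact: (mcomp (@powR R ^~ (-1)) _ (measurable_powR _)).
- apply: (mcomp (fun z => `|z|) (fun x => ln (a x)) (@normr_measurable R setT)).
  exact: (mcomp (@ln R) _ (@measurable_ln R)).
- apply: measurable_funM => //.
  exact: (mcomp (@powR R ^~ (-1)) _ (measurable_powR _)).
- apply: (mcomp (fun z => `|z|) (fun x => ln `|phi x|) (@normr_measurable R setT)).
  exact: (mcomp (@ln R) _ (@measurable_ln R)).
Qed.

Hypothesis bOm : exists M, forall x, Om x -> forall i, `|x ord0 i| <= M.

(** Where wpow is positive both a and phi are nonzero, so the logarithms are
    finite and the pointwise Lipschitz calculus applies; elsewhere there is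
    nothing to prove. *)
Lemma wpow_line_dominated : line_dominated wpow wpow_slope.
Proof.
move=> x i; have [M OM] := bOm.
have xE : x = upd x i (x ord0 i).
  by apply/rowP => j; rewrite !mxE; case: eqP => [->|].
rewrite {1}xE.
apply: (@le_integral_line R (fun s => wpow (upd x i s))
   (fun s => wpow_slope i (upd x i s)) _ (Num.min (x ord0 i) (- M - 1))).
- move=> t; apply: continuous_comp; [exact: upd_continuous|exact: wpow_continuous].
- by move=> y; exact: wpow_ge0.
- by move=> y; exact: wpow_slope_ge0.
- apply: (measurableT_comp (measurable_wpow_slope i)).
  apply: measurable_fun_rV => j; rewrite /rV_coord.
  have [->|ji] := eqVneq j i.
    by rewrite (_ : _ \o _ = id)//; apply/funext => s /=; rewrite mxE eqxx.
  rewrite (_ : _ \o _ = cst (x ord0 j)); first exact: measurable_cst.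
  by apply/funext => s /=; rewrite mxE (negbTE ji).
- move=> t gt; split; last exact: wpow_pt_lip.
  have [Oz az pz] := wpow_gt0 gt.
  apply: continuous_comp; first exact: upd_continuous.
  exact: wpow_slope_continuous.
- by rewrite ge_min lexx.
- apply: wpow_notin => /OM/(_ i); rewrite mxE eqxx.
  set s := Num.min _ _; have : s <= - M - 1 by rewrite ge_min lexx orbT.
  by move=> sM; rewrite ler_norml => /andP[]; lra.
Qed.

End weighted_power.

(** * The a priori bound for a weighted power *)

Section measure_facts.
Context d (T : measurableType d) (R : realType).

Lemma measurable_powR_fun (D : set T) (f s : T -> R) : measurable D ->
  measurable_fun D f -> measurable_fun D s -> measurable_fun D (fun x => f x `^ s x).
Proof.
move=> mD mf ms.
have mS b : measurable (D `&` (fun t => f t == 0) @^-1` [set b]).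
  have mb : measurable_fun D (fun t => f t == 0).
    by apply: measurable_fun_eqr => //; exact: measurable_cst.
  exact: mb.
have sub b (g : T -> R) : measurable_fun D g ->
    measurable_fun (D `&` (fun t => f t == 0) @^-1` [set b]) g.
  by move=> mg; apply: measurable_funS mg => // x [].
rewrite /powR; apply: measurable_fun_if => //.
- by apply: measurable_fun_eqr => //; exact: measurable_cst.
- rewrite (_ : (fun x => _) = (fun x => if s x == 0 then 1 else 0 : R)); last first.
    by apply/funext => x; case: eqP.
  apply: measurable_fun_if => //; try exact: measurable_cst.
  by apply: measurable_fun_eqr; [exact: sub|exact: measurable_cst].
- apply: measurableT_comp => //; apply: measurable_funM; first exact: sub.
  by apply: measurableT_comp => //; exact: sub.
Qed.

Variable mu : {measure set T -> \bar R}.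

Lemma integral_affine_le (D : set T) (X Y Z : T -> R) (al be ga de x y z v : R) :
  measurable D -> (forall t, D t -> 0 <= X t) -> (forall t, D t -> 0 <= Y t) ->
  (forall t, D t -> 0 <= Z t) ->
  measurable_fun D X -> measurable_fun D Y -> measurable_fun D Z ->
  0 <= al -> 0 <= be -> 0 <= ga -> 0 <= de ->
  (\int[mu]_(t in D) (X t)%:E <= x%:E)%E ->
  (\int[mu]_(t in D) (Y t)%:E <= y%:E)%E ->
  (\int[mu]_(t in D) (Z t)%:E <= z%:E)%E -> (mu D <= v%:E)%E ->
  (\int[mu]_(t in D) (al * X t + be * Y t + ga * Z t + de)%:E <=
   (al * x + be * y + ga * z + de * v)%:E)%E.
Proof.
move=> mD X0 Y0 Z0 mX mY mZ al0 be0 ga0 de0 iX iY iZ iv.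
have scal (f : T -> R) (k w : R) : (forall t, D t -> 0 <= f t) -> measurable_fun D f ->
    0 <= k -> (\int[mu]_(t in D) (f t)%:E <= w%:E)%E ->
    (\int[mu]_(t in D) (k * f t)%:E <= (k * w)%:E)%E.
  move=> f0 mf k0 fw; under eq_integral do rewrite EFinM.
  rewrite ge0_integralZl_EFin//.
  - by rewrite EFinM; apply: lee_wpmul2l.
  - exact/measurable_EFinP.
have mM (f : T -> R) (k : R) : measurable_fun D f -> measurable_fun D (fun t => k * f t).
  by move=> mf; apply: measurable_funM => //; exact: measurable_cst.
have add (f g : T -> R) (w1 w2 : R) : (forall t, D t -> 0 <= f t) -> (forall t, D t -> 0 <= g t) ->
    measurable_fun D f -> measurable_fun D g ->
    (\int[mu]_(t in D) (f t)%:E <= w1%:E)%E -> (\int[mu]_(t in D) (g t)%:E <= w2%:E)%E ->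
    (\int[mu]_(t in D) (f t + g t)%:E <= (w1 + w2)%:E)%E.
  move=> f0 g0 mf mg fw gw; under eq_integral do rewrite EFinD.
  rewrite ge0_integralD//; try by move=> t Dt; rewrite lee_fin ?f0 ?g0.
  - by rewrite EFinD; apply: leeD.
  - exact/measurable_EFinP.
  - exact/measurable_EFinP.
have aX t : D t -> 0 <= al * X t by move=> /X0; exact: mulr_ge0.
have bY t : D t -> 0 <= be * Y t by move=> /Y0; exact: mulr_ge0.
have gZ t : D t -> 0 <= ga * Z t by move=> /Z0; exact: mulr_ge0.
have p2 t : D t -> 0 <= al * X t + be * Y t by move=> Dt; rewrite addr_ge0 ?aX ?bY.
have p3 t : D t -> 0 <= al * X t + be * Y t + ga * Z t.
  by move=> Dt; rewrite addr_ge0 ?p2 ?gZ.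
have m2 : measurable_fun D (fun t => al * X t + be * Y t).
  by apply: measurable_funD; exact: mM.
have m3 : measurable_fun D (fun t => al * X t + be * Y t + ga * Z t).
  by apply: measurable_funD => //; exact: mM.
have i2 := add _ _ _ _ aX bY (mM _ al mX) (mM _ be mY) (scal _ _ _ X0 mX al0 iX)
  (scal _ _ _ Y0 mY be0 iY).
have i3 := add _ _ _ _ p2 gZ m2 (mM _ ga mZ) i2 (scal _ _ _ Z0 mZ ga0 iZ).
apply: (add _ (fun=> de) _ (de * v) p3 _ m3 _ i3) => //.
by rewrite integral_cst// EFinM; apply: lee_wpmul2l.
Qed.

End measure_facts.

(** The exponent N / (N - 1), where N = n + 2 is the dimension. *)
Definition sobolev1 (R : realType) (n : nat) : R := 1 + n.+1%:R^-1.
Arguments sobolev1 : clear implicits.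

Section phase.
Variables (R : realType) (n : nat).
Local Notation V := 'rV[R]_n.+2.
Local Notation mu := (@lebesgue_rV R n.+2).
Local Notation s1 := (sobolev1 R n).

Lemma C1c_bounded (Om : set V) (phi : V -> R) (B : R) :
  (forall x, Om x -> forall i, `|x ord0 i| <= B) -> C1c Om phi ->
  exists2 M : R, 1 <= M & forall x, `|phi x| <= M.
Proof.
move=> OB [cphi _ _ [K [cK KO] phiK]].
have KB : K `<=` cbox (const_mx (- B)) (const_mx B).
  by move=> x /KO/OB xB i; rewrite !mxE in_itv/= -ler_norml.
have kK : compact K by exact: subclosed_compact cK (@cbox_compact _ _ _ _) KB.
have : compact ((fun x => `|phi x|) @` K).
  apply: continuous_compact => //; apply: continuous_subspaceT => x.
  exact: cont_norm (cphi x).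
move=> /compact_bounded[M [_ KM]].
have M1 : M < `|M| + 1 by rewrite (le_lt_trans (ler_norm M))// ltrDl.
exists (`|M| + 1) => [|x]; first by rewrite lerDr.
have [Kx|nKx] := pselect (K x); last by rewrite phiK// normr0 addr_ge0.
have := KM _ M1 `|phi x|; rewrite /= normr_id; apply.
by exists x.
Qed.

Lemma measurable_C1c_norm (Om : set V) (phi : V -> R) : C1c Om phi ->
  measurable_fun Om ((fun x => `|phi x|) : V -> measurableTypeR R) /\
  forall i, measurable_fun Om ((fun x => `|partial i phi x|) : V -> measurableTypeR R).
Proof.
move=> [cphi _ cdphi _]; split=> [|i]; apply: measurable_funTS;
  apply: open_continuous_measurable_rV => [|x _]; try exact: openT.
- exact: cont_norm (cphi x).
- exact: cont_norm (cdphi i x).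
Qed.

(** Let I be the integral of X = wpow `^ sobolev1. By the derivative bound and
    Young's inequality, the integral of each wpow_slope is at most a constant
    times I `^ z, and the Gagliardo inequality gives I <= C * I `^ (z * sobolev1).
    The exponent is less than 1, so this bounds I, which is finite because phi
    is bounded with support in a bounded set. The function Y stands for whatever
    is already known to be integrable and absorbs the lower order terms. *)
Lemma weighted_power_bound (Om : set V) (a m th q l k : V -> R)
    (A La m1 Lm th1 Lt e z C1 C2 B : R) :
  open Om -> (forall x, Om x -> forall i, `|x ord0 i| <= B) ->
  1 <= A -> 0 <= La -> 0 <= Lm -> 0 <= Lt -> 0 < e ->
  (forall x, Om x -> 0 <= a x <= A) -> lip_on Om a La ->
  (forall x, Om x -> 1 <= m x <= m1) -> lip_on Om m Lm ->
  (forall x, Om x -> 1 <= th x <= th1) -> lip_on Om th Lt ->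
  (forall x, Om x -> 0 < q x /\ th x = m x * q x) ->
  measurable_fun Om (q : V -> measurableTypeR R) ->
  0 <= z -> z * s1 < 1 ->
  (forall x, Om x -> (th x - 1) / (th x * s1) <= z /\
     (th x - 1) / (th x * s1) + (q x)^-1 <= 1) ->
  (forall x, Om x -> [/\ 0 <= l x, l x <= z, 0 <= k x & l x + k x <= 1]) ->
  0 <= C1 -> 0 <= C2 ->
  exists C : R, forall (phi : V -> R) (Y : V -> R), C1c Om phi ->
    (forall x, Om x -> 0 <= Y x) -> measurable_fun Om (Y : V -> measurableTypeR R) ->
    (\int[mu]_(x in Om) (Y x)%:E <= C1%:E)%E ->
    (forall i, \int[mu]_(x in Om) (a x * `|partial i phi x| `^ q x)%:E <= C2%:E)%E ->
    (forall x, Om x -> 0 < a x -> phi x != 0 ->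
       a x `^ (m x - 1) * `|phi x| `^ (th x + e) <=
       (wpow Om a m th phi x `^ s1) `^ l x * Y x `^ k x) ->
    (\int[mu]_(x in Om) (wpow Om a m th phi x `^ s1)%:E <= C%:E)%E.
Proof.
move=> oOm OB A1 La0 Lm0 Lt0 e0 a_bnd aL m_bnd mL th_bnd thL qP mq z0 zN thz lk C10 C20.
have N1 : 1 <= s1 by rewrite /sobolev1 lerDl invr_ge0.
have N0 : 0 < s1 by exact: lt_le_trans N1.
have mO : measurable Om by exact: open_measurable_rV.
have muO : (mu Om < +oo)%E := lebesgue_bounded_lty mO OB.
have muf : mu Om \is a fin_num by rewrite ge0_fin_numE.
pose v := fine (mu Om).
have muv : (mu Om <= v%:E)%E by rewrite /v fineK.
have v0 : 0 <= v by rewrite fine_ge0.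
have [->|/set0P[x0 Ox0]] := eqVneq Om set0.
  by exists 0 => phi Y *; rewrite integral_set0.
have m1_ge1 : 1 <= m1 by have /andP[] := m_bnd _ Ox0; exact: le_trans.
have th1_ge1 : 1 <= th1 by have /andP[] := th_bnd _ Ox0; exact: le_trans.
pose D := (m1 * La + Lm * A ^+ 2 + Lt * A * (1 + e^-1)) * 2 * A `^ m1.
have ei : 0 < e^-1 by rewrite invr_gt0.
have D0 : 0 <= D.
  have m10 : 0 <= m1 by exact: le_trans m1_ge1.
  have A0 : 0 <= A by exact: le_trans A1.
  rewrite /D; repeat first [done | exact: powR_ge0 | exact: ltW | apply: addr_ge0 |
    apply: mulr_ge0].
pose C3 := (D + th1) * 1 + D * C1 + th1 * C2 + (D * 2 + th1) * v.
have th10 : 0 <= th1 by exact: le_trans th1_ge1.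
have C30 : 0 <= C3 by rewrite /C3 mulr1; repeat first [done | apply: addr_ge0 | apply: mulr_ge0].
pose C4 := (n.+2%:R * C3) `^ s1.
exists (1 + C4 `^ (1 - z * s1)^-1) => phi Y phiC Y0 mY YC1 ZC2 H.
set g := wpow Om a m th phi.
have g0 x : 0 <= g x by exact: wpow_ge0.
have cg x : {for x, continuous g}.
  exact: (@wpow_continuous _ _ Om a m th phi A La m1 Lm th1 Lt).
have mg : measurable_fun setT (g : V -> measurableTypeR R).
  by apply: open_continuous_measurable_rV => [|x _]; [exact: openT|exact: cg].
pose X x := g x `^ s1.
have X0 x : 0 <= X x by exact: powR_ge0.
have mX : measurable_fun setT (X : V -> measurableTypeR R).
  exact: (@measurableT_comp _ _ _ _ _ _ (@powR R ^~ s1)).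
have mXO : measurable_fun Om (X : V -> measurableTypeR R) by exact: measurable_funTS.
have [M M1 phiM] := C1c_bounded OB phiC.
pose G := A `^ m1 * M `^ th1 * (A * M).
have gG x : g x <= G.
  have GG : 0 <= A `^ m1 * M `^ th1 by rewrite mulr_ge0// powR_ge0.
  have [Ox|Ox] := pselect (Om x); last first.
    by rewrite /g wpow_notin// /G !mulr_ge0 ?powR_ge0//; exact: le_trans ler01 _.
  have := @wpow_le_linear _ _ Om a m th phi A m1 th1 A1 a_bnd m_bnd th_bnd x M Ox M1 (phiM x).
  move=> /le_trans; apply; apply: ler_wpM2l => //.
  by have /andP[a0 aA] := a_bnd _ Ox; apply: ler_pM.
have XG x : X x <= G `^ s1.
  apply: ge0_ler_powR; rewrite ?nnegrE// ?(ltW N0)//.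
  exact: le_trans (gG x).
have I_lty : (\int[mu]_(x in Om) (X x)%:E < +oo)%E.
  apply: (@le_lt_trans _ _ (\int[mu]_(x in Om) (G `^ s1)%:E)%E).
    apply: ge0_le_integral => //; try by move=> x _; rewrite lee_fin.
    exact/measurable_EFinP.
  by rewrite integral_cst// lte_mul_pinfty// ?lee_fin ?powR_ge0.
have I_ge0 : (0 <= \int[mu]_(x in Om) (X x)%:E)%E.
  by apply: integral_ge0 => x _; rewrite lee_fin.
pose I := fine (\int[mu]_(x in Om) (X x)%:E).
have IE : (\int[mu]_(x in Om) (X x)%:E = I%:E)%E by rewrite /I fineK// ge0_fin_numE.
have I0 : 0 <= I by rewrite fine_ge0.
rewrite IE lee_fin.
have [I1|I1] := leP I 1.
  by apply: (le_trans I1); rewrite lerDl powR_ge0.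
(* From here on I > 1, so larger powers of I are larger. *)
have I1' : 1 <= I by exact: ltW.
have Ipos : 0 < I by exact: lt_le_trans I1'.
pose h := wpow_slope Om a m th phi La Lm Lt.
have h0 i x : 0 <= h i x.
  by apply: wpow_slope_ge0; eassumption.
have mh i : measurable_fun setT (h i : V -> measurableTypeR R).
  exact: (@measurable_wpow_slope _ _ Om a m th phi A La m1 Lm th1 Lt).
have gh : line_dominated g h.
  apply: (@wpow_line_dominated _ _ Om a m th phi A La m1 Lm th1 Lt) => //.
  by exists B.
have := gagliardo g0 mg h0 mh gh; rewrite -/s1.
have hI i : (\int[mu]_x (h i x)%:E <= (I `^ z * C3)%:E)%E.
  have -> : (\int[mu]_x (h i x)%:E = \int[mu]_(x in Om) (h i x)%:E)%E.
    rewrite [RHS]integral_mkcond; apply: eq_integral => x _.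
    rewrite patchE; case: ifPn => //; rewrite notin_setE => Ox.
    by rewrite /h /wpow_slope patchE memNset.
  pose Z x := a x * `|partial i phi x| `^ q x.
  have Z0 x : Om x -> 0 <= Z x.
    by move=> Ox; have /andP[a0 _] := a_bnd _ Ox; rewrite mulr_ge0// powR_ge0.
  have mZ : measurable_fun Om (Z : V -> measurableTypeR R).
    apply: measurable_funM.
      by apply: open_continuous_measurable_rV => // x; exact: lip_on_continuous aL.
    apply: (@measurable_powR_fun _ V R) => //.
    by have [_] := measurable_C1c_norm phiC; exact.
  have Iz0 : 0 <= I `^ z by exact: powR_ge0.
  have ->: I `^ z * C3 = I `^ z * ((D + th1) / I) * I + I `^ z * D * C1 +
     I `^ z * th1 * C2 + I `^ z * (D * 2 + th1) * v.
    by rewrite /C3; field; rewrite gt_eqF.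
  have := @integral_affine_le _ V R mu Om X Y Z (I `^ z * ((D + th1) / I))
    (I `^ z * D) (I `^ z * th1) (I `^ z * (D * 2 + th1)) I C1 C2 v mO
    (fun t _ => X0 t) Y0 Z0 mXO mY mZ _ _ _ _ _ YC1 (ZC2 i) muv.
  rewrite IE lexx; move=> /(_ _ _ _ _ isT) HH; apply: le_trans (HH _ _ _ _); last first.
  all: try by repeat first [done | apply: addr_ge0 | apply: mulr_ge0 | rewrite invr_ge0].
  apply: ge0_le_integral => //.
  - by move=> x _; rewrite lee_fin.
  - by apply/measurable_EFinP; apply: (@measurable_funTS _ _ V R Om (h i)); exact: mh.
  - apply/measurable_EFinP; apply: measurable_funD; last exact: measurable_cst.
    by apply: measurable_funD; [apply: measurable_funD|]; apply: measurable_funM => //;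
      exact: measurable_cst.
  move=> x Ox; rewrite lee_fin.
  have rhs0 : 0 <= I `^ z * ((D + th1) / I) * X x + I `^ z * D * Y x +
      I `^ z * th1 * Z x + I `^ z * (D * 2 + th1).
    have Yx := Y0 _ Ox; have Zx := Z0 _ Ox.
    by repeat first [done | apply: addr_ge0 | apply: mulr_ge0 | rewrite invr_ge0].
  have [gx|] := ltP 0 (g x); last first.
    move=> gx; have gx0 : g x = 0 by apply/le_anti; rewrite gx g0.
    have -> : h i x = 0.
      rewrite /h /wpow_slope patchE mem_set//.
      by move: gx0; rewrite /g wpowE// => ->; rewrite mul0r.
    exact: rhs0.
  have [_ ax px] := wpow_gt0 a_bnd m_bnd th_bnd gx.
  have [q0 thE] := qP _ Ox.
  have [thz1 thz2] := thz _ Ox.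
  have [l0 lz k0 lk1] := lk _ Ox.
  have /andP[_ aA] := a_bnd _ Ox.
  have axA : 0 < a x <= A by rewrite ax.
  have nx : 0 < `|phi x| by rewrite normr_gt0.
  have := weighted_power_derivative_le A1 axA (m_bnd _ Ox) q0 thE (th_bnd _ Ox)
    nx (normr_ge0 (partial i phi x)) La0 Lm0 Lt0 e0 N0 (wpowE a m th phi Ox) (erefl D).
  move=> hx.
  have -> : h i x = g x * (m x * (a x `^ (-1) * La) + `|ln (a x)| * Lm +
     (th x * (`|phi x| `^ (-1) * `|partial i phi x|) + `|ln `|phi x| | * Lt)).
    by rewrite /h /wpow_slope patchE mem_set// /g wpowE.
  apply: (le_trans hx).
  have b1 := H _ Ox ax px.
  have b2 := powR_weighted_scaled I1' (X0 x) (Y0 _ Ox) l0 lz k0 lk1.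
  have th0 : 0 <= (th x - 1) / (th x * s1).
    have /andP[th_ge1 _] := th_bnd _ Ox.
    by rewrite divr_ge0 ?subr_ge0// mulr_ge0 ?(ltW N0)//; exact: le_trans th_ge1.
  have qi0 : 0 <= (q x)^-1 by rewrite invr_ge0 ltW.
  have b3 := powR_weighted_scaled I1' (X0 x) (Z0 _ Ox) th0 thz1 qi0 thz2.
  have Iz1 : 1 <= I `^ z by rewrite -(powRr0 I); apply: ler_powR.
  have c1 : D * (1 + a x `^ (m x - 1) * `|phi x| `^ (th x + e)) <=
      D * (I `^ z + I `^ z * (X x / I + Y x + 1)).
    by apply: ler_wpM2l => //; apply: lerD => //; exact: le_trans b1 b2.
  have c2 := ler_wpM2l th10 b3.
  apply: (le_trans (lerD c1 c2)).
  by rewrite le_eqVlt; apply/orP; left; apply/eqP; field; rewrite gt_eqF.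
have -> : (\int[mu]_x (g x `^ s1)%:E = I%:E)%E.
  rewrite -IE [RHS]integral_mkcond; apply: eq_integral => x _.
  rewrite patchE; case: ifPn => //; rewrite notin_setE => Ox.
  by rewrite /g wpow_notin// powR0// gt_eqF.
have sumI : (\sum_i \int[mu]_x (h i x)%:E <= (n.+2%:R * (I `^ z * C3))%:E)%E.
  apply: (le_trans (lee_sum _ (fun i _ => hI i))).
  by rewrite sumEFin sumr_const card_ord lee_fin mulr_natl.
have {}sumI : (\sum_i \int[mu]_x (h i x)%:E <= (I `^ z * (n.+2%:R * C3))%:E)%E.
  by apply: (le_trans sumI); rewrite lee_fin mulrCA.
have S0 : (0 <= \sum_i \int[mu]_x (h i x)%:E)%E.
  by apply: sume_ge0 => i _; apply: integral_ge0 => x _; rewrite lee_fin.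
move=> IS; have {IS} : (I%:E <= (I `^ z * (n.+2%:R * C3))%:E `^ s1)%E.
  apply: (le_trans IS); apply: gt0_ler_poweR => //; first exact: ltW.
  - by rewrite in_itv/= leey S0.
  - by rewrite in_itv/= leey andbT lee_fin !mulr_ge0// powR_ge0.
rewrite poweR_EFin lee_fin powRM ?powR_ge0 ?mulr_ge0// -powRrM -/C4 => IC.
have zN' : 0 < 1 - z * s1 by rewrite subr_gt0.
have IC4 : I `^ (1 - z * s1) <= C4.
  rewrite powRB; last by rewrite implybE orbC gt_eqF.
  by rewrite (powRr1 I0) ler_pdivrMr ?powR_gt0// mulrC.
have : I <= C4 `^ (1 - z * s1)^-1.
  have -> : I = (I `^ (1 - z * s1)) `^ (1 - z * s1)^-1.
    by rewrite -powRrM mulfV ?gt_eqF// powRr1.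
  by apply: ge0_ler_powR; rewrite ?nnegrE ?powR_ge0// invr_ge0; exact: ltW.
by move=> /le_trans; apply; rewrite lerDr.
Qed.

End phase.

(** * Boxes and smooth bumps *)

Section box_generation.
Variables (R : realType) (n : nat).
Local Notation V := 'rV[R]_n.+1.

Definition oboxes : set (set V) := [set A | exists l u, A = obox l u].

Lemma oboxes_setI : setI_closed oboxes.
Proof.
move=> _ _ [l [u ->]] [l' [u' ->]].
exists (\row_i Num.max (l ord0 i) (l' ord0 i)), (\row_i Num.min (u ord0 i) (u' ord0 i)).
apply/seteqP; split => [x [xA xB] i|x xAB].
  have := xA i; have := xB i; rewrite !in_itv/= !mxE gt_max lt_min.
  by move=> /andP[-> ->] /andP[-> ->].
by split => i; have := xAB i; rewrite !in_itv/= !mxE gt_max lt_min;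
  move=> /andP[/andP[? ?] /andP[? ?]]; apply/andP.
Qed.

Lemma measurable_oboxes : oboxes `<=` measurable.
Proof. by move=> _ [l [u ->]]; exact: measurable_obox. Qed.

Lemma measurable_sub_oboxes : (@measurable _ V) `<=` <<s oboxes >>.
Proof.
have coordP (i : 'I_n.+1) : measurable_fun setT
    (fun x : g_sigma_algebraType oboxes => x ord0 i : measurableTypeR R).
  apply: (measurability _ (RGenOpens.measurableE R)).
  move=> _ [_ [a [b ->]] <-]; rewrite setTI.
  rewrite (_ : _ @^-1` _ = \bigcup_k (obox
     (\row_j if j == i then a else - k%:R) (\row_j if j == i then b else k%:R))).
    apply: bigcupT_measurable => k; apply: sub_sigma_algebra.
    by eexists; eexists.
  apply/seteqP; split => [x /= xab|x [k _ /(_ i)]]; last by rewrite !mxE eqxx.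
  have [k xk] : exists k : nat, `|x| < k%:R by exists (Num.bound `|x|); exact: archi_boundP.
  exists k => // j; rewrite !mxE; case: eqP => [->//|_].
  rewrite in_itv/= -ltr_norml; apply: le_lt_trans xk.
  rewrite [leRHS]mx_normrE.
  exact: (@le_bigmax _ _ _ _ (fun ij : 'I_1 * 'I_n.+1 => `|x ij.1 ij.2|) (ord0, j)).
apply: smallest_sub; first exact: smallest_sigma_algebra.
elim/big_ind: _ => [//|A B sA sB|i _]; first by rewrite subUset.
by move=> _ [B mB <-]; exact: coordP.
Qed.

End box_generation.

Section density.
Context d (T : measurableType d) (R : realType) (mu : {measure set T -> \bar R}).
Variables (Q : set T) (f : T -> \bar R).
Hypotheses (mQ : measurable Q) (f0 : forall x, (0 <= f x)%E) (fi : mu.-integrable Q f).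

Definition density : set T -> \bar R := fun A => (\int[mu]_(x in Q `&` A) f x)%E.

Let density0 : density set0 = 0%E.
Proof. by rewrite /density setI0 integral_set0. Qed.

Let density_ge0 A : (0 <= density A)%E.
Proof. exact: integral_ge0. Qed.

Let density_additive : semi_sigma_additive density.
Proof.
move=> A mA tA mUA; rewrite /density setI_bigcupr integral_bigcup//; last first.
- rewrite -setI_bigcupr; apply: integrableS fi => //; exact: measurableI.
- by move=> k; exact: measurableI.
- exact: trivIset_setIl.
by apply: is_cvg_ereal_nneg_natsum_cond => k _ _; exact: integral_ge0.
Qed.

HB.instance Definition _ := isMeasure.Build _ _ _
  density density0 density_ge0 density_additive.

Definition density_measure : {measure set T -> \bar R} := density.

End density.

Section boxes_determine.
Variables (R : realType) (n : nat).
Local Notation V := 'rV[R]_n.+1.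
Local Notation mu := (@lebesgue_rV R n.+1).

(** The positive and the negative part of D are densities of two finite measures
    that agree on boxes, a generating class stable under intersection, hence
    everywhere. *)
Lemma integral_boxes_eq0 (l u : V) (D : V -> \bar R) : mu.-integrable (obox l u) D ->
  (forall l' u' : V, (\int[mu]_(x in obox l u `&` obox l' u') D x = 0)%E) ->
  {ae mu, forall x, obox l u x -> D x = 0%E}.
Proof.
move=> iD D0; set Q := obox l u.
have mQ : measurable Q by exact: measurable_obox.
have ip := integrable_funepos mQ iD; have in_ := integrable_funeneg mQ iD.
pose mp := density_measure mQ (funepos_ge0 D) ip.
pose mn := density_measure mQ (funeneg_ge0 D) in_.
have Dpn A : measurable A -> (\int[mu]_(x in Q `&` A) D x = 0)%E -> mp A = mn A.
  move=> mA; have mQA : measurable (Q `&` A) by exact: measurableI.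
  have iDA : mu.-integrable (Q `&` A) D by apply: integrableS iD.
  have fp := integrable_pos_fin_num mQA iDA; have fn := integrable_neg_fin_num mQA iDA.
  rewrite integralE /mp /mn /= /density -(fineK fp) -(fineK fn) -EFinB => -[/eqP].
  by rewrite subr_eq0 => /eqP ->.
have E X : measurable X -> mp X = mn X.
  have HG : @oboxes R n = [set A | oboxes A /\ A `<=` setT].
    by apply/seteqP; split => [A oA|A []].
  move=> /measurable_sub_oboxes; rewrite {1}HG.
  apply: (g_sigma_algebra_measure_unique_trace (@oboxes R n) setT) => //.
  - by move=> A [oA _]; exact: measurable_oboxes oA.
  - by move=> A B [oA _] [oB _]; split=> //; exact: oboxes_setI.
  - apply: Dpn => //; rewrite setIT.
    by have := D0 l u; rewrite setIid.
  - move=> A [[l' [u' ->]] _]; apply: Dpn; first exact: measurable_obox.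
    exact: D0.
  - rewrite /mp /= /density setIT.
    by have := integrable_pos_fin_num mQ iD; rewrite ge0_fin_numE// integral_ge0.
apply: (integral_ae_eq mQ iD (g := cst 0%E)) => // A AQ mA.
rewrite integral0 -(setIidr AQ) integralE.
have iDA : mu.-integrable (Q `&` A) D by apply: integrableS iD => //; exact: measurableI.
have mQA : measurable (Q `&` A) by exact: measurableI.
have := E _ mA; rewrite /mp /mn /= /density => ->.
by rewrite subee// integrable_neg_fin_num.
Qed.

End boxes_determine.

Section smooth_bump.
Variable R : realType.

(** For k = 0 this is the classical function that vanishes to infinite order at
    0. The negative powers of t make the family stable under differentiation. *)
Definition flat (k : nat) (t : R) : R := if 0 < t then t^-1 ^+ k * expR (- t^-1) else 0.

Lemma flat_gt0E k t : 0 < t -> flat k t = t^-1 ^+ k * expR (- t^-1).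
Proof. by rewrite /flat => ->. Qed.

Lemma flat_le0E k t : t <= 0 -> flat k t = 0.
Proof. by rewrite /flat leNgt => /negbTE ->. Qed.

Lemma flat_le k t : `|flat k t| <= k.+2%:R ^+ k.+2 * t ^+ 2.
Proof.
have [t0|t0] := leP t 0.
  by rewrite flat_le0E// normr0 mulr_ge0 ?sqr_ge0 ?exprn_ge0.
have y0 : 0 < t^-1 by rewrite invr_gt0.
rewrite flat_gt0E// ger0_norm; last by rewrite mulr_ge0 ?expR_ge0// exprn_ge0// ltW.
have : (t^-1 / k.+2%:R) ^+ k.+2 <= expR t^-1.
  have -> : expR t^-1 = expR (t^-1 / k.+2%:R) ^+ k.+2.
    by rewrite -expRM_natl mulrC divfK.
  rewrite lerXn2r ?nnegrE ?expR_ge0// ?divr_ge0// ?(ltW y0)//.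
  by apply: le_trans (expR_ge1Dx _); rewrite lerDr.
set y := t^-1 in y0 *; have -> : t = y^-1 by rewrite invrK.
rewrite expRN => h; rewrite ler_pdivrMr ?expR_gt0//.
have C0 : 0 < k.+2%:R ^+ k.+2 :> R by rewrite exprn_gt0.
have CY : 0 <= k.+2%:R ^+ k.+2 * y^-1 ^+ 2 by rewrite mulr_ge0 ?sqr_ge0// ltW.
apply: le_trans (ler_wpM2l CY h).
rewrite le_eqVlt; apply/orP; left; apply/eqP.
have -> : (y / k.+2%:R) ^+ k.+2 = y ^+ k * y ^+ 2 / k.+2%:R ^+ k.+2.
  by rewrite expr_div_n -exprD addn2.
move: (k.+2%:R ^+ k.+2) C0 {CY h} => P P0.
by field; rewrite !gt_eqF.
Qed.

Lemma is_derive_flat k (t : R) : is_derive t (1 : R) (flat k) (flat k.+2 t - k%:R * flat k.+1 t).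
Proof.
have [t0|t0|t0] := ltgtP 0 t.
- have dV : is_derive t (1 : R) (fun s : R => s^-1) (- t ^- 2).
    have := @is_deriveV _ (@id R) t 1 1 (lt0r_neq0 t0) (is_derive_id _ _).
    by rewrite /GRing.scale/= mulr1.
  have dX : is_derive (t^-1) (1 : R) (fun y : R => y ^+ k) (k%:R * t^-1 ^+ k.-1).
    rewrite (_ : (fun y : R => y ^+ k) = (@id R) ^+ k); last first.
      by apply/funext => y; rewrite exprfctE.
    have := @is_deriveX _ _ (@id R) k t^-1 1 1 (is_derive_id _ _).
    by rewrite /GRing.scale/= mulr1.
  have dE : is_derive (t^-1) (1 : R) (fun y : R => expR (- y)) (- expR (- t^-1)).
    have dN : is_derive (t^-1) (1 : R) (fun y : R => - y) (- 1) by exact: is_deriveN.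
    have := @is_derive1_comp _ (@expR R) (fun y => - y) t^-1 _ _ (is_derive_expR _) dN.
    by rewrite mulrN1.
  have dF := @is_deriveM _ _ _ _ _ _ _ _ dX dE.
  have := @is_derive1_comp _ _ (fun s : R => s^-1) t _ _ dF dV.
  have NE : \forall s \near t, ((fun y : R => y ^+ k) * (fun y : R => expR (- y)) \o
      (fun s : R => s^-1)) s = flat k s.
    have : \forall s \near t, 0 < s.
      by apply: open_nbhs_nbhs; split; [exact: open_gt|].
    by apply: filterS => s s0; rewrite flat_gt0E.
  move=> /(near_eq_is_derive NE); congr is_derive.
  rewrite !flat_gt0E// /GRing.scale/=; case: k {dX dF NE} => [|k].
    by rewrite !expr0; field; rewrite gt_eqF.
  by rewrite !exprS; field; rewrite gt_eqF.
- have NE : \forall s \near t, cst 0 s = flat k s.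
    have : \forall s \near t, s < 0.
      by apply: open_nbhs_nbhs; split; [exact: open_lt|].
    by apply: filterS => s s0; rewrite flat_le0E// ltW.
  rewrite !flat_le0E ?ltW// mulr0 subr0.
  exact: near_eq_is_derive NE (is_derive_cst _ _ _).
- rewrite -t0 !flat_le0E// mulr0 subr0.
  have D : h^-1 *: ((flat k \o shift 0) (h *: 1) - flat k 0) @[h --> 0^'] --> 0.
    pose C : R := k.+2%:R ^+ k.+2.
    have C0 : 0 <= C by rewrite exprn_ge0.
    apply/cvgrPdist_le => e e0.
    have eC : 0 < e / (C + 1) by rewrite divr_gt0// ltr_wpDl.
    near=> h.
    have h0 : h != 0 by near: h; exact: nbhs_dnbhs_neq.
    rewrite sub0r normrN /= addr0 (flat_le0E k (lexx 0)) subr0 /GRing.scale/= mulr1 normrM normfV.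
    rewrite mulrC ler_pdivrMr ?normr_gt0//.
    apply: (le_trans (flat_le _ _)); rewrite -/C -real_normK ?num_real// expr2 mulrA.
    apply: ler_wpM2r => //.
    have he : `|h| <= e / (C + 1) by near: h; exact: dnbhs0_le.
    have C1 : 0 < C + 1 by rewrite ltr_wpDl.
    apply: (@le_trans _ _ ((C + 1) * `|h|)); first by apply: ler_wpM2r => //; rewrite lerDl.
    by rewrite mulrC -ler_pdivlMr.
  split; first by apply: cvgP D.
  by apply: cvg_lim D.
Unshelve. all: by end_near. Qed.

End smooth_bump.

Section test_functions.
Variables (R : realType) (n : nat).
Local Notation V := 'rV[R]_n.+1.

Lemma is_derive_of_line (f : V -> R) (x : V) i df :
  is_derive (x ord0 i) (1 : R) (fun s : R => f (upd x i s)) df ->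
  is_derive x (delta_mx ord0 i : V) f df.
Proof.
have xE : upd x i (x ord0 i) = x.
  by apply/rowP => j; rewrite !mxE; case: eqP => [->|].
case; rewrite /derivable /derive.
have -> : (fun h : R => h^-1 *: (((fun s : R => f (upd x i s)) \o shift (x ord0 i)) (h *: 1)
     - f (upd x i (x ord0 i)))) =
  (fun h : R => h^-1 *: ((f \o shift x) (h *: (delta_mx ord0 i : V)) - f x)).
  apply/funext => h /=; rewrite xE; congr (_ *: (f _ - _)).
  by rewrite /GRing.scale/= mulr1 upd_shift xE.
by split.
Qed.

(** The smallest class that contains the factors of the bumps and is closed under
    partial derivatives; being inductive, it gives smoothness of all orders at
    once. *)
Inductive smooth_class : (V -> R) -> Prop :=
| smooth_flat k (a b : R) i : smooth_class (fun x => flat k (a * x ord0 i + b))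
| smooth_cst (c : R) : smooth_class (fun=> c)
| smooth_add f g : smooth_class f -> smooth_class g -> smooth_class (f \+ g)
| smooth_mul f g : smooth_class f -> smooth_class g -> smooth_class (f \* g).

Lemma flat_continuous k (t : R) : {for t, continuous (@flat R k)}.
Proof.
apply: differentiable_continuous; apply/derivable1_diffP.
by have [] := is_derive_flat k t.
Qed.

Lemma coord_cont (x : V) (i : 'I_n.+1) : {for x, continuous (fun y : V => y ord0 i)}.
Proof. exact: coord_continuous. Qed.

Lemma smooth_class_spec f : smooth_class f -> (forall x, {for x, continuous f}) /\
  forall i, exists2 df, smooth_class df &
    forall x, is_derive x (delta_mx ord0 i : V) f (df x).
Proof.
elim=> {f} [k a b i|c|f g _ [cf df] _ [cg dg]|f g sf [cf df] sg [cg dg]].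
- split=> [x|j].
    apply: (@continuous_comp _ _ _ (fun y : V => a * y ord0 i + b) (@flat R k)).
      apply: contD; last exact: cont_cst.
      by apply: contM; [exact: cont_cst|exact: coord_cont].
    exact: flat_continuous.
  have [->|ji] := eqVneq j i; last first.
    exists (fun=> 0) => [|x]; first exact: smooth_cst.
    apply: is_derive_of_line.
    rewrite (_ : (fun s : R => _) = cst (flat k (a * x ord0 i + b))).
      exact: is_derive_cst.
    by apply/funext => s; rewrite mxE eq_sym (negbTE ji).
  exists (fun x => a * (flat k.+2 (a * x ord0 i + b) +
      - k%:R * flat k.+1 (a * x ord0 i + b))).
    apply: (@smooth_mul (fun=> a)); first exact: smooth_cst.
    apply: (@smooth_add (fun x => flat k.+2 (a * x ord0 i + b))); first exact: smooth_flat.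
    apply: (@smooth_mul (fun=> - k%:R)); first exact: smooth_cst.
    exact: smooth_flat.
  move=> x; apply: is_derive_of_line.
  rewrite (_ : (fun s : R => _) = @flat R k \o (fun s => a * s + b)); last first.
    by apply/funext => s /=; rewrite mxE eqxx.
  rewrite mulrC mulNr; apply: is_derive1_comp; first exact: is_derive_flat.
  have h1 : is_derive (x ord0 i) (1 : R) (fun s : R => a * s) a.
    have := @is_deriveZ _ _ _ (@id R) a (x ord0 i) 1 1 (is_derive_id _ _).
    by rewrite /GRing.scale/= mulr1.
  have := is_deriveD h1 (is_derive_cst b (x ord0 i) (1 : R)).
  by rewrite addr0.
- split=> [x|i]; first exact: cont_cst.
  exists (fun=> 0) => [|x]; first exact: smooth_cst.
  exact: is_derive_cst.
- split=> [x|i]; first exact: contD.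
  have [f' sf' f'P] := df i; have [g' sg' g'P] := dg i.
  exists (f' \+ g') => [|x]; first exact: smooth_add.
  exact: is_deriveD.
- split=> [x|i]; first exact: contM.
  have [f' sf' f'P] := df i; have [g' sg' g'P] := dg i.
  exists ((f \* g') \+ (g \* f')) => [|x].
    by apply: smooth_add; apply: smooth_mul.
  exact: is_deriveM.
Qed.

Lemma smooth_class_smooth f : smooth_class f -> smooth_on setT f.
Proof.
move=> sf k; elim: k f sf => [|k IH] f sf; have [cf df] := smooth_class_spec sf.
  by split=> // x _; exact: cf.
split; first by move=> x _; exact: cf.
move=> i; have [f' sf' f'P] := df i.
split; first by move=> x _; have [] := f'P x.
rewrite (_ : partial i f = f'); first exact: IH.
by apply/funext => x; rewrite /partial; have [_ ->] := f'P x.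
Qed.

Lemma smooth_class_prod m (f : 'I_m -> V -> R) : (forall i, smooth_class (f i)) ->
  smooth_class (fun x => \prod_i f i x).
Proof.
move=> sf; elim: m f sf => [|m IH] f sf.
  rewrite (_ : (fun x => _) = fun=> 1); first exact: smooth_cst.
  by apply/funext => x; rewrite big_ord0.
rewrite (_ : (fun x => _) = f ord0 \* (fun x => \prod_(i < m) f (lift ord0 i) x)).
  by apply: smooth_mul => //; exact: IH.
by apply/funext => x /=; rewrite big_ord_recl.
Qed.

(** It vanishes outside the open box with vertices l and u, and increases to 1
    inside as k tends to infinity. *)
Definition box_bump (l u : V) (k : nat) : V -> R := fun x =>
  \prod_(i < n.+1) (flat 0 (k.+1%:R * x ord0 i + - (k.+1%:R * l ord0 i)) *
    flat 0 (- k.+1%:R * x ord0 i + k.+1%:R * u ord0 i)).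

Lemma flat0_itv (t : R) : 0 <= flat 0 t <= 1.
Proof.
have [t0|t0] := leP t 0; first by rewrite flat_le0E// lexx ler01.
rewrite flat_gt0E// expr0 mul1r expR_ge0/= -expR0 ler_expR oppr_le0 invr_ge0.
exact: ltW.
Qed.

Lemma box_bump_itv l u k x : 0 <= box_bump l u k x <= 1.
Proof.
apply/andP; split.
  by apply: prodr_ge0 => i _; rewrite mulr_ge0//;
    have /andP[] := flat0_itv (k.+1%:R * x ord0 i + - (k.+1%:R * l ord0 i));
    have /andP[] := flat0_itv (- k.+1%:R * x ord0 i + k.+1%:R * u ord0 i).
apply: prodr_ile1 => i _.
have /andP[a0 a1] := flat0_itv (k.+1%:R * x ord0 i + - (k.+1%:R * l ord0 i)).
have /andP[b0 b1] := flat0_itv (- k.+1%:R * x ord0 i + k.+1%:R * u ord0 i).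
by rewrite mulr_ge0//= mulr_ile1.
Qed.

Lemma box_bump_out l u k x : ~ obox l u x -> box_bump l u k x = 0.
Proof.
move=> nx; apply/eqP; rewrite prodf_seq_eq0; apply/hasP.
have [i ni] : exists i, ~~ (x ord0 i \in `]l ord0 i, u ord0 i[).
  apply: contrapT => /forallNP h; apply: nx => i.
  by have := h i; move=> /negP; rewrite negbK.
exists i; first by rewrite mem_index_enum.
have k0 : 0 < k.+1%:R :> R by [].
move: ni; rewrite in_itv/= negb_and -!leNgt mulf_eq0 => /orP[xl|ux].
  by apply/orP; left; rewrite flat_le0E//; nra.
by apply/orP; right; rewrite flat_le0E//; nra.
Qed.

Lemma box_bump_cvg l u x : obox l u x -> box_bump l u k x @[k --> \oo] --> (1 : R).
Proof.
move=> xlu.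
have fl (c : R) : 0 < c -> (flat 0 (k.+1%:R * c) @[k --> \oo] --> (1 : R)).
  move=> c0.
  have -> : (fun k : nat => flat 0 (k.+1%:R * c)) = fun k => expR (- (c^-1 * k.+1%:R^-1)).
    apply/funext => k; rewrite flat_gt0E ?mulr_gt0// expr0 mul1r invfM.
    by rewrite mulrC.
  have H : c^-1 * (k.+1%:R)^-1 @[k --> \oo] --> c^-1 * 0.
    by apply: cvgM; [exact: cvg_cst|exact: cvg_harmonic].
  have {}H : - (c^-1 * (k.+1%:R)^-1) @[k --> \oo] --> - (c^-1 * 0) by exact: cvgN.
  have := @continuous_cvg _ _ _ _ _ _ (@expR R) _ (@continuous_expR R _) H.
  by rewrite mulr0 oppr0 expR0 => /(_ _); apply.
suff : box_bump l u k x @[k --> \oo] --> (\prod_(i < n.+1) (1 * 1) : R).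
  by rewrite (_ : \prod_(i < n.+1) (1 * 1) = 1)// big1// => i _; rewrite mulr1.
rewrite /box_bump; apply: cvg_big => [|i _]; first exact: mul_continuous.
have := xlu i; rewrite in_itv/= => /andP[lx xu].
apply: cvgM.
  have -> : (fun k : nat => flat 0 (k.+1%:R * x ord0 i + - (k.+1%:R * l ord0 i))) =
     fun k => flat 0 (k.+1%:R * (x ord0 i - l ord0 i)).
    by apply/funext => k; rewrite mulrBr.
  by apply: fl; rewrite subr_gt0.
have -> : (fun k : nat => flat 0 (- k.+1%:R * x ord0 i + k.+1%:R * u ord0 i)) =
     fun k => flat 0 (k.+1%:R * (u ord0 i - x ord0 i)).
  by apply/funext => k; congr flat; ring.
by apply: fl; rewrite subr_gt0.
Qed.

Lemma box_bump_test (Om : set V) l u k : cbox l u `<=` Om -> test_function Om (box_bump l u k).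
Proof.
move=> luO.
have cc : closed (cbox l u) by apply: compact_closed; [exact: norm_hausdorff|exact: cbox_compact].
have sub : closure [set x | box_bump l u k x != 0] `<=` cbox l u.
  rewrite [X in _ `<=` X]((closure_id _).1 cc); apply: closure_subset => x /= /eqP bx.
  apply: contrapT => nx; apply: bx; apply: box_bump_out => xo; apply: nx => i.
  by have := xo i; exact: subset_itv_oo_cc.
split.
- apply: smooth_class_smooth; apply: smooth_class_prod => i.
  by apply: smooth_mul; exact: smooth_flat.
- by apply: subclosed_compact sub; [exact: closed_closure|exact: cbox_compact].
- by move=> x /sub/luO.
Qed.

End test_functions.

(** * Integration by parts and uniqueness of weak gradients *)

Section boxed.
Variable R : realType.
Local Notation lam := (@lebesgue_measure R).

(** Boundedness and support in a fixed cube, the two properties that make all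
    the Fubini arguments below legitimate and that pass to slices. *)
Definition boxed n (f : 'rV[R]_n -> R) (M B : R) :=
  [/\ measurable_fun setT (f : _ -> measurableTypeR R), forall x, `|f x| <= M &
      forall x, ~ cbox (const_mx (- B)) (const_mx B) x -> f x = 0].

Lemma boxed_integrable n (f : 'rV[R]_n -> R) M B : boxed f M B ->
  (@lebesgue_rV R n).-integrable setT (EFin \o f).
Proof.
move=> [mf fM fB].
have mC : measurable (cbox (const_mx (- B)) (const_mx B) : set 'rV[R]_n).
  exact: measurable_cbox.
have iC : (@lebesgue_rV R n).-integrable (cbox (const_mx (- B)) (const_mx B)) (EFin \o f).
  apply: measurable_bounded_integrable => //; first exact: lebesgue_cbox_lty.
    exact: measurable_funTS.
  exists M; split; first exact: num_real.
  by move=> N MN x _; exact: le_trans (fM x) (ltW MN).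
have := (@integrable_mkcond _ _ _ (@lebesgue_rV R n) _ (EFin \o f) mC).1 iC.
apply: eq_integrable => // x _; rewrite patchE; case: ifPn => //.
by rewrite notin_setE => /fB; rewrite /= => ->.
Qed.

Lemma boxed_slice n (f : 'rV[R]_n.+1 -> R) M B a : boxed f M B ->
  boxed (fun x => f (rV_cons (a, x))) M B.
Proof.
move=> [mf fM fB]; split=> //.
  by apply: (measurableT_comp mf); exact: measurable_rV_cons1.
move=> x nx; apply: fB => xB; apply: nx => i.
by have := xB (lift ord0 i); rewrite !mxE liftK.
Qed.

Lemma boxed_integrable_cons n (f : 'rV[R]_n.+1 -> R) M B : boxed f M B ->
  (lam \x @lebesgue_rV R n)%E.-integrable setT (EFin \o f \o @rV_cons R n).
Proof.
move=> fb; have /integrableP[_] := boxed_integrable fb; have [mf _ _] := fb.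
move=> fi; apply/integrableP; split.
  by apply: measurable_rV_cons_comp; exact/measurable_EFinP.
move: fi; rewrite {1}/lebesgue_rV/= /lebesgue_rV_step ge0_integral_pushforward//.
- exact: measurable_rV_cons.
- by apply/measurable_EFinP; exact: (measurableT_comp (@normr_measurable R setT)).
Qed.

Lemma integral_boxedE n (f : 'rV[R]_n.+1 -> R) M B : boxed f M B ->
  (\int[@lebesgue_rV R n.+1]_x (f x)%:E =
   \int[lam \x @lebesgue_rV R n]_z (f (rV_cons z))%:E)%E.
Proof.
move=> fb; have [mf _ _] := fb; rewrite {1}/lebesgue_rV/= /lebesgue_rV_step.
rewrite integral_pushforward//.
- exact: measurable_rV_cons.
- exact/measurable_EFinP.
- by rewrite preimage_setT; exact: boxed_integrable_cons fb.
Qed.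

(** Fubini, with the i-th variable integrated first; the induction brings the
    i-th coordinate to the front. *)
Lemma integral_zero_lines n (f : 'rV[R]_n -> R) M B i : boxed f M B ->
  (forall x, (\int[lam]_t (f (upd x i t))%:E = 0)%E) ->
  (\int[@lebesgue_rV R n]_x (f x)%:E = 0)%E.
Proof.
elim: n f i => [f []//|n IH f i fb f0].
rewrite (integral_boxedE fb).
have ic := boxed_integrable_cons fb.
case: (unliftP ord0 i) f0 => [j ->|->] f0.
  rewrite -(integral12_prod_meas1 ic) /fubini_F/=.
  under eq_integral => a _.
    rewrite (IH (fun x => f (rV_cons (a, x))) j (boxed_slice a fb)); last first.
      by move=> x; rewrite -[RHS](f0 (rV_cons (a, x))); under [RHS]eq_integral do rewrite upd_cons_lift.
    over.
  by rewrite integral0.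
rewrite -(integral21_prod_meas1 ic) /fubini_G/=.
under eq_integral => x _.
  have -> : (\int[lam]_a (f (rV_cons (a, x)))%:E = 0)%E.
    by rewrite -[RHS](f0 (rV_cons (0, x))); under [RHS]eq_integral do rewrite upd_cons0.
  over.
by rewrite integral0.
Qed.

End boxed.

Section integration_by_parts.
Variables (R : realType) (n : nat) (Om : set 'rV[R]_n.+1) (B : R).
Local Notation V := 'rV[R]_n.+1.
Local Notation mu := (@lebesgue_rV R n.+1).
Local Notation lam := (@lebesgue_measure R).
Hypotheses (oOm : open Om) (OB : forall x, Om x -> forall i, `|x ord0 i| <= B).
Implicit Types phi psi : V -> R.

Lemma C1c_partial_out phi i : C1c Om phi ->
  exists2 K, closed K /\ K `<=` Om & forall x, ~ K x -> phi x = 0 /\ partial i phi x = 0.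
Proof.
move=> [_ _ _ [K KP phiK]]; exists K => // x nK; split; first exact: phiK.
rewrite /partial.
have NE : \forall y \near x, cst 0 y = phi y.
  have : \forall y \near x, ~ K y.
    by apply: open_nbhs_nbhs; split => //; rewrite openC; case: KP.
  by apply: filterS => y /phiK ->.
by have [_ ->] := near_eq_is_derive NE (is_derive_cst (0 : R) x (delta_mx ord0 i : V)).
Qed.

Lemma C1cM phi psi : C1c Om phi -> C1c Om psi -> C1c Om (phi \* psi) /\
  forall i x, partial i (phi \* psi) x = phi x * partial i psi x + psi x * partial i phi x.
Proof.
move=> [cphi dphi cdphi [K KP phiK]] [cpsi dpsi cdpsi _].
have E i x : partial i (phi \* psi) x = phi x * partial i psi x + psi x * partial i phi x.
  exact: (deriveM (dphi i x) (dpsi i x)).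
split; last exact: E.
split.
- by move=> x; exact: (@contM R V x _ _ (cphi x) (cpsi x)).
- by move=> i x; exact: (derivableM (dphi i x) (dpsi i x)).
- move=> i; rewrite (_ : partial i _ = fun x => phi x * partial i psi x + psi x * partial i phi x).
    move=> x; exact: (@contD R V x _ _ (@contM R V x _ _ (cphi x) (cdpsi i x))
      (@contM R V x _ _ (cpsi x) (cdphi i x))).
  by apply/funext => x; exact: E.
- by exists K => // x /phiK /= ->; rewrite mul0r.
Qed.

Lemma continuous_bounded_supp (f : V -> R) : continuous f ->
  (exists2 K, closed K /\ K `<=` Om & forall x, ~ K x -> f x = 0) ->
  exists M, boxed f M B.
Proof.
move=> cf [K [cK KO] fK].
have KB : K `<=` cbox (const_mx (- B)) (const_mx B).
  by move=> x /KO/OB xB i; rewrite !mxE in_itv/= -ler_norml.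
have kK : compact K by exact: subclosed_compact cK (@cbox_compact _ _ _ _) KB.
have : compact ((fun x => `|f x|) @` K).
  apply: continuous_compact => //; apply: continuous_subspaceT => x.
  exact: cont_norm (cf x).
move=> /compact_bounded[M [_ KM]].
have M1 : M < `|M| + 1 by rewrite (le_lt_trans (ler_norm M))// ltrDl.
exists (`|M| + 1); split.
- by apply: open_continuous_measurable_rV => [|x _]; [exact: openT|exact: cf].
- move=> x; have [Kx|nKx] := pselect (K x); last by rewrite fK// normr0 addr_ge0.
  have := KM _ M1 `|f x|; rewrite /= normr_id; apply.
  by exists x.
- by move=> x nx; apply: fK => /KB.
Qed.

Lemma C1c_boxed phi : C1c Om phi -> exists M, boxed phi M B.
Proof.
move=> phiC; have [cphi _ _ [K KP phiK]] := phiC.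
by apply: continuous_bounded_supp => //; exists K.
Qed.

Lemma C1c_partial_boxed phi i : C1c Om phi -> exists M, boxed (partial i phi) M B.
Proof.
move=> phiC; have [_ _ cdphi _] := phiC; have [K KP phiK] := C1c_partial_out i phiC.
by apply: continuous_bounded_supp; [exact: cdphi|exists K => // x /phiK[]].
Qed.

(** On each line the fundamental theorem of calculus applies to a function that
    vanishes at both ends. *)
Lemma integral_partial_eq0 phi i : C1c Om phi -> (\int[mu]_x (partial i phi x)%:E = 0)%E.
Proof.
move=> phiC; have [M pM] := C1c_partial_boxed i phiC.
apply: (integral_zero_lines (i := i) pM) => x.
have [cphi dphi cdphi _] := phiC.
have [M' [_ _ phiB]] := C1c_boxed phiC.
have [_ _ dphiB] := pM.
pose b : R := `|B| + 1.
have out t : b <= `|t| -> ~ cbox (const_mx (- B)) (const_mx B) (upd x i t).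
  move=> bt /(_ i); rewrite !mxE eqxx in_itv/= -ler_norml.
  by apply/negP; rewrite -ltNge; apply: lt_le_trans bt; rewrite /b (le_lt_trans (ler_norm B))// ltrDl.
have b0 : 0 < b by rewrite /b ltr_wpDl.
have -> : (\int[lam]_t (partial i phi (upd x i t))%:E =
   \int[lam]_(t in `[(- b)%R, b]) (partial i phi (upd x i t))%:E)%E.
  rewrite [RHS]integral_mkcond; apply: eq_integral => t _; rewrite patchE.
  case: ifPn => //; rewrite notin_setE => /= nt; rewrite dphiB//; apply: out.
  by move: nt; rewrite in_itv/= -ler_norml => /negP; rewrite -ltNge => /ltW.
have cline (f : V -> R) : continuous f -> continuous (fun t => f (upd x i t)).
  by move=> cf t; apply: continuous_comp; [exact: upd_continuous|exact: cf].
have dl t := is_derive_line (dphi i (upd x i t)).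
rewrite (@continuous_FTC2 _ _ (fun t => phi (upd x i t))).
- by rewrite !phiB ?subee//; apply: out; rewrite ?normrN ger0_norm// ltW.
- by rewrite -subr_gt0 opprK addr_gt0.
- by apply: continuous_subspaceT; exact: cline.
- split.
  + by move=> t _; have [] := dl t.
  + by apply: cvg_at_right_filter; exact: (cline _ cphi).
  + by apply: cvg_at_left_filter; exact: (cline _ cphi).
- by move=> t _; rewrite derive1E; have [_ ->] := dl t.
Qed.

Lemma boxed_mul (f g : V -> R) M1 M2 : boxed f M1 B -> boxed g M2 B ->
  boxed (fun x => f x * g x) (M1 * M2) B.
Proof.
move=> [mf fM fB] [mg gM gB]; split; first exact: measurable_funM.
- by move=> x; rewrite normrM; apply: ler_pM.
- by move=> x /fB ->; rewrite mul0r.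
Qed.

(** The product has compact support, so its partial derivative has integral 0. *)
Lemma integral_by_parts phi psi i : C1c Om phi -> C1c Om psi ->
  \int[mu]_(x in Om) (phi x * partial i psi x) =
  - \int[mu]_(x in Om) (partial i phi x * psi x).
Proof.
move=> phiC psiC; have [wC wE] := C1cM phiC psiC.
have [M1 b1] := C1c_boxed phiC; have [M2 b2] := C1c_boxed psiC.
have [M3 b3] := C1c_partial_boxed i phiC; have [M4 b4] := C1c_partial_boxed i psiC.
have i1 := integrableS measurableT (open_measurable_rV oOm) (@subsetT _ _) (boxed_integrable (boxed_mul b1 b4)).
have i2 := integrableS measurableT (open_measurable_rV oOm) (@subsetT _ _) (boxed_integrable (boxed_mul b3 b2)).
apply/eqP; rewrite -addr_eq0 -RintegralD//; last exact: open_measurable_rV.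
rewrite /Rintegral (_ : (\int[mu]_(x in Om) _)%E = 0%E)//.
rewrite -[RHS](integral_partial_eq0 i wC) integral_mkcond.
apply: eq_integral => x _; rewrite patchE wE; case: ifPn => [_|].
  by rewrite [psi x * _]mulrC.
rewrite notin_setE => nx; have [K [_ KO] KP] := C1c_partial_out i phiC.
have [|-> ->] := KP x; first by move=> /KO.
by rewrite mul0r mulr0 addr0.
Qed.

Lemma test_function_C1c phi : test_function Om phi -> C1c Om phi.
Proof.
move=> [sphi _ clO]; split.
- by move=> x; have [+ _] := sphi 0%N; apply; rewrite inE.
- by move=> i x; have [_ /(_ i)[+ _]] := sphi 1%N; apply; rewrite inE.
- by move=> i x; have [_ /(_ i)[_ [+ _]]] := sphi 1%N; apply; rewrite inE.
- exists (closure [set x | phi x != 0]) => [|x nx]; first by split=> //; exact: closed_closure.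
  apply: contrapT => /eqP px; apply: nx; exact: subset_closure.
Qed.

Definition grad (phi : V -> R) : V -> V := fun x => \row_i partial i phi x.

(** Classical and weak gradients agree, by integration by parts. *)
Lemma weak_gradient_C1c phi : C1c Om phi -> weak_gradient Om phi (grad phi).
Proof.
move=> phiC.
have locint (f : V -> R) M : boxed f M B -> loc_integrable Om f.
  move=> fb K cK KO; apply: integrableS (boxed_integrable fb) => //.
  apply: closed_measurable_rV; apply: compact_closed => //; exact: norm_hausdorff.
split.
- by have [M] := C1c_boxed phiC; exact: locint.
- move=> i; have [M pM] := C1c_partial_boxed i phiC; apply: (locint _ M).
  by rewrite (_ : (fun x => _) = partial i phi)//; apply/funext => x; rewrite mxE.
- move=> i psi /test_function_C1c psiC; rewrite (integral_by_parts i phiC psiC).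
  by congr (- _); apply: eq_Rintegral => x _; rewrite mxE.
Qed.

End integration_by_parts.

Section fundamental_lemma.
Variables (R : realType) (n : nat) (Om : set 'rV[R]_n.+1).
Local Notation V := 'rV[R]_n.+1.
Local Notation mu := (@lebesgue_rV R n.+1).
Hypothesis oOm : open Om.

Lemma loc_integrable_test (D phi : V -> R) : loc_integrable Om D ->
  test_function Om phi -> mu.-integrable Om (EFin \o (fun x => D x * phi x)).
Proof.
move=> lD [sphi cphi clO]; set K := closure _ in cphi clO.
have ck : closed K by exact: closed_closure.
have mK : measurable K by exact: closed_measurable_rV.
have mO : measurable Om by exact: open_measurable_rV.
have cf : continuous phi.
  by move=> x; have [+ _] := sphi 0%N; apply; rewrite inE.
have iK : mu.-integrable K (EFin \o (fun x => D x * phi x)).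
  rewrite (_ : _ \o _ = (EFin \o D) \* (EFin \o phi))%E; last by apply/funext.
  apply: integrableMl => //; first exact: lD.
  - apply: measurable_funTS.
    by apply: open_continuous_measurable_rV => [|x _]; [exact: openT|exact: cf].
  - have : compact ((fun x => `|phi x|) @` K).
      apply: continuous_compact => //; apply: continuous_subspaceT => x.
      exact: cont_norm (cf x).
    move=> /compact_bounded[M [rM KM]]; exists M; split => // N MN x Kx.
    have := KM _ MN `|phi x|; rewrite /= normr_id; apply.
    by exists x.
apply/integrable_mkcond => //.
have /integrable_mkcond := iK => /(_ mK); apply: eq_integrable => // x _.
rewrite !patchE; case: ifPn => xK.
  by rewrite mem_set//; apply: clO; exact: set_mem.
case: ifPn => // _ /=; suff -> : phi x = 0 by rewrite mulr0.
apply: contrapT => /eqP px; move: xK; rewrite notin_setE; apply.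
exact: subset_closure.
Qed.

Lemma integral_obox_eq0 (D : V -> R) (l u : V) : loc_integrable Om D ->
  (forall phi, test_function Om phi -> \int[mu]_(x in Om) (D x * phi x) = 0) ->
  cbox l u `<=` Om -> (\int[mu]_(x in obox l u) (D x)%:E = 0)%E.
Proof.
move=> lD D0 luO.
have mC : measurable (cbox l u) by exact: measurable_cbox.
have mB : measurable (obox l u) by exact: measurable_obox.
have mO : measurable Om by exact: open_measurable_rV.
have BC : obox l u `<=` cbox l u by move=> x xB i; have := xB i; exact: subset_itv_oo_cc.
have iD : mu.-integrable (cbox l u) (EFin \o D) by apply: lD => //; exact: cbox_compact.
have mD := measurable_int _ iD.
pose f k x := (D x * box_bump l u k x)%:E.
have mb k : measurable_fun setT (box_bump l u k : V -> measurableTypeR R).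
  apply: open_continuous_measurable_rV => [|x _]; first exact: openT.
  have [s _ _] := box_bump_test k luO; have [+ _] := s 0%N; apply.
  by rewrite inE.
have mf k : measurable_fun (cbox l u) (f k).
  apply/measurable_EFinP; apply: measurable_funM; first exact/measurable_EFinP.
  exact: (@measurable_funTS _ _ V R (cbox l u) _ (mb k)).
pose g x := ((EFin \o D) \_ (obox l u)) x.
have mg : measurable_fun (cbox l u) g.
  apply: measurable_funTS; apply/(measurable_restrictT _ mB).
  exact: measurable_funS mD.
have [] := @dominated_convergence _ _ _ mu _ mC f g (abse \o (EFin \o D)) mf mg.
- apply: aeW => x xC; rewrite /g patchE; case: ifPn => [/set_mem xB|].
    rewrite /f /= -[X in _ --> X%:E]mulr1; apply: cvg_EFin; first by near=> k.
    rewrite (_ : fine \o _ = fun k => D x * box_bump l u k x); last by apply/funext.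
    by apply: cvgM; [exact: cvg_cst|exact: box_bump_cvg].
  rewrite notin_setE => xB; rewrite /f.
  rewrite (_ : (fun k => _) = fun=> 0%E); first exact: cvg_cst.
  by apply/funext => k; rewrite box_bump_out// mulr0.
- exact: integrable_abse.
- apply: aeW => x k _ /=; rewrite lee_fin normrM ler_piMr//.
  by have /andP[b0 b1] := box_bump_itv l u k x; rewrite ger0_norm.
move=> _ _ H.
have -> : (\int[mu]_(x in obox l u) (D x)%:E = \int[mu]_(x in cbox l u) g x)%E.
  rewrite [LHS]integral_mkcond [RHS]integral_mkcond; apply: eq_integral => x _.
  rewrite /g !patchE; case: ifPn => xB; first by rewrite mem_set//; apply/BC/set_mem.
  by case: ifPn.
have E0 k : (\int[mu]_(x in cbox l u) f k x = 0)%E.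
  have tb := box_bump_test k luO; have := D0 _ tb; rewrite /Rintegral => fz.
  have iO := loc_integrable_test lD tb.
  have : (\int[mu]_(x in Om) (D x * box_bump l u k x)%:E = 0)%E.
    by have := integrable_fin_num mO iO => /fineK <-; rewrite fz.
  move=> <-; rewrite [LHS]integral_mkcond [RHS]integral_mkcond.
  apply: eq_integral => x _; rewrite !patchE; case: ifPn => xC.
    by rewrite mem_set//; apply/luO/set_mem.
  case: ifPn => // _; rewrite box_bump_out ?mulr0// => /BC.
  by move: xC; rewrite notin_setE.
have H0 : (\int[mu]_(x in cbox l u) f k x)%E @[k --> \oo] --> 0%E.
  by rewrite (funext E0); exact: cvg_cst.
exact: (cvg_unique _ H H0).
Unshelve. all: by end_near. Qed.

(** Testing against bumps that tend to the indicator of a box shows that D has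
    integral 0 over all boxes contained in Om, and these determine D almost
    everywhere. *)
Lemma fundamental_lemma (D : V -> R) : loc_integrable Om D ->
  (forall phi, test_function Om phi -> \int[mu]_(x in Om) (D x * phi x) = 0) ->
  {ae mu, forall x, Om x -> D x = 0}.
Proof.
move=> lD D0; have [l [u [luO Olu]]] := open_cover_boxes oOm.
have H k : {ae mu, forall x, obox (l k) (u k) x -> (EFin \o D) x = 0%E}.
  apply: integral_boxes_eq0 => [|l' u'].
    apply: integrableS (lD _ (@cbox_compact _ _ _ _) (luO k)).
    - exact: measurable_cbox.
    - exact: measurable_obox.
    - by move=> x xB i; have := xB i; exact: subset_itv_oo_cc.
  have [l2 [u2 E]] : oboxes (obox (l k) (u k) `&` obox l' u').
    by apply: oboxes_setI; eexists; eexists.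
  pose l3 : V := \row_i Num.max (l k ord0 i) (l' ord0 i).
  pose u3 : V := \row_i Num.min (u k ord0 i) (u' ord0 i).
  have -> : obox (l k) (u k) `&` obox l' u' = obox l3 u3.
    apply/seteqP; split => [x [xA xB] i|x xAB].
      have := xA i; have := xB i; rewrite !in_itv/= !mxE gt_max lt_min.
      by move=> /andP[-> ->] /andP[-> ->].
    by split => i; have := xAB i; rewrite !in_itv/= !mxE gt_max lt_min;
      move=> /andP[/andP[? ?] /andP[? ?]]; apply/andP.
  apply: integral_obox_eq0 => // x x3; apply: (luO k) => i.
  have := x3 i; rewrite !in_itv/= !mxE ge_max le_min.
  by move=> /andP[/andP[-> _] /andP[-> _]].
have := ae_foralln H; apply: filterS => x hx /Olu[k _ /hx].
by move=> [].
Qed.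

(** It is what identifies the gradient chosen by wgrad, up to a null set, with
    one obtained by computation. *)
Lemma weak_gradient_unique (u : V -> R) G G' : weak_gradient Om u G ->
  weak_gradient Om u G' -> {ae mu, forall x, Om x -> G x = G' x}.
Proof.
move=> [_ lG HG] [_ lG' HG'].
have mO : measurable Om by exact: open_measurable_rV.
have H i : {ae mu, forall x, Om x -> G x ord0 i - G' x ord0 i = 0}.
  apply: fundamental_lemma.
    move=> K cK KO; have := integrableB _ (lG i _ cK KO) (lG' i _ cK KO).
    apply; apply: closed_measurable_rV; apply: compact_closed => //; exact: norm_hausdorff.
  move=> phi tphi.
  have i1 := loc_integrable_test (lG i) tphi; have i2 := loc_integrable_test (lG' i) tphi.
  under eq_Rintegral do rewrite mulrBl.
  rewrite RintegralB//; apply/eqP; rewrite subr_eq0; apply/eqP/oppr_inj.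
  by rewrite -HG// -HG'.
have : {ae mu, forall x, forall i, Om x -> G x ord0 i - G' x ord0 i = 0}.
  have := @ae_foralln _ _ _ mu (fun k x => forall i : 'I_n.+1, i = k :> nat -> Om x ->
    G x ord0 i - G' x ord0 i = 0) => /(_ _)/filterS; apply.
    by move=> x hx i; exact: hx.
  move=> k; have [kn|kn] := ltnP k n.+1; last first.
    by apply: aeW => x i ik; move: kn; rewrite -ik leqNgt ltn_ord.
  apply: filterS (H (Ordinal kn)) => x hx i ik; rewrite (_ : i = Ordinal kn)//.
  exact: val_inj.
apply: filterS => x hx Ox; apply/rowP => i; apply/eqP; rewrite -subr_eq0; apply/eqP.
exact: hx.
Qed.

End fundamental_lemma.

(** * The Riesz kernel *)

(** Monotonicity for arbitrary functions: the integral of a nonnegative function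
    is a supremum over the simple functions below it. *)
Lemma integral_le_dominated d (T : measurableType d) (R : realType)
    (mu : {measure set T -> \bar R}) (D : set T) (f g : T -> \bar R) :
  (forall x, D x -> (0 <= f x)%E) -> (forall x, D x -> (f x <= g x)%E) ->
  (\int[mu]_(x in D) f x <= \int[mu]_(x in D) g x)%E.
Proof.
move=> f0 fg; have g0 x : D x -> (0 <= g x)%E by move=> Dx; exact: le_trans (f0 _ Dx) (fg _ Dx).
rewrite !ge0_integralE//; apply: le_ereal_sup => _ [h hf <-]; exists h => // x.
apply: (le_trans (hf x)); apply: lee_restrict => y Dy; exact: fg.
Qed.

Lemma abse_integral_le_dominated d (T : measurableType d) (R : realType)
    (mu : {measure set T -> \bar R}) (D : set T) (f : T -> R) (g : T -> R) (C : R) :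
  (forall x, D x -> `|f x| <= g x) ->
  (\int[mu]_(x in D) (g x)%:E <= C%:E)%E ->
  (`|\int[mu]_(x in D) (f x)%:E| <= C%:E)%E.
Proof.
move=> fg gC; rewrite integralE.
have bnd (h : T -> \bar R) : (forall x, (0 <= h x)%E) -> (forall x, (h x <= `|(f x)%:E|)%E) ->
    (0 <= \int[mu]_(x in D) h x <= C%:E)%E.
  move=> h0 hf; rewrite integral_ge0//=; apply: le_trans gC.
  apply: integral_le_dominated => // x Dx; apply: (le_trans (hf x)).
  by rewrite abse_EFin lee_fin fg.
have pf x : ((EFin \o f)^\+ x <= `|(f x)%:E|)%E.
  by rewrite funeposE ge_max abse_ge0 lee_abs.
have nf x : ((EFin \o f)^\- x <= `|(f x)%:E|)%E.
  by rewrite funenegE ge_max abse_ge0 -abseN lee_abs.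
have finE (x : \bar R) : (0 <= x <= C%:E)%E -> exists2 y, x = y%:E & 0 <= y <= C.
  by case: x => [y h| |]; [exists y|rewrite leye_eq andbF|].
have gen (a b : \bar R) : (0 <= a <= C%:E)%E -> (0 <= b <= C%:E)%E -> (`|a - b| <= C%:E)%E.
  move=> /finE[y -> /andP[y0 yC]] /finE[z -> /andP[z0 zC]].
  by rewrite -EFinB abse_EFin lee_fin ler_norml; apply/andP; split; lra.
exact: gen (bnd _ (@funepos_ge0 _ _ (EFin \o f)) pf) (bnd _ (@funeneg_ge0 _ _ (EFin \o f)) nf).
Qed.

Lemma coord_le_norm (R : realType) n (x : 'rV[R]_n.+1) i : `|x ord0 i| <= `|x|.
Proof.
rewrite [leRHS]mx_normrE.
exact: le_trans (@le_bigmax _ _ _ _ (fun ij : 'I_1 * 'I_n.+1 => `|x ij.1 ij.2|) (ord0, i)).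
Qed.

Section riesz_kernel.
Variables (R : realType) (n : nat).
Local Notation V := 'rV[R]_n.+1.
Local Notation mu := (@lebesgue_rV R n.+1).

Lemma cubeE (x : V) (r : R) : 0 <= r -> [set y | `|x - y| <= r] =
    [set y : V | forall i, [set` `[x ord0 i - r, x ord0 i + r]] (y ord0 i)].
Proof.
move=> r0; apply/seteqP; split => y /=.
  move=> xy i; rewrite /= in_itv/= -ler_distl distrC; apply: le_trans xy.
  by have := coord_le_norm (x - y) i; rewrite !mxE.
move=> xy; rewrite [leLHS]mx_normrE; apply: bigmax_le => // -[i j] _ /=.
by have := xy j; rewrite /= in_itv/= -ler_distl distrC !mxE (ord1 i).
Qed.

Lemma lebesgue_cube (x : V) (r : R) : 0 <= r ->
  mu [set y | `|x - y| <= r] = ((2 * r) ^+ n.+1)%:E.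
Proof.
move=> r0; rewrite cubeE//.
rewrite (@lebesgue_rV_box _ _ (fun i => [set` `[x ord0 i - r, x ord0 i + r]]))//.
rewrite (eq_bigr (fun=> (2 * r)%:E)); last first.
  move=> i _; rewrite lebesgue_measure_itv/= lte_fin.
  case: ltP => h; first by rewrite -EFinB; congr EFin; ring.
  by have -> : r = 0; [lra|rewrite mulr0].
elim: n.+1 => [|m IH]; first by rewrite big_ord0 expr0.
by rewrite big_ord_recl IH exprS EFinM.
Qed.

Lemma measurable_cube (x : V) (r : R) : 0 <= r -> measurable [set y | `|x - y| <= r].
Proof.
move=> r0; rewrite cubeE//.
exact: (@measurable_coord_set _ _ (fun i => [set` `[x ord0 i - r, x ord0 i + r]])
  (fun i => measurable_itv _)).
Qed.

Lemma nneseries_geometric_le (A th : R) : 0 <= A -> 0 <= th -> th < 1 ->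
  (\sum_(j <oo) (A * th ^+ j)%:E <= (A / (1 - th))%:E)%E.
Proof.
move=> A0 th0 th1; have d0 : 0 < 1 - th by lra.
apply: lime_le.
  by apply: is_cvg_nneseries => j _ _; rewrite lee_fin mulr_ge0// exprn_ge0.
apply: nearW => m; rewrite sumEFin lee_fin.
have th_neq1 : th != 1 by rewrite lt_eqF.
have := geometric_seriesE A th_neq1 => /(congr1 (fun u => u m)) /=.
rewrite /series/= => ->; apply: ler_wpM2r; first by rewrite invr_ge0 ltW.
by rewrite ler_piMr// lerBlDr lerDl exprn_ge0.
Qed.

(** Dyadic decomposition: on the cube of radius D / 2 ^ j around x the kernel is
    replaced by its value at radius D / 2 ^ (j + 1), and the resulting integrals
    form a geometric series of ratio 2 ^ (b - n - 1). *)
Lemma integral_riesz_le (Om : set V) (B b : R) : measurable Om ->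
  (forall x, Om x -> forall i, `|x ord0 i| <= B) -> 0 < b < n.+1%:R ->
  exists2 C, 0 <= C & forall x, Om x ->
    (\int[mu]_(y in Om) (`|x - y| `^ (- b))%:E <= C%:E)%E.
Proof.
move=> mO OB /andP[b0 bN].
pose D : R := 2 * `|B| + 1.
have D0 : 0 < D by rewrite /D ltr_wpDl// mulr_ge0.
pose rho j : R := D * 2^-1 ^+ j.
have h0 : 0 < 2^-1 :> R by rewrite invr_gt0.
have rho0 j : 0 < rho j by rewrite /rho mulr_gt0// exprn_gt0.
pose c j := rho j.+1 `^ (- b).
have c0 j : 0 <= c j by exact: powR_ge0.
pose A := (D / 2) `^ (- b) * (2 * D) ^+ n.+1.
pose th : R := 2^-1 `^ (- b) * 2^-1 ^+ n.+1.
have A0 : 0 <= A by rewrite /A mulr_ge0 ?powR_ge0// exprn_ge0// mulr_ge0// ltW.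
have th0 : 0 <= th by rewrite /th mulr_ge0 ?powR_ge0// exprn_ge0// ltW.
have th1 : th < 1.
  rewrite /th -powR_mulrn ?(ltW h0)// -powRD; last by rewrite implybE orbC gt_eqF.
  have l2 : 0 < ln (2 : R) by rewrite ln_gt0// ltr1n.
  by rewrite /powR gt_eqF// expR_lt1 lnV ?posrE//; nra.
have cE j : c j * (2 * rho j) ^+ n.+1 = A * th ^+ j.
  have pE m : (2^-1 ^+ m) `^ (- b) = (2^-1 `^ (- b)) ^+ m :> R.
    by rewrite -powR_mulrn ?powR_ge0// -powRrM mulrC powRrM powR_mulrn// ltW.
  rewrite /c /rho /A /th !powRM ?exprn_ge0 ?(ltW D0) ?(ltW h0)// pE.
  by rewrite !exprMn -!exprM [(j * n.+1)%N]mulnC exprS; ring.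
exists (A / (1 - th)) => [|x Ox]; first by rewrite divr_ge0// subr_ge0 ltW.
pose f j y := (c j * \1_[set y | `|x - y| <= rho j] y)%:E.
have mf j : measurable_fun Om (f j).
  apply/measurable_EFinP; apply: measurable_funM; first exact: measurable_cst.
  by apply: measurable_indic; apply: measurable_cube; exact: ltW.
have f0 j y : (0 <= f j y)%E by rewrite lee_fin mulr_ge0.
apply: (@le_trans _ _ (\int[mu]_(y in Om) (\sum_(j <oo) f j y))%E).
  apply: integral_le_dominated => y Oy; first by rewrite lee_fin powR_ge0.
  have [->|xy] := eqVneq x y.
    rewrite subrr normr0 powR0 ?oppr_eq0 ?gt_eqF//.
    by apply: nneseries_ge0 => j _ _.
  have xy0 : 0 < `|x - y| by rewrite normr_gt0 subr_eq0.
  have xyD : `|x - y| <= D.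
    rewrite [leLHS]mx_normrE; apply: bigmax_le; first exact: ltW.
    move=> [i k] _ /=; rewrite !mxE (ord1 i); apply: (le_trans (ler_normB _ _)).
    have := OB _ Ox k; have := OB _ Oy k; have := ler_norm B; rewrite /D; lra.
  have exj : exists j, rho j.+1 < `|x - y|.
    have hlt1 : `|2^-1| < 1 :> R by rewrite ger0_norm ?(ltW h0)// invf_lt1// ltr1n.
    have := @cvg_geometric _ (D / 2) _ hlt1.
    move=> /cvgrPdist_lt/(_ _ xy0)[j _ /(_ j (leqnn j))] /= hj.
    exists j; move: hj; rewrite sub0r normrN ger0_norm.
      by rewrite /rho exprS mulrA.
    by rewrite mulr_ge0 ?exprn_ge0 ?divr_ge0// ltW.
  have [j hj minj] := ex_minnP exj.
  have xyj : `|x - y| <= rho j.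
    case: j hj minj => [|j] hj minj; first by rewrite /rho expr0 mulr1.
    by rewrite leNgt; apply/negP => /minj; rewrite ltnn.
  apply: (@le_trans _ _ (f j y)).
    rewrite lee_fin indicE mem_set// mulr1 /c !powRN lef_pV2 ?posrE ?powR_gt0//.
    apply: ge0_ler_powR; rewrite ?nnegrE ?(ltW b0) ?(ltW (rho0 _))//.
    exact: ltW.
  have := @nneseries_lim_ge R (fun j => f j y) xpredT 0 j.+1 (fun i _ _ => f0 i y).
  by apply: le_trans; rewrite big_nat_recr//= leeDr// sume_ge0.
rewrite integral_nneseries//.
apply: le_trans (nneseries_geometric_le A0 th0 th1).
apply: lee_nneseries => j _; first by move=> _; exact: integral_ge0.
rewrite -cE /f.
under eq_integral do rewrite EFinM.
rewrite ge0_integralZl_EFin//; last first.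
  by apply/measurable_EFinP; apply: measurable_indic; apply: measurable_cube; exact: ltW.
rewrite EFinM; apply: lee_wpmul2l; first by rewrite lee_fin.
rewrite integral_indic//; last by apply: measurable_cube; exact: ltW.
rewrite -(lebesgue_cube x); last exact: ltW.
apply: le_measure; rewrite ?inE//; last by apply: measurable_cube; exact: ltW.
by apply: measurableI => //; apply: measurable_cube; exact: ltW.
Qed.

End riesz_kernel.

(** * Double integrals against the Riesz kernel *)

(** The left-hand side is a weighted geometric mean of the three terms on the
    right, with weights 2 / t - 1, 1 - 1 / t and 1 - 1 / t. The value of s is
    forced by the homogeneity in k. *)
Lemma mul3_powR_le (R : realType) (a b k t : R) : 0 <= a -> 0 <= b -> 0 <= k ->
  1 < t < 2 -> forall s, s = t / (2 * (t - 1)) ->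
  a * b * k <= a `^ t * b `^ t + a `^ t * k `^ s + b `^ t * k `^ s.
Proof.
move=> a0 b0 k0 /andP[t1 t2] s sE; set M := leRHS.
have M0 : 0 <= M by rewrite /M !addr_ge0// mulr_ge0// powR_ge0.
have tt0 : t != 0 by rewrite gt_eqF//; lra.
have t10 : t - 1 != 0 by rewrite gt_eqF//; lra.
pose w2 := (t - 1) / t; pose w1 := 2 / t - 1.
have w20 : 0 <= w2 by rewrite /w2 divr_ge0//; lra.
have w10 : 0 <= w1 by rewrite /w1 subr_ge0 ler_pdivlMr; lra.
have X : a * b * k = (a `^ t * b `^ t) `^ w1 * (a `^ t * k `^ s) `^ w2 * (b `^ t * k `^ s) `^ w2.
  rewrite !powRM ?powR_ge0// -!powRrM.
  have -> : a `^ (t * w1) * b `^ (t * w1) * (a `^ (t * w2) * k `^ (s * w2)) *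
    (b `^ (t * w2) * k `^ (s * w2)) = (a `^ (t * w1) * a `^ (t * w2)) *
     (b `^ (t * w1) * b `^ (t * w2)) * (k `^ (s * w2) * k `^ (s * w2)) by ring.
  have e1 : t * w1 + t * w2 = 1 by rewrite /w1 /w2; field.
  have e2 : s * w2 + s * w2 = 1 by rewrite sE /w2; field; rewrite tt0.
  by rewrite -!powRD ?e1 ?e2 ?powRr1// ?oner_eq0 ?implybT.
have le u w : 0 <= u -> u <= M -> 0 <= w -> u `^ w <= M `^ w.
  by move=> u0 uM w0; apply: ge0_ler_powR; rewrite ?nnegrE.
have p1 : 0 <= a `^ t * b `^ t by rewrite mulr_ge0 ?powR_ge0.
have p2 : 0 <= a `^ t * k `^ s by rewrite mulr_ge0 ?powR_ge0.
have p3 : 0 <= b `^ t * k `^ s by rewrite mulr_ge0 ?powR_ge0.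
have q1 : a `^ t * b `^ t <= M by rewrite /M -addrA lerDl addr_ge0.
have q2 : a `^ t * k `^ s <= M by rewrite /M -addrA addrCA lerDl addr_ge0.
have q3 : b `^ t * k `^ s <= M by rewrite /M lerDr addr_ge0.
apply: (@le_trans _ _ (M `^ w1 * M `^ w2 * M `^ w2)).
  rewrite X; apply: ler_pM; [by rewrite mulr_ge0 ?powR_ge0|exact: powR_ge0| |exact: le].
  by apply: ler_pM; [exact: powR_ge0|exact: powR_ge0|exact: le|exact: le].
clearbody M.
have e : w1 + w2 + w2 = 1 by rewrite /w1 /w2; field.
have [->|Mn0] := eqVneq M 0.
  have [w1z|w1z] := eqVneq w1 0; last by rewrite (powR0 w1z) !mul0r.
  have w2z : w2 != 0 by apply: contra_eq_neq e => ->; rewrite w1z !addr0 eq_sym oner_eq0.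
  by rewrite (powR0 w2z) !mulr0.
by rewrite -!powRD ?Mn0 ?implybT// e powRr1.
Qed.

Section kernel.
Context d (T : measurableType d) (R : realType).
Variable m : {sigma_finite_measure set T -> \bar R}.
Variables (D : set T) (g : T -> R) (A : R).
Hypotheses (mD : measurable D) (g0 : forall x, D x -> 0 <= g x).
Hypotheses (mg : measurable_fun D (g : T -> measurableTypeR R)).
Hypotheses (gA : (\int[m]_(x in D) (g x)%:E <= A%:E)%E).

Lemma integral_prod_le1 (K : T * T -> R) (C : R) : 0 <= C ->
  (forall z, (D `*` D) z -> 0 <= K z) ->
  measurable_fun (D `*` D) (K : _ -> measurableTypeR R) ->
  (forall x, D x -> (\int[m]_(y in D) (K (x, y))%:E <= C%:E)%E) ->
  (\int[m \x m]_(z in D `*` D) (g z.1 * K z)%:E <= (A * C)%:E)%E.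
Proof.
move=> C0 K0 mK KC; have mDD : measurable (D `*` D) by exact: measurableX.
have mgf : measurable_fun (D `*` D) (fun z => g z.1 : measurableTypeR R).
  apply: (@measurable_comp _ _ _ _ _ _ D) => //; last exact: measurable_funTS.
  by move=> _ [z [Dz _] <-].
rewrite integral_mkcond fubini_tonelli1; first last.
- by apply: erestrict_ge0 => z Dz; rewrite lee_fin mulr_ge0 ?K0// g0//; case: Dz.
- apply/(measurable_restrictT _ mDD)/measurable_EFinP; exact: measurable_funM.
have KCr x : D x -> (\int[m]_(y in D) (g x * K (x, y))%:E <= (C * g x)%:E)%E.
  move=> Dx; under eq_integral do rewrite EFinM.
  rewrite ge0_integralZl_EFin//; last 3 first.
  - by move=> y Dy; rewrite lee_fin K0.
  - apply/measurable_EFinP; apply: (@measurable_comp _ _ _ _ _ _ (D `*` D)) => //.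
      by move=> _ [y Dy <-].
    by apply: measurable_funTS; exact: measurable_pair1.
  - exact: g0.
  by rewrite mulrC EFinM; apply: lee_wpmul2l; rewrite ?lee_fin ?g0// KC.
apply: (@le_trans _ _ (\int[m]_(x in D) (C * g x)%:E)%E); last first.
  under eq_integral do rewrite EFinM.
  rewrite ge0_integralZl_EFin//; last by apply/measurable_EFinP.
  by rewrite mulrC EFinM; apply: lee_wpmul2l; rewrite ?lee_fin.
rewrite [leRHS]integral_mkcond; apply: integral_le_dominated => x _.
  apply: integral_ge0 => y _; apply: erestrict_ge0 => z Dz.
  by rewrite lee_fin mulr_ge0 ?K0// g0//; case: Dz.
rewrite /fubini_F patchE; case: ifPn => Dx.
  apply: le_trans (KCr x (set_mem Dx)).
  rewrite [leRHS]integral_mkcond; apply: integral_le_dominated => y _.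
    apply: erestrict_ge0 => z Dz.
    by rewrite lee_fin mulr_ge0 ?K0// g0//; case: Dz.
  rewrite !patchE; case: ifPn => [/set_mem[_ Dy]|xy]; first by rewrite mem_set.
  by case: ifPn => // /set_mem Dy; rewrite lee_fin; apply: mulr_ge0; [exact: g0 (set_mem Dx)|apply: K0; split => //; exact: set_mem].
rewrite integral0_eq// => y _; rewrite patchE; case: ifPn => // /set_mem[Dx'].
by rewrite notin_setE in Dx.
Qed.

Lemma integral_prod_le2 (K : T * T -> R) (C : R) : 0 <= C ->
  (forall z, (D `*` D) z -> 0 <= K z) ->
  measurable_fun (D `*` D) (K : _ -> measurableTypeR R) ->
  (forall y, D y -> (\int[m]_(x in D) (K (x, y))%:E <= C%:E)%E) ->
  (\int[m \x m]_(z in D `*` D) (g z.2 * K z)%:E <= (A * C)%:E)%E.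
Proof.
move=> C0 K0 mK KC; have mDD : measurable (D `*` D) by exact: measurableX.
pose K' z := K (z.2, z.1).
have mK' : measurable_fun (D `*` D) (K' : _ -> measurableTypeR R).
  apply: (@measurable_comp _ _ _ _ _ _ (D `*` D)) => //.
    by move=> _ [z [Dz1 Dz2] <-].
  by apply: measurable_funTS; exact: measurable_swap.
have K'0 z : (D `*` D) z -> 0 <= K' z by move=> [Dz1 Dz2]; exact: K0.
apply: le_trans (integral_prod_le1 C0 K'0 mK' KC).
have mgf : measurable_fun (D `*` D) (fun z => g z.1 : measurableTypeR R).
  apply: (@measurable_comp _ _ _ _ _ _ D) => //; last exact: measurable_funTS.
  by move=> _ [z [Dz _] <-].
have mgf2 : measurable_fun (D `*` D) (fun z => g z.2 : measurableTypeR R).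
  apply: (@measurable_comp _ _ _ _ _ _ D) => //; last exact: measurable_funTS.
  by move=> _ [z [_ Dz] <-].
rewrite !(integral_mkcond (D `*` D)) fubini_tonelli2 ?fubini_tonelli1; first last.
- by apply: erestrict_ge0 => z Dz; rewrite lee_fin mulr_ge0 ?K0// g0//; case: Dz.
- apply/(measurable_restrictT _ mDD)/measurable_EFinP; exact: measurable_funM.
- by apply: erestrict_ge0 => z Dz; rewrite lee_fin mulr_ge0 ?K'0// g0//; case: Dz.
- apply/(measurable_restrictT _ mDD)/measurable_EFinP; exact: measurable_funM.
rewrite le_eqVlt; apply/orP; left; apply/eqP/eq_integral => y _; apply: eq_integral => x _ /=; rewrite !patchE.
by congr (if _ then _ else _); apply/idP/idP => /set_mem[? ?]; rewrite mem_set.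
Qed.

(** An elementary substitute for the Hardy-Littlewood-Sobolev inequality. After
    the pointwise bound mul3_powR_le, every term is the product of two integrals
    in separate variables. The condition of integrability of k `^ s is strict,
    so a little more than the critical exponent is asked of h. *)
Lemma double_integral_kernel_le (h : T -> R) (k : T * T -> R) (t C : R) : 0 <= A -> 0 <= C ->
  1 < t < 2 -> forall s, s = t / (2 * (t - 1)) ->
  (forall x, D x -> 0 <= h x) -> (forall x, D x -> g x = h x `^ t) ->
  (forall z, (D `*` D) z -> 0 <= k z) ->
  measurable_fun (D `*` D) (k : _ -> measurableTypeR R) ->
  (forall x, D x -> (\int[m]_(y in D) (k (x, y) `^ s)%:E <= C%:E)%E) ->
  (forall y, D y -> (\int[m]_(x in D) (k (x, y) `^ s)%:E <= C%:E)%E) ->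
  (\int[m \x m]_(z in D `*` D) (h z.1 * h z.2 * k z)%:E <= (A * A + A * C + A * C)%:E)%E.
Proof.
move=> A0 C0 t12 s sE h0 gE k0 mk kC1 kC2.
have mDD : measurable (D `*` D) by exact: measurableX.
have mgf : measurable_fun (D `*` D) (fun z => g z.1 : measurableTypeR R).
  apply: (@measurable_comp _ _ _ _ _ _ D) => //; last exact: measurable_funTS.
  by move=> _ [z [Dz _] <-].
have mgf2 : measurable_fun (D `*` D) (fun z => g z.2 : measurableTypeR R).
  apply: (@measurable_comp _ _ _ _ _ _ D) => //; last exact: measurable_funTS.
  by move=> _ [z [_ Dz] <-].
have mks : measurable_fun (D `*` D) (fun z => k z `^ s : measurableTypeR R).
  by apply: measurable_powR_fun => //; exact: measurable_cst.
apply: (@le_trans _ _ (\int[m \x m]_(z in D `*` D)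
    ((g z.1 * g z.2)%:E + (g z.1 * k z `^ s)%:E + (g z.2 * k z `^ s)%:E))%E).
  apply: integral_le_dominated => z [Dz1 Dz2].
    by rewrite lee_fin !mulr_ge0 ?h0 ?k0.
  by rewrite -!EFinD lee_fin !gE//; apply: mul3_powR_le; rewrite ?h0 ?k0.
have e1 z : (D `*` D) z -> (0%R <= (g z.1 * g z.2)%:E)%E.
  by move=> [Dz1 Dz2]; rewrite lee_fin mulr_ge0 ?g0.
have e2 z : (D `*` D) z -> (0%R <= (g z.1 * k z `^ s)%:E)%E.
  by move=> [Dz1 Dz2]; rewrite lee_fin mulr_ge0 ?g0 ?powR_ge0.
have e3 z : (D `*` D) z -> (0%R <= (g z.2 * k z `^ s)%:E)%E.
  by move=> [Dz1 Dz2]; rewrite lee_fin mulr_ge0 ?g0 ?powR_ge0.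
have m1 : measurable_fun (D `*` D) (fun z => (g z.1 * g z.2)%:E).
  by apply/measurable_EFinP; exact: measurable_funM.
have m2 : measurable_fun (D `*` D) (fun z => (g z.1 * k z `^ s)%:E).
  by apply/measurable_EFinP; exact: measurable_funM.
have m3 : measurable_fun (D `*` D) (fun z => (g z.2 * k z `^ s)%:E).
  by apply/measurable_EFinP; exact: measurable_funM.
rewrite ge0_integralD//; last 2 first.
- by move=> z Dz; rewrite adde_ge0 ?e1 ?e2.
- exact: emeasurable_funD.
rewrite ge0_integralD// !EFinD; apply: leeD; first apply: leeD.
- by apply: (@integral_prod_le1 (fun z => g z.2)) => // z [_ Dz2]; exact: g0.
- by apply: integral_prod_le1 => // z _; exact: powR_ge0.
- by apply: integral_prod_le2 => // z _; exact: powR_ge0.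
Qed.

End kernel.

Section riesz_double.
Variables (R : realType) (n : nat).
Local Notation V := 'rV[R]_n.+1.
Local Notation mu := (@lebesgue_rV R n.+1).

Lemma coord_le_enorm (x : V) i : `|x ord0 i| <= enorm x.
Proof.
rewrite /enorm -sqrtr_sqr ler_wsqrtr// (bigD1 i)//= lerDl.
by apply: sumr_ge0 => j _; exact: sqr_ge0.
Qed.

Lemma norm_le_enorm (x : V) : `|x| <= enorm x.
Proof.
rewrite [leLHS]mx_normrE; apply: bigmax_le; first exact: sqrtr_ge0.
by move=> [i j] _ /=; rewrite (ord1 i); exact: coord_le_enorm.
Qed.

Lemma norm_lt_diam (Om : set V) (B : R) (x y : V) :
  (forall x, Om x -> forall i, `|x ord0 i| <= B) -> Om x -> Om y ->
  `|x - y| <= 1 + 2 * `|B|.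
Proof.
move=> OB Ox Oy; rewrite [leLHS]mx_normrE; apply: bigmax_le; first by have := normr_ge0 B; lra.
move=> [i k] _ /=; rewrite !mxE (ord1 i); apply: (le_trans (ler_normB _ _)).
have := OB _ Ox k; have := OB _ Oy k; have := ler_norm B; lra.
Qed.

(** On a bounded set the kernel with variable exponent e is dominated by the one
    with the largest exponent dM. *)
Lemma enorm_kernel_le (B dM e : R) (x : V) : 0 < e <= dM -> `|x| <= B -> 1 <= B ->
  (enorm x `^ e)^-1 <= B `^ dM * `|x| `^ (- dM).
Proof.
move=> /andP[e0 edM] xB B1.
have [->|x0] := eqVneq x 0.
  have -> : enorm (0 : V) = 0.
    by rewrite /enorm big1 ?sqrtr0// => i _; rewrite mxE expr0n.
  by rewrite powR0 ?gt_eqF// invr0 mulr_ge0 ?powR_ge0.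
have nx0 : 0 < `|x| by rewrite normr_gt0.
apply: (@le_trans _ _ ((`|x| `^ e)^-1)).
  rewrite lef_pV2 ?posrE ?powR_gt0//; last exact: lt_le_trans (norm_le_enorm x).
  apply: ge0_ler_powR; rewrite ?nnegrE ?(ltW e0) ?(ltW nx0)//; first exact: sqrtr_ge0.
  exact: norm_le_enorm.
rewrite -powRN (_ : - e = (dM - e) + - dM); last by ring.
rewrite powRD; last by rewrite (gt_eqF nx0) implybT.
apply: ler_wpM2r; first exact: powR_ge0.
apply: (@le_trans _ _ (B `^ (dM - e))).
  by apply: ge0_ler_powR; rewrite ?nnegrE ?subr_ge0 ?(ltW nx0)//; lra.
by apply: ler_powR => //; lra.
Qed.

Lemma measurable_norm_sub : measurable_fun setT ((fun z : V * V => `|z.1 - z.2|) : _ -> measurableTypeR R).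
Proof.
apply: (@measurableT_comp _ _ _ _ _ _ (fun x : V => `|x| : measurableTypeR R)); last first.
  apply: measurable_fun_rV => i.
  rewrite (_ : _ \o _ = (fun z : V * V => z.1 ord0 i - z.2 ord0 i)); last first.
    by apply/funext => z; rewrite /rV_coord /= !mxE.
  by apply: measurable_funB; apply: (measurableT_comp (measurable_rV_coord i)).
apply: (@open_continuous_measurable_rV _ _ setT); first exact: openT.
by move=> x _; exact: norm_continuous.
Qed.

(** The lower bound on t is the condition b * t / (2 * (t - 1)) < N for the
    kernel k `^ s of double_integral_kernel_le to be integrable. *)
Lemma double_integral_riesz_le (Om : set V) (B b t : R) : measurable Om ->
  (forall x, Om x -> forall i, `|x ord0 i| <= B) -> 0 < b < n.+1%:R ->
  2 * n.+1%:R / (2 * n.+1%:R - b) < t < 2 ->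
  exists2 C, 0 <= C & forall (h : V -> R) (A : R), 0 <= A ->
    (forall x, Om x -> 0 <= h x) -> measurable_fun Om (h : V -> measurableTypeR R) ->
    (\int[mu]_(x in Om) (h x `^ t)%:E <= A%:E)%E ->
    (\int[mu \x mu]_(z in Om `*` Om)
       (h z.1 * h z.2 * `|z.1 - z.2| `^ (- b))%:E <= (A * A + A * C + A * C)%:E)%E.
Proof.
move=> mO OB bN; have /andP[b0 bN'] := bN => /andP[tb t2].
have N1 : 1 <= n.+1%:R :> R by rewrite ler1n.
have den : 0 < 2 * n.+1%:R - b by lra.
have t1 : 1 < t by apply: le_lt_trans tb; rewrite ler_pdivlMr//; lra.
pose s := t / (2 * (t - 1)).
have s0 : 0 < s by rewrite /s divr_gt0//; lra.
have bs : 0 < b * s < n.+1%:R.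
  rewrite mulr_gt0//= /s mulrA ltr_pdivrMr; last by lra.
  by move: tb; rewrite ltr_pdivrMr//; lra.
have [C C0 hC] := integral_riesz_le mO OB bs.
exists C => // h A A0 h0 mh hA.
have kE (x y : V) : (`|x - y| `^ (- b)) `^ s = `|x - y| `^ (- (b * s)).
  by rewrite -powRrM mulNr.
apply: (@double_integral_kernel_le _ _ _ mu Om (fun x => h x `^ t) A mO _ _ _ h
  (fun z => `|z.1 - z.2| `^ (- b)) t C) => //.
- by move=> x _; exact: powR_ge0.
- by apply: measurable_powR_fun => //; exact: measurable_cst.
- by rewrite t1.
- apply: measurable_powR_fun; [exact: measurableX| |exact: measurable_cst].
  by apply: measurable_funTS; exact: measurable_norm_sub.
- by move=> x Ox; under eq_integral do rewrite kE; exact: hC.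
- by move=> y Oy; under eq_integral do rewrite kE distrC; exact: hC.
Qed.

End riesz_double.

(** * Powers close to the Sobolev conjugate exponent *)

Section phase_instances.
Variables (R : realType) (n : nat).
Local Notation V := 'rV[R]_n.+2.
Local Notation mu := (@lebesgue_rV R n.+2).
Local Notation s1 := (sobolev1 R n).
Local Notation N := (@GRing.natmul R 1 n.+2).

(** The exponent m such that (a `^ m * y `^ (m * s)) `^ (N / (N - 1)) is
    (a `^ s^-1 * y) to the power kap * sobolev_conj s. It is at least 1 as soon
    as kap is close enough to 1. *)
Definition mexp (kap s : R) : R := kap * n.+1%:R / (N - s).

(** The range in which mexp is at least 1 and Young's inequality can be applied
    to the gradient term. *)
Definition phase_range (kap pm sM : R) :=
  [/\ 0 < kap <= 1, 1 < pm, sM < N & N - pm <= kap * n.+1%:R].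

Lemma NE : N = 1 + n.+1%:R.
Proof. by rewrite nat1r. Qed.

Lemma sobolev1E : s1 = N / n.+1%:R.
Proof. by rewrite /sobolev1 NE mulrDl mul1r divff// addrC. Qed.

Section one.
Variables (kap pm sM s : R).
Hypothesis rng : phase_range kap pm sM.
Hypothesis s_bnd : pm <= s <= sM.

Let facts : [/\ [/\ 0 < kap, kap <= 1, pm <= s & s <= sM],
  [/\ 0 < s, 1 < pm, 0 < N - s & 0 < N - sM], 0 < (@GRing.natmul R 1 n.+1) &
    N - pm <= kap * n.+1%:R].
Proof.
case: rng s_bnd => /andP[k0 k1] p1 sN kp /andP[ps sM'].
by split => //; split => //; lra.
Qed.

Lemma mexp_bnd : 1 <= mexp kap s <= mexp kap sM.
Proof.
have [[k0 k1 s_pm s_sM] [s0 pm1 Ns NsM] M0 kap_pm] := facts.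
apply/andP; split; first by rewrite /mexp ler_pdivlMr//; lra.
by rewrite /mexp ler_pM2l ?mulr_gt0// lef_pV2 ?posrE//; lra.
Qed.

Lemma mexp_mul_bnd : 1 <= mexp kap s * s <= mexp kap sM * sM.
Proof.
have [[k0 k1 s_pm s_sM] [s0 pm1 Ns NsM] M0 kap_pm] := facts.
have /andP[m1 mM] := mexp_bnd.
have s1' : 1 <= s by lra.
apply/andP; split; first by rewrite -(mulr1 1); apply: ler_pM.
by apply: ler_pM => //; lra.
Qed.

Lemma mexp_mulE : mexp kap s * s * s1 = kap * (N * s / (N - s)).
Proof.
have [_ [_ _ Ns _] M0 _] := facts; rewrite /mexp sobolev1E.
move: Ns M0; move: (n.+2%:R : R) (n.+1%:R : R) => nu mu Ns M0.
by field; rewrite !gt_eqF.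
Qed.

Lemma mexp_power_le : (mexp kap s * s - 1) / (mexp kap s * s * s1) + s^-1 <= 1.
Proof.
have [[k0 k1 s_pm s_sM] [s0 pm1 Ns NsM] M0 kap_pm] := facts.
have N0 : 0 < N by rewrite ltr0n.
have -> : (mexp kap s * s - 1) / (mexp kap s * s * s1) + s^-1 = 1 + (s^-1 - N^-1) * (1 - kap^-1).
  move: Ns N0 M0; rewrite /mexp sobolev1E NE; move: (n.+1%:R : R) => nu Ns N0 M0.
  by field; rewrite !gt_eqF.
have a1 : 0 <= s^-1 - N^-1 by rewrite subr_ge0 lef_pV2 ?posrE//; lra.
have a2 : 1 - kap^-1 <= 0 by rewrite subr_le0 invf_ge1.
by rewrite gerDl mulr_ge0_le0.
Qed.

Lemma mexp_power_le_sub j : (2 * N)^-1 <= j -> (mexp kap s * s - j) / (mexp kap s * s * s1) <=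
  s1^-1 - (2 * N)^-1 / (mexp kap sM * sM * s1).
Proof.
have [[k0 k1 s_pm s_sM] [s0 pm1 Ns NsM] M0 kap_pm] := facts.
move=> j0; have N0 : 0 < N by rewrite ltr0n.
have /andP[t1 tM] := mexp_mul_bnd.
have s10 : 0 < s1 by rewrite sobolev1E divr_gt0.
have t0 : 0 < mexp kap s * s by lra.
have -> : (mexp kap s * s - j) / (mexp kap s * s * s1) = s1^-1 - j / (mexp kap s * s * s1).
  by rewrite mulrBl; congr (_ - _); rewrite invfM mulrA divff ?mul1r// gt_eqF.
rewrite lerD2l lerN2; apply: ler_pM => //.
- by rewrite invr_ge0; apply: mulr_ge0; [lra|exact: ltW].
- rewrite lef_pV2 ?posrE ?ler_pM2r//; first by apply: mulr_gt0 => //; lra.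
  exact: mulr_gt0.
Qed.

End one.

Lemma mexp_lip (kap pm sM s t : R) : phase_range kap pm sM -> pm <= s <= sM -> pm <= t <= sM ->
  `|mexp kap s - mexp kap t| <= kap * n.+1%:R / (N - sM) ^+ 2 * `|s - t|.
Proof.
move=> [/andP[k0 k1] pm1 sMN kap_pm] /andP[s1' s2] /andP[t1 t2].
have NsM : 0 < N - sM by rewrite subr_gt0.
have Ns : 0 < N - s by lra.
have Nt : 0 < N - t by lra.
have -> : mexp kap s - mexp kap t = kap * n.+1%:R / ((N - s) * (N - t)) * (s - t).
  move: Ns Nt; rewrite /mexp; move: (n.+2%:R : R) (n.+1%:R : R) => nu mu Ns Nt.
  by field; rewrite !gt_eqF.
have h0 : 0 < kap * n.+1%:R by rewrite mulr_gt0// ltr0n.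
rewrite normrM ger0_norm; last by rewrite divr_ge0// ?mulr_ge0// ltW.
apply: ler_wpM2r => //; rewrite ler_pM2l// lef_pV2 ?posrE ?mulr_gt0// expr2.
by apply: ler_pM; lra.
Qed.

(** This is weighted_power_bound for m = mexp s and th = m * s. Here th - j is
    the part of the exponent of phi that is charged to the unknown integral, and
    j the part charged to Y. The bound j >= 1 / (2 * N) keeps the exponent of the
    unknown integral uniformly below (N - 1) / N. *)
Lemma phase_bound (Om : set V) (a s j k : V -> R) (kap pm sM A La Ls e C1 C2 B : R) :
  phase_range kap pm sM ->
  open Om -> (forall x, Om x -> forall i, `|x ord0 i| <= B) ->
  1 <= A -> 0 <= La -> 0 <= Ls -> 0 < e ->
  (forall x, Om x -> 0 <= a x <= A) -> lip_on Om a La ->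
  (forall x, Om x -> pm <= s x <= sM) -> lip_on Om s Ls ->
  (forall x, Om x -> (2 * N)^-1 <= j x <= mexp kap (s x) * s x) ->
  (forall x, Om x -> 0 <= k x /\
     (mexp kap (s x) * s x - j x) / (mexp kap (s x) * s x * s1) + k x <= 1) ->
  0 <= C1 -> 0 <= C2 ->
  exists C : R, forall (phi : V -> R) (Y : V -> R), C1c Om phi ->
    (forall x, Om x -> 0 <= Y x) -> measurable_fun Om (Y : V -> measurableTypeR R) ->
    (\int[mu]_(x in Om) (Y x)%:E <= C1%:E)%E ->
    (forall i, \int[mu]_(x in Om) (a x * `|partial i phi x| `^ s x)%:E <= C2%:E)%E ->
    (forall x, Om x -> 0 < a x -> phi x != 0 ->
       a x `^ (mexp kap (s x) - 1) * `|phi x| `^ (mexp kap (s x) * s x + e) <=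
       a x `^ ((mexp kap (s x) * s x - j x) / s x) * `|phi x| `^ (mexp kap (s x) * s x - j x) *
       Y x `^ k x) ->
    (\int[mu]_(x in Om)
      ((a x `^ (s x)^-1 * `|phi x|) `^ (kap * sobolev_conj s x))%:E <= C%:E)%E.
Proof.
move=> rng oOm OB A1 La0 Ls0 e0 a_bnd aL s_bnd sL j_bnd kP C10 C20.
have [->|/set0P[x0 Ox0]] := eqVneq Om set0.
  by exists 0 => phi Y *; rewrite integral_set0.
have N0 : 0 < N by rewrite ltr0n.
have N2 : 2 <= N by rewrite ler_nat.
have s10 : 0 < s1 by rewrite sobolev1E divr_gt0// ltr0n.
have [/andP[kap0 kap1] pm1 sMN kap_pm] := rng.
have NsM : 0 < N - sM by rewrite subr_gt0.
pose m x := mexp kap (s x); pose th x := m x * s x.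
pose Lm := kap * n.+1%:R / (N - sM) ^+ 2 * Ls.
have Lm0 : 0 <= Lm by rewrite /Lm mulr_ge0// divr_ge0 ?sqr_ge0// mulr_ge0// ltW.
have mL : lip_on Om m Lm.
  move=> x y Ox Oy; apply: (le_trans (mexp_lip rng (s_bnd _ Ox) (s_bnd _ Oy))).
  rewrite /Lm -[leRHS]mulrA; apply: ler_wpM2l; last exact: sL.
  by rewrite divr_ge0 ?sqr_ge0// mulr_ge0// ltW.
have m_bnd x : Om x -> 1 <= m x <= mexp kap sM by move=> Ox; exact: mexp_bnd rng (s_bnd _ Ox).
have th_bnd x : Om x -> 1 <= th x <= mexp kap sM * sM by move=> Ox; exact: mexp_mul_bnd rng (s_bnd _ Ox).
have sM0 : 0 <= sM by have /andP[] := s_bnd _ Ox0; lra.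
have mM0 : 0 <= mexp kap sM by have /andP[] := m_bnd _ Ox0; lra.
pose Lt := Lm * sM + mexp kap sM * Ls.
have Lt0 : 0 <= Lt by rewrite /Lt addr_ge0// mulr_ge0.
have thL : lip_on Om th Lt.
  move=> x y Ox Oy; have /andP[s1' s2] := s_bnd _ Ox.
  have /andP[m1 m2] := m_bnd _ Oy.
  have -> : th x - th y = (m x - m y) * s x + m y * (s x - s y) by rewrite /th; ring.
  apply: (le_trans (ler_normD _ _)).
  rewrite (normrM (_ - _)) (normrM (m y)) /Lt mulrDl; apply: lerD.
    rewrite [leRHS]mulrAC; apply: ler_pM => //; first exact: mL.
    by rewrite ger0_norm//; lra.
  rewrite -[leRHS]mulrA; apply: ler_pM => //; last exact: sL.
  by rewrite ger0_norm//; lra.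
pose z := s1^-1 - (2 * N)^-1 / (mexp kap sM * sM * s1).
have zs1 : z * s1 < 1.
  have thM : 0 < mexp kap sM * sM by have /andP[] := th_bnd _ Ox0; lra.
  rewrite /z mulrBl mulVf ?gt_eqF// gtrBl; apply: mulr_gt0 => //.
  by apply: divr_gt0; [rewrite invr_gt0; lra|exact: mulr_gt0].
have ltz x : Om x -> (th x - j x) / (th x * s1) <= z.
  by move=> Ox; apply: (mexp_power_le_sub rng (s_bnd _ Ox)); have /andP[] := j_bnd _ Ox.
have l0 x : Om x -> 0 <= (th x - j x) / (th x * s1).
  move=> Ox; have /andP[_ jt] := j_bnd _ Ox; have /andP[th1 _] := th_bnd _ Ox.
  by rewrite divr_ge0 ?subr_ge0// mulr_ge0 ?(ltW s10)//; lra.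
have z0 : 0 <= z by exact: le_trans (l0 _ Ox0) (ltz _ Ox0).
have N21 : (2 * N)^-1 <= 1 by rewrite invf_le1; lra.
have [C HC] := @weighted_power_bound R n Om a m th s (fun x => (th x - j x) / (th x * s1)) k
  A La (mexp kap sM) Lm (mexp kap sM * sM) Lt e z C1 C2 B oOm OB A1 La0 Lm0 Lt0 e0 a_bnd aL m_bnd mL
  th_bnd thL
  (fun x Ox => conj (lt_le_trans (lt_trans ltr01 pm1) (proj1 (andP (s_bnd x Ox)))) erefl)
  (open_continuous_measurable_rV oOm (fun x Ox => lip_on_continuous oOm sL Ox)) z0 zs1
  (fun x Ox => conj (mexp_power_le_sub rng (s_bnd x Ox) N21) (mexp_power_le rng (s_bnd x Ox)))
  (fun x Ox => And4 (l0 x Ox) (ltz x Ox) (proj1 (kP x Ox)) (proj2 (kP x Ox))) C10 C20.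
exists C => phi Y phiC Y0 mY YC1 ZC2 H.
have E x : Om x -> wpow Om a m th phi x `^ s1 =
    (a x `^ (s x)^-1 * `|phi x|) `^ (kap * sobolev_conj s x).
  move=> Ox; have sx0 : 0 < s x by have /andP[] := s_bnd _ Ox; lra.
  rewrite (wpowE a m th phi Ox) !(powRM _ (powR_ge0 _ _)) ?powR_ge0// -!powRrM.
  have -> : m x * s1 = (s x)^-1 * (kap * sobolev_conj s x).
    rewrite /sobolev_conj -(mexp_mulE rng (s_bnd _ Ox)) /m; field; exact/lt0r_neq0.
  by rewrite /th /m (mexp_mulE rng (s_bnd _ Ox)).
have -> : (\int[mu]_(x in Om) ((a x `^ (s x)^-1 * `|phi x|) `^ (kap * sobolev_conj s x))%:E =
  \int[mu]_(x in Om) (wpow Om a m th phi x `^ s1)%:E)%E.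
  by apply: eq_integral => x /set_mem Ox; rewrite E.
apply: (HC _ Y) => // x Ox ax px; apply: (le_trans (H _ Ox ax px)).
rewrite le_eqVlt; apply/orP; left; apply/eqP; congr (_ * _).
have sx0 : 0 < s x by have /andP[] := s_bnd _ Ox; lra.
have tx0 : 0 < th x by have /andP[] := th_bnd _ Ox; lra.
have mx0 : 0 < m x by have /andP[] := m_bnd _ Ox; lra.
rewrite (wpowE a m th phi Ox) !(powRM _ (powR_ge0 _ _) (powR_ge0 _ _)) -!powRrM; congr (_ * _).
  by congr (_ `^ _); rewrite /th -/(m x); field; rewrite !gt_eqF.
by congr (_ `^ _); rewrite -/(m x) -/(th x); field; rewrite !gt_eqF.
Qed.

Lemma measurable_kap_sobolev_conj (Om : set V) (p : V -> R) (kap Lp : R) : open Om ->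
  lip_on Om p Lp -> (forall x, Om x -> p x < N) ->
  measurable_fun Om ((fun x => kap * sobolev_conj p x) : V -> measurableTypeR R).
Proof.
move=> oOm pL pN; apply: open_continuous_measurable_rV => // x Ox.
have px := lip_on_continuous oOm pL Ox.
have NpE : N - p x != 0 by rewrite subr_eq0 gt_eqF// pN.
apply: (@contM R V x (fun=> kap)); first exact: cont_cst.
apply: (@contM R V x (fun y => N * p y)).
  by apply: (@contM R V x (fun=> N)) => //; exact: cont_cst.
apply: (@contV R V x) => //.
apply: (@contD R V x (fun=> N)); first exact: cont_cst.
by rewrite (_ : (fun y => - p y) = (fun y => -1 * p y)); [apply: (@contM R V x (fun=> -1)) => //; exact: cont_cst|apply/funext => y; rewrite mulN1r].
Qed.

(** The Gagliardo inequality for the absolute value of phi, which is the weighted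
    power with all parameters equal to 1. It starts the bootstrap: the p-th
    power of the gradient controls its first power. *)
Lemma integral_C1c_sobolev1_le (Om : set V) (p : V -> R) (Lp C2 B : R) :
  open Om -> (forall x, Om x -> forall i, `|x ord0 i| <= B) ->
  lip_on Om p Lp -> (forall x, Om x -> 1 <= p x) -> 0 <= C2 ->
  exists2 C : R, 0 <= C & forall (phi : V -> R), C1c Om phi ->
    (forall i, \int[mu]_(x in Om) (`|partial i phi x| `^ p x)%:E <= C2%:E)%E ->
    (\int[mu]_(x in Om) (`|phi x| `^ s1)%:E <= C%:E)%E.
Proof.
move=> oOm OB pL p1 C20.
have mO : measurable Om by exact: open_measurable_rV.
have muO : (mu Om < +oo)%E := lebesgue_bounded_lty mO OB.
have muf : mu Om \is a fin_num by rewrite ge0_fin_numE.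
pose v := fine (mu Om); have v0 : 0 <= v by rewrite fine_ge0.
have s10 : 0 < s1 by rewrite sobolev1E divr_gt0// ltr0n.
have e0 : 0 <= n.+2%:R * (v + C2) by rewrite mulr_ge0// addr_ge0.
exists ((n.+2%:R * (v + C2)) `^ s1) => [|phi phiC C2i]; first exact: powR_ge0.
pose one : V -> R := fun=> 1.
have one_bnd x : Om x -> 0 <= one x <= 1 by rewrite /one ler01 lexx.
have one_bnd1 x : Om x -> 1 <= one x <= 1 by rewrite /one lexx.
have one_lip : lip_on Om one 0 by move=> x y _ _; rewrite subrr normr0 mul0r.
pose g := wpow Om one one one phi.
pose h := wpow_slope Om one one one phi 0 0 0.
have gE x : Om x -> g x = `|phi x|.
  by move=> Ox; rewrite /g wpowE// /one powR1 mul1r powRr1.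
have hE i x : Om x -> h i x <= `|partial i phi x|.
  move=> Ox; rewrite /h /wpow_slope patchE mem_set// /one powR1 mul1r powRr1// !mulr0 !mul1r.
  rewrite !add0r addr0 mulrA; have [->|px] := eqVneq `|phi x| 0; first by rewrite !mul0r.
  by rewrite powR_inv1// divff// mul1r.
have h0 i x : 0 <= h i x.
  by apply: (@wpow_slope_ge0 _ _ Om one one one phi 0 1 0 1 0).
have gh : line_dominated g h.
  apply: (@wpow_line_dominated _ _ Om one one one phi 1 0 1 0 1 0) => //.
  by exists B.
have mg : measurable_fun setT (g : V -> measurableTypeR R).
  apply: open_continuous_measurable_rV => [|x _]; first exact: openT.
  exact: (@wpow_continuous _ _ Om one one one phi 1 0 1 0 1 0).
have mh i : measurable_fun setT (h i : V -> measurableTypeR R).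
  exact: (@measurable_wpow_slope _ _ Om one one one phi 1 0 1 0 1 0).
have := gagliardo (fun x => wpow_ge0 Om one one one phi x) mg h0 mh gh; rewrite -/s1.
have hI i : (\int[mu]_x (h i x)%:E <= (v + C2)%:E)%E.
  have -> : (\int[mu]_x (h i x)%:E = \int[mu]_(x in Om) (h i x)%:E)%E.
    rewrite [RHS]integral_mkcond; apply: eq_integral => x _.
    rewrite patchE; case: ifPn => //; rewrite notin_setE => Ox.
    by rewrite /h /wpow_slope patchE memNset.
  apply: (@le_trans _ _ (\int[mu]_(x in Om) ((1%:E) + (`|partial i phi x| `^ p x)%:E))%E).
    apply: integral_le_dominated => x Ox; first by rewrite lee_fin.
    rewrite -EFinD lee_fin; apply: (le_trans (hE i x Ox)).
    have [d1|d1] := leP `|partial i phi x| 1; first by apply: (le_trans d1); rewrite lerDl powR_ge0.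
    apply: ler_wpDl => //; rewrite -[leLHS]powRr1//; apply: ler_powR; [exact: ltW|exact: p1].
  have mp : measurable_fun Om (fun x => `|partial i phi x| `^ p x : measurableTypeR R).
    apply: measurable_powR_fun => //; first by have [_] := measurable_C1c_norm phiC; exact.
    by apply: open_continuous_measurable_rV => // x; exact: lip_on_continuous pL.
  rewrite ge0_integralD//; last by apply/measurable_EFinP.
  rewrite integral_cst// mul1e EFinD; apply: leeD; last exact: C2i.
  by rewrite /v fineK.
have -> : (\int[mu]_x (g x `^ s1)%:E = \int[mu]_(x in Om) (`|phi x| `^ s1)%:E)%E.
  rewrite [RHS]integral_mkcond; apply: eq_integral => x _.
  rewrite patchE; case: ifPn => [/set_mem Ox|]; first by rewrite gE.
  by rewrite notin_setE => Ox; rewrite /g wpow_notin// powR0// gt_eqF.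
move=> /le_trans; apply.
have S0 : (0 <= \sum_i \int[mu]_x (h i x)%:E)%E.
  by apply: sume_ge0 => i _; apply: integral_ge0 => x _; rewrite lee_fin.
rewrite -poweR_EFin; apply: gt0_ler_poweR; first exact: ltW.
- by rewrite in_itv/= leey S0.
- by rewrite in_itv/= leey andbT lee_fin.
apply: (le_trans (lee_sum _ (fun i _ => hI i))).
by rewrite sumEFin sumr_const card_ord lee_fin mulr_natl.
Qed.

(** The weight is 1, and the lower order terms are charged to the L^(N / (N - 1))
    norm of phi, with the loss e = 1 / (2 * N). *)
Lemma phase_one (Om : set V) (p : V -> R) (kap pm pM Lp C2 B : R) :
  phase_range kap pm pM ->
  open Om -> (forall x, Om x -> forall i, `|x ord0 i| <= B) ->
  0 <= Lp -> (forall x, Om x -> pm <= p x <= pM) -> lip_on Om p Lp -> 0 <= C2 ->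
  exists C : R, forall (phi : V -> R), C1c Om phi ->
    (forall i, \int[mu]_(x in Om) (`|partial i phi x| `^ p x)%:E <= C2%:E)%E ->
    (\int[mu]_(x in Om) (`|phi x| `^ (kap * sobolev_conj p x))%:E <= C%:E)%E.
Proof.
move=> rng oOm OB Lp0 p_bnd pL C20.
have [kap01 pm1 pMN kap_pm] := rng.
have N0 : 0 < N by rewrite ltr0n.
have s10 : 0 < s1 by rewrite sobolev1E divr_gt0// ltr0n.
have e0 : 0 < (2 * N)^-1 by rewrite invr_gt0 mulr_gt0.
have p1 x : Om x -> 1 <= p x by move=> Ox; have /andP[] := p_bnd _ Ox; lra.
have [C1 C10 HC1] := integral_C1c_sobolev1_le oOm OB pL p1 C20.
pose one : V -> R := fun=> 1.
have one_bnd x : Om x -> 0 <= one x <= 1 by rewrite /one ler01 lexx.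
have one_lip : lip_on Om one 0 by move=> x y _ _; rewrite subrr normr0 mul0r.
have e1 : (2 * N)^-1 <= 1 by rewrite invf_le1 ?mulr_gt0//; have : 2 <= N by [rewrite ler_nat]; lra.
have j_bnd x : Om x -> (2 * N)^-1 <= (2 * N)^-1 <= mexp kap (p x) * p x.
  by move=> Ox; rewrite lexx/=; have /andP[+ _] := mexp_mul_bnd rng (p_bnd _ Ox); exact: le_trans.
have s1N : s1^-1 + N^-1 / s1 <= 1.
  have -> : s1^-1 = 1 - N^-1.
    by rewrite sobolev1E invf_div -{1}(addKr 1 n.+1%:R) -NE addrC mulrBl divff ?gt_eqF// mul1r.
  by have := sqr_ge0 N^-1; rewrite expr2; move: (N^-1) => u uu; lra.
have kP x : Om x -> 0 <= N^-1 / s1 /\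
    (mexp kap (p x) * p x - (2 * N)^-1) / (mexp kap (p x) * p x * s1) + N^-1 / s1 <= 1.
  move=> Ox; split; first by rewrite divr_ge0 ?invr_ge0// ltW.
  apply: le_trans s1N; rewrite lerD2r.
  apply: (le_trans (mexp_power_le_sub rng (p_bnd _ Ox) (lexx _))).
  have th0 : 0 < mexp kap pM * pM.
    by have /andP[a1 a2] := mexp_mul_bnd rng (p_bnd _ Ox); lra.
  by rewrite gerBl divr_ge0 ?(ltW e0)// mulr_ge0// ltW.
have [C HC] := phase_bound rng oOm OB (lexx 1) (lexx 0) Lp0 e0 one_bnd one_lip p_bnd pL
  j_bnd kP C10 C20.
exists C => phi phiC C2i.
have -> : (\int[mu]_(x in Om) (`|phi x| `^ (kap * sobolev_conj p x))%:E =
    \int[mu]_(x in Om) ((one x `^ (p x)^-1 * `|phi x|) `^ (kap * sobolev_conj p x))%:E)%E.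
  by apply: eq_integral => x _; rewrite /one powR1 mul1r.
apply: (HC phi (fun x => `|phi x| `^ s1) phiC (fun x _ => powR_ge0 _ _) _ (HC1 _ phiC C2i)).
- apply: measurable_powR_fun; [exact: open_measurable_rV| |exact: measurable_cst].
  by have [] := measurable_C1c_norm phiC.
- by move=> i; rewrite /one; under eq_integral do rewrite mul1r; exact: C2i.
move=> x Ox _ px; rewrite /one !powR1 !mul1r -powRrM -powRD.
  by rewrite le_eqVlt; apply/orP; left; apply/eqP; congr (_ `^ _); field; rewrite !gt_eqF.
by rewrite normr_eq0 px implybT.
Qed.

(** The lower order term a `^ (m - 1) * phi `^ (m * s + e) is split between the
    unknown integral, which takes all of the weight, and the bound of the first
    phase, which has to absorb phi `^ (s + e). That the exponents then add up to
    at most 1 is the hypothesis relating s / p, e and kap; it can be met when the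
    ratio of the exponents is less than 1 + 1 / N. *)
Lemma phase_next (Om : set V) (a p s : V -> R) (kap pm sM A La Lp Ls e C1 C2 B : R) :
  phase_range kap pm sM ->
  open Om -> (forall x, Om x -> forall i, `|x ord0 i| <= B) ->
  1 <= A -> 0 <= La -> 0 <= Ls -> 0 < e ->
  (forall x, Om x -> 0 <= a x <= A) -> lip_on Om a La ->
  (forall x, Om x -> [/\ pm <= p x, p x <= s x, s x <= sM &
     N * (s x / p x - 1) + N * e <= kap]) ->
  lip_on Om p Lp -> lip_on Om s Ls -> 0 <= C1 -> 0 <= C2 ->
  exists C : R, forall (phi : V -> R), C1c Om phi ->
    (\int[mu]_(x in Om) (`|phi x| `^ (kap * sobolev_conj p x))%:E <= C1%:E)%E ->
    (forall i, \int[mu]_(x in Om) (a x * `|partial i phi x| `^ s x)%:E <= C2%:E)%E ->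
    (\int[mu]_(x in Om)
      ((a x `^ (s x)^-1 * `|phi x|) `^ (kap * sobolev_conj s x))%:E <= C%:E)%E.
Proof.
move=> rng oOm OB A1 La0 Ls0 e0 a_bnd aL ps_bnd pL sL C10 C20.
have [/andP[k0 k1] pm1 sMN kap_pm] := rng.
have N0 : 0 < N by rewrite ltr0n.
have s10 : 0 < s1 by rewrite sobolev1E divr_gt0// ltr0n.
have s_bnd x : Om x -> pm <= s x <= sM.
  by move=> Ox; have [a1 a2 a3 a4] := ps_bnd _ Ox; apply/andP; split; lra.
have p_bnd x : Om x -> pm <= p x <= sM.
  by move=> Ox; have [a1 a2 a3 a4] := ps_bnd _ Ox; apply/andP; split; lra.
have e1 : (2 * N)^-1 <= 1 by rewrite invf_le1 ?mulr_gt0//; have : 2 <= N by [rewrite ler_nat]; lra.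
have j_bnd x : Om x -> (2 * N)^-1 <= s x <= mexp kap (s x) * s x.
  move=> Ox; have /andP[a1 a2] := s_bnd _ Ox; have /andP[m1 _] := mexp_bnd rng (s_bnd _ Ox).
  by apply/andP; split; [apply: (le_trans e1); lra|rewrite ler_peMl//; lra].
have pstar x : Om x -> 0 < kap * sobolev_conj p x.
  move=> Ox; have /andP[a1 a2] := p_bnd _ Ox.
  by rewrite mulr_gt0// /sobolev_conj divr_gt0 ?mulr_gt0//; lra.
pose k x := (s x + e) / (kap * sobolev_conj p x).
have kP x : Om x -> 0 <= k x /\
    (mexp kap (s x) * s x - s x) / (mexp kap (s x) * s x * s1) + k x <= 1.
  move=> Ox; have [a1 a2 a3 a4] := ps_bnd _ Ox.
  split; first by rewrite /k divr_ge0 ?(ltW (pstar _ Ox))//; lra.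
  have sx0 : 0 < s x by lra.
  have px0 : 0 < p x by lra.
  have Ns : 0 < N - s x by lra.
  have Np : 0 < N - p x by lra.
  have -> : (mexp kap (s x) * s x - s x) / (mexp kap (s x) * s x * s1) + k x =
      1 + (kap * N)^-1 * (N * (s x / p x - 1) + N / p x * e - e - kap).
    rewrite (mexp_mulE rng (s_bnd _ Ox)) /k /mexp /sobolev_conj.
    have -> : @GRing.natmul R 1 n.+1 = N - 1 by rewrite NE addrAC subrr add0r.
    move: N0 Ns Np; move: (n.+2%:R : R) => nu N0 Ns Np.
    by field; rewrite !gt_eqF.
  rewrite gerDl; apply: mulr_ge0_le0; first by rewrite invr_ge0 mulr_ge0// ltW.
  have : N / p x * e <= N * e.
    by apply: ler_wpM2r; [exact: ltW|rewrite ler_pdivrMr// ler_peMr ?(ltW N0)//; lra].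
  lra.
have [C HC] := phase_bound rng oOm OB A1 La0 Ls0 e0 a_bnd aL s_bnd sL j_bnd kP C10 C20.
exists C => phi phiC C1phi C2i; apply: (HC phi (fun x => `|phi x| `^ (kap * sobolev_conj p x))) => //.
- apply: measurable_powR_fun; first exact: open_measurable_rV.
    by have [] := measurable_C1c_norm phiC.
  by apply: (measurable_kap_sobolev_conj _ oOm pL) => x Ox; have /andP[] := p_bnd _ Ox; lra.
move=> x Ox ax px; rewrite -mulrA; have /andP[a1 a2] := s_bnd _ Ox.
have sx0 : 0 < s x by lra.
have -> : (mexp kap (s x) * s x - s x) / s x = mexp kap (s x) - 1 by field; rewrite gt_eqF.
apply: ler_wpM2l; first exact: powR_ge0.
rewrite -powRrM -powRD; last by rewrite normr_eq0 px implybT.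
rewrite le_eqVlt; apply/orP; left; apply/eqP; congr (_ `^ _).
rewrite /k mulrCA divff ?mulr1; last by rewrite gt_eqF// pstar.
by ring.
Qed.

End phase_instances.

(** * The three phases *)

Lemma ge0_integral_add3_le d (T : measurableType d) (R : realType)
    (m : {measure set T -> \bar R}) (D : set T) (f g h : T -> R) (A B C : R) : measurable D ->
  (forall x, D x -> 0 <= f x) -> (forall x, D x -> 0 <= g x) -> (forall x, D x -> 0 <= h x) ->
  measurable_fun D f -> measurable_fun D g -> measurable_fun D h ->
  (\int[m]_(x in D) (f x)%:E <= A%:E)%E -> (\int[m]_(x in D) (g x)%:E <= B%:E)%E ->
  (\int[m]_(x in D) (h x)%:E <= C%:E)%E ->
  (\int[m]_(x in D) (f x + g x + h x)%:E <= (A + B + C)%:E)%E.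
Proof.
move=> mD f0 g0 h0 mf mg mh fA gB hC.
under eq_integral do rewrite EFinD.
rewrite ge0_integralD//; last 3 first.
- by move=> x Dx; rewrite lee_fin addr_ge0 ?f0 ?g0.
- by apply/measurable_EFinP; exact: measurable_funD.
- exact/measurable_EFinP.
under eq_integral do rewrite EFinD.
rewrite ge0_integralD//; last 2 first.
- exact/measurable_EFinP.
- exact/measurable_EFinP.
by rewrite !EFinD; apply: leeD => //; apply: leeD.
Qed.

Section three_phases.
Variables (R : realType) (n : nat).
Local Notation V := 'rV[R]_n.+2.
Local Notation mu := (@lebesgue_rV R n.+2).
Local Notation N := (@GRing.natmul R 1 n.+2).

(** The quantity bounded by the embedding: for kap = 1 it would be the conjugate
    of the modular function in the sense of Sobolev. *)
Definition conj_energy (kap : R) (p q r a1 a2 : V -> R) (x : V) (t : R) : R :=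
  t `^ (kap * sobolev_conj p x) +
  (a1 x `^ (q x)^-1 * t) `^ (kap * sobolev_conj q x) +
  (a2 x `^ (r x)^-1 * t) `^ (kap * sobolev_conj r x).

Lemma conj_energy_ge0 kap p q r a1 a2 x t : 0 <= conj_energy kap p q r a1 a2 x t.
Proof. by rewrite /conj_energy !addr_ge0// powR_ge0. Qed.

Lemma measurable_conj_term (Om : set V) (a s phi : V -> R) (kap La Ls : R) :
  open Om -> (forall x, Om x -> 0 < s x < N) -> lip_on Om a La -> lip_on Om s Ls ->
  measurable_fun Om (phi : V -> measurableTypeR R) ->
  measurable_fun Om ((fun x => (a x `^ (s x)^-1 * `|phi x|) `^
    (kap * sobolev_conj s x)) : V -> measurableTypeR R).
Proof.
move=> oOm s_bnd aL sL mphi; have mO : measurable Om by exact: open_measurable_rV.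
apply: measurable_powR_fun => //; last first.
  by apply: (measurable_kap_sobolev_conj _ oOm sL) => x /s_bnd/andP[].
apply: measurable_funM; last exact: measurableT_comp.
apply: measurable_powR_fun => //; apply: open_continuous_measurable_rV => // x Ox.
  exact: lip_on_continuous aL Ox.
apply: (@contV R V x); last exact: lip_on_continuous sL Ox.
by have /andP[s0 _] := s_bnd _ Ox; rewrite gt_eqF.
Qed.

Lemma measurable_conj_term1 (Om : set V) (s phi : V -> R) (kap Ls : R) :
  open Om -> (forall x, Om x -> 0 < s x < N) -> lip_on Om s Ls ->
  measurable_fun Om (phi : V -> measurableTypeR R) ->
  measurable_fun Om ((fun x => `|phi x| `^ (kap * sobolev_conj s x)) : V -> measurableTypeR R).
Proof.
move=> oOm s_bnd sL mphi; have mO : measurable Om by exact: open_measurable_rV.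
apply: measurable_powR_fun => //; first exact: measurableT_comp.
by apply: (measurable_kap_sobolev_conj _ oOm sL) => x /s_bnd/andP[].
Qed.

Lemma measurable_conj_energy (Om : set V) (p q r a1 a2 phi : V -> R)
    (kap La1 La2 Lp Lq Lr : R) : open Om ->
  (forall x, Om x -> [/\ 0 < p x < N, 0 < q x < N & 0 < r x < N]) ->
  lip_on Om p Lp -> lip_on Om q Lq -> lip_on Om r Lr ->
  lip_on Om a1 La1 -> lip_on Om a2 La2 ->
  measurable_fun Om (phi : V -> measurableTypeR R) ->
  measurable_fun Om ((fun x => conj_energy kap p q r a1 a2 x `|phi x|) : V -> measurableTypeR R).
Proof.
move=> oOm bnd pL qL rL a1L a2L mphi.
apply: measurable_funD; first apply: measurable_funD.
- by apply: (measurable_conj_term1 _ oOm _ pL mphi) => x /bnd[].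
- by apply: (measurable_conj_term _ oOm _ a1L qL mphi) => x /bnd[].
- by apply: (measurable_conj_term _ oOm _ a2L rL mphi) => x /bnd[].
Qed.

(** The second and the third phase are two instances of phase_next, both resting
    on the first. *)
Lemma phases_bound (Om : set V) (p q r a1 a2 : V -> R)
    (kap pm rM A La1 La2 Lp Lq Lr e C2 B : R) :
  phase_range n kap pm rM ->
  open Om -> (forall x, Om x -> forall i, `|x ord0 i| <= B) ->
  1 <= A -> 0 <= La1 -> 0 <= La2 -> 0 <= Lp -> 0 <= Lq -> 0 <= Lr -> 0 < e ->
  (forall x, Om x -> [/\ pm <= p x, p x <= q x, q x <= r x & r x <= rM]) ->
  (forall x, Om x -> 0 <= a1 x <= A) -> (forall x, Om x -> 0 <= a2 x <= A) ->
  lip_on Om p Lp -> lip_on Om q Lq -> lip_on Om r Lr ->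
  lip_on Om a1 La1 -> lip_on Om a2 La2 ->
  N * (rM / pm - 1) + N * e <= kap -> 0 <= C2 ->
  exists C : R, forall phi : V -> R, C1c Om phi ->
    (forall i, \int[mu]_(x in Om)
       (triple_phase p q r a1 a2 x `|partial i phi x|)%:E <= C2%:E)%E ->
    (\int[mu]_(x in Om) (conj_energy kap p q r a1 a2 x `|phi x|)%:E <= C%:E)%E.
Proof.
move=> rng oOm OB A1 La10 La20 Lp0 Lq0 Lr0 e0 bnd a1b a2b pL qL rL a1L a2L kape C20.
have [/andP[k0 k1] pm1 rMN kap_pm] := rng.
have N0 : 0 < N by rewrite ltr0n.
have pm0 : 0 < pm by lra.
have mO : measurable Om by exact: open_measurable_rV.
have p_bnd x : Om x -> pm <= p x <= rM.
  by move=> /bnd[b1 b2 b3 b4]; apply/andP; split; lra.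
have q_bnd' x : Om x -> pm <= q x <= rM.
  by move=> /bnd[b1 b2 b3 b4]; apply/andP; split; lra.
have r_bnd' x : Om x -> pm <= r x <= rM.
  by move=> /bnd[b1 b2 b3 b4]; apply/andP; split; lra.
have [C1 HC1] := phase_one rng oOm OB Lp0 p_bnd pL C20.
have C1'0 : 0 <= Num.max C1 0 by rewrite le_max lexx orbT.
have srat s x : pm <= p x -> p x <= s -> s <= rM -> N * (s / p x - 1) + N * e <= kap.
  move=> h1 h2 h3; apply: le_trans kape; rewrite lerD2r ler_pM2l// lerD2r.
  by apply: ler_pM; [lra|rewrite invr_ge0; lra|lra|rewrite lef_pV2 ?posrE//; lra].
have q_bnd x : Om x -> [/\ pm <= p x, p x <= q x, q x <= rM &
    N * (q x / p x - 1) + N * e <= kap].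
  by move=> /bnd[b1 b2 b3 b4]; split => //; [lra|apply: srat => //; lra].
have r_bnd x : Om x -> [/\ pm <= p x, p x <= r x, r x <= rM &
    N * (r x / p x - 1) + N * e <= kap].
  by move=> /bnd[b1 b2 b3 b4]; split => //; [lra|apply: srat => //; lra].
have [Cq HCq] := phase_next rng oOm OB A1 La10 Lq0 e0 a1b a1L q_bnd pL qL C1'0 C20.
have [Cr HCr] := phase_next rng oOm OB A1 La20 Lr0 e0 a2b a2L r_bnd pL rL C1'0 C20.
exists (C1 + Cq + Cr) => phi phiC C2i.
have mphi : measurable_fun Om (phi : V -> measurableTypeR R).
  apply: measurable_funTS; apply: open_continuous_measurable_rV => [|x _]; first exact: openT.
  by case: phiC => + _ _ _; exact.
have tp i (w : V -> R) : (forall x, Om x -> 0 <= w x <= triple_phase p q r a1 a2 x `|partial i phi x|) ->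
    (\int[mu]_(x in Om) (w x)%:E <= C2%:E)%E.
  move=> hw; apply: le_trans (C2i i); apply: integral_le_dominated => x Ox;
    by have /andP[h1 h2] := hw _ Ox; rewrite lee_fin.
have tge x i : Om x -> [/\ 0 <= `|partial i phi x| `^ p x,
    0 <= a1 x * `|partial i phi x| `^ q x & 0 <= a2 x * `|partial i phi x| `^ r x].
  move=> Ox; have /andP[h1 _] := a1b _ Ox; have /andP[h2 _] := a2b _ Ox.
  by split; rewrite ?mulr_ge0// powR_ge0.
have I1 : (\int[mu]_(x in Om) (`|phi x| `^ (kap * sobolev_conj p x))%:E <= C1%:E)%E.
  apply: HC1 => // i; apply: (tp i) => x Ox; have [t1 t2 t3] := tge x i Ox.
  by rewrite /triple_phase t1 -addrA lerDl addr_ge0.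
have I1' : (\int[mu]_(x in Om) (`|phi x| `^ (kap * sobolev_conj p x))%:E <=
    (Num.max C1 0)%:E)%E.
  by apply: (le_trans I1); rewrite lee_fin le_max lexx.
have Iq : (\int[mu]_(x in Om) ((a1 x `^ (q x)^-1 * `|phi x|) `^
    (kap * sobolev_conj q x))%:E <= Cq%:E)%E.
  apply: HCq => // i; apply: (tp i) => x Ox; have [t1 t2 t3] := tge x i Ox.
  by rewrite /triple_phase t2 addrAC lerDr addr_ge0.
have Ir : (\int[mu]_(x in Om) ((a2 x `^ (r x)^-1 * `|phi x|) `^
    (kap * sobolev_conj r x))%:E <= Cr%:E)%E.
  apply: HCr => // i; apply: (tp i) => x Ox; have [t1 t2 t3] := tge x i Ox.
  by rewrite /triple_phase t3 lerDr addr_ge0.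
rewrite /conj_energy.
have bndN s : (forall x, Om x -> pm <= s x <= rM) -> forall x, Om x -> 0 < s x < N.
  by move=> h x /h/andP[h1 h2]; apply/andP; split; lra.
have mp := measurable_conj_term1 kap oOm (bndN _ p_bnd) pL mphi.
have mq := measurable_conj_term kap oOm (bndN _ q_bnd') a1L qL mphi.
have mr := measurable_conj_term kap oOm (bndN _ r_bnd') a2L rL mphi.
apply: (ge0_integral_add3_le mO _ _ _ mp mq mr I1 Iq Ir) => x _; exact: powR_ge0.
Qed.

End three_phases.

(** * Differences of weak gradients *)

Section weak_gradient_sub.
Variables (R : realType) (n : nat) (Om : set 'rV[R]_n.+1).
Local Notation V := 'rV[R]_n.+1.
Local Notation mu := (@lebesgue_rV R n.+1).
Hypothesis oOm : open Om.

Lemma compact_measurable_rV (K : set V) : compact K -> measurable K.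
Proof.
by move=> cK; apply: closed_measurable_rV; apply: compact_closed => //; exact: norm_hausdorff.
Qed.

(** An open set is a countable union of compact boxes. *)
Lemma loc_integrable_measurable (f : V -> R) : loc_integrable Om f ->
  measurable_fun Om (f : V -> measurableTypeR R).
Proof.
move=> lf; have [l [u [luO Olu]]] := open_cover_boxes oOm.
have -> : Om = \bigcup_k cbox (l k) (u k).
  apply/seteqP; split => x; last by move=> [k _]; exact: luO.
  move=> /Olu[k _ xk]; exists k => //= i; have := xk i.
  by rewrite /= !in_itv/= => /andP[h1 h2]; rewrite !ltW.
apply/measurable_fun_bigcup => k; first exact: measurable_cbox.
have := lf _ (@cbox_compact _ _ (l k) (u k)) (luO k).
by move=> /measurable_int/measurable_EFinP.
Qed.

Lemma loc_integrableB (f g : V -> R) : loc_integrable Om f -> loc_integrable Om g ->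
  loc_integrable Om (f \- g).
Proof.
move=> lf lg K cK KO; have := integrableB _ (lf _ cK KO) (lg _ cK KO).
by apply; exact: compact_measurable_rV.
Qed.

Lemma test_function_partial (phi : V -> R) i : test_function Om phi ->
  test_function Om (partial i phi).
Proof.
move=> [sphi cphi clO].
have sub : closure [set x | partial i phi x != 0] `<=` closure [set x | phi x != 0].
  rewrite ((closure_id (closure [set x | phi x != 0])).1 (@closed_closure _ _)).
  apply: closure_subset => x /= px; apply: contrapT => xK; move/negP: px; apply; apply/eqP.
  have px0 : \forall y \near x, cst 0 y = phi y.
    have oK : open (~` closure [set x | phi x != 0]) by rewrite openC; exact: closed_closure.
    have : nbhs x (~` closure [set x | phi x != 0]) by exact: open_nbhs_nbhs.
    apply: filterS => y yK; apply/esym; apply: contrapT => /eqP py; apply: yK.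
    exact: subset_closure.
  rewrite /partial.
  by have [_ ->] := near_eq_is_derive px0 (is_derive_cst (0 : R) x (delta_mx ord0 i : V)).
split.
- by move=> k; have [_ /(_ i)[_]] := sphi k.+1.
- apply: subclosed_compact sub => //; exact: closed_closure.
- exact: subset_trans sub clO.
Qed.

(** A partial derivative of a test function is a test function, so both sides
    are integrals of integrable functions and linearity applies. *)
Lemma weak_gradientB (u v : V -> R) (G H : V -> V) : weak_gradient Om u G ->
  weak_gradient Om v H -> weak_gradient Om (u \- v) (fun x => G x - H x).
Proof.
move=> [lu lG HG] [lv lH HH].
have mO : measurable Om by exact: open_measurable_rV.
have lGH i : loc_integrable Om (fun x => (G x - H x) ord0 i).
  rewrite (_ : (fun x => _) = (fun x => G x ord0 i) \- (fun x => H x ord0 i)).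
    exact: loc_integrableB.
  by apply/funext => x; rewrite !mxE.
split => // [|i phi tphi]; first exact: loc_integrableB.
have tp := test_function_partial i tphi.
under eq_Rintegral do rewrite mulrBl.
rewrite RintegralB//; [|exact: loc_integrable_test..].
under [in RHS]eq_Rintegral do rewrite !mxE mulrBl.
rewrite RintegralB//; [|exact: loc_integrable_test..].
by rewrite HG// HH// opprB opprK addrC.
Qed.

End weak_gradient_sub.

(** * Modulars and Luxemburg norms *)

Section triple_phase_theory.
Variables (R : realType) (n : nat).
Local Notation V := 'rV[R]_n.+1.

(** The bounds on exponents and weights at one point that the inequalities for
    the modular function need. *)
Definition phase_at (p q r a1 a2 : V -> R) (rM : R) (x : V) :=
  [/\ 1 <= p x <= rM, 1 <= q x <= rM, 1 <= r x <= rM & 0 <= a1 x /\ 0 <= a2 x].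

Lemma powRD_le (e rM s t : R) : 0 <= e <= rM -> 0 <= s -> 0 <= t ->
  (s + t) `^ e <= 2 `^ rM * (s `^ e + t `^ e).
Proof.
move=> /andP[e0 eM] s0 t0.
have st w : 0 <= w -> (2 * w) `^ e <= 2 `^ rM * w `^ e.
  move=> w0; rewrite powRM//; apply: ler_wpM2r; first exact: powR_ge0.
  by apply: ler_powR => //; rewrite ler1n.
have [h|h] := leP s t.
  apply: (@le_trans _ _ ((2 * t) `^ e)).
    by apply: ge0_ler_powR; rewrite ?nnegrE ?addr_ge0 ?mulr_ge0//; lra.
  apply: (le_trans (st _ t0)); apply: ler_wpM2l; first exact: powR_ge0.
  by rewrite lerDr powR_ge0.
apply: (@le_trans _ _ ((2 * s) `^ e)).
  by apply: ge0_ler_powR; rewrite ?nnegrE ?addr_ge0 ?mulr_ge0//; lra.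
apply: (le_trans (st _ s0)); apply: ler_wpM2l; first exact: powR_ge0.
by rewrite lerDl powR_ge0.
Qed.

Lemma powR_scale_le1 (e c t : R) : 1 <= e -> 0 <= c <= 1 -> 0 <= t ->
  (c * t) `^ e <= c * t `^ e.
Proof.
move=> e1 /andP[c0 c1] t0; rewrite powRM//; apply: ler_wpM2r; first exact: powR_ge0.
have [->|cn0] := eqVneq c 0; first by rewrite powR0// gt_eqF//; lra.
by rewrite -{2}(powRr1 c0); apply: ger_powR => //; rewrite lt0r cn0 c0.
Qed.

Lemma powR_scale_ge1 (e rM c t : R) : e <= rM -> 1 <= c -> 0 <= t ->
  (c * t) `^ e <= c `^ rM * t `^ e.
Proof.
move=> eM c1 t0; rewrite powRM//; last by lra.
by apply: ler_wpM2r; [exact: powR_ge0|exact: ler_powR].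
Qed.

Section at_point.
Variables (p q r a1 a2 : V -> R) (rM : R) (x : V).
Local Notation T := (triple_phase p q r a1 a2 x).
Hypothesis ok : phase_at p q r a1 a2 rM x.

Lemma triple_phase_ge0 t : 0 <= T t.
Proof. by case: ok => _ _ _ [h1 h2]; rewrite /triple_phase !addr_ge0 ?mulr_ge0 ?powR_ge0. Qed.

Lemma triple_phase_mono s t : 0 <= s -> s <= t -> T s <= T t.
Proof.
case: ok => /andP[p1 _] /andP[q1 _] /andP[r1 _] [h1 h2] s0 st; have t0 : 0 <= t by lra.
rewrite /triple_phase; apply: lerD; first apply: lerD.
- by apply: ge0_ler_powR; rewrite ?nnegrE//; lra.
- by apply: ler_wpM2l => //; apply: ge0_ler_powR; rewrite ?nnegrE//; lra.
- by apply: ler_wpM2l => //; apply: ge0_ler_powR; rewrite ?nnegrE//; lra.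
Qed.

Lemma powR_le_triple_phase t : t `^ p x <= T t.
Proof.
case: ok => _ _ _ [h1 h2]; rewrite /triple_phase -addrA lerDl.
by rewrite addr_ge0 ?mulr_ge0 ?powR_ge0.
Qed.

Lemma triple_phaseD s t : 0 <= s -> 0 <= t -> T (s + t) <= 2 `^ rM * (T s + T t).
Proof.
case: ok => /andP[p1 pM] /andP[q1 qM] /andP[r1 rM'] [h1 h2] s0 t0.
have -> : 2 `^ rM * (T s + T t) = 2 `^ rM * (s `^ p x + t `^ p x) +
   a1 x * (2 `^ rM * (s `^ q x + t `^ q x)) + a2 x * (2 `^ rM * (s `^ r x + t `^ r x)).
  by rewrite /triple_phase; ring.
rewrite /triple_phase; apply: lerD; first apply: lerD.
- by apply: powRD_le => //; apply/andP; split; lra.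
- by apply: ler_wpM2l => //; apply: powRD_le => //; apply/andP; split; lra.
- by apply: ler_wpM2l => //; apply: powRD_le => //; apply/andP; split; lra.
Qed.

Lemma triple_phase_scale_le1 c t : 0 <= c <= 1 -> 0 <= t -> T (c * t) <= c * T t.
Proof.
case: ok => /andP[p1 pM] /andP[q1 qM] /andP[r1 rM'] [h1 h2] c01 t0.
rewrite /triple_phase !mulrDr; apply: lerD; first apply: lerD.
- exact: powR_scale_le1.
- by rewrite mulrCA; apply: ler_wpM2l => //; exact: powR_scale_le1.
- by rewrite mulrCA; apply: ler_wpM2l => //; exact: powR_scale_le1.
Qed.

Lemma triple_phase_scale_ge1 c t : 1 <= c -> 0 <= t -> T (c * t) <= c `^ rM * T t.
Proof.
case: ok => /andP[p1 pM] /andP[q1 qM] /andP[r1 rM'] [h1 h2] c01 t0.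
rewrite /triple_phase !mulrDr; apply: lerD; first apply: lerD.
- exact: powR_scale_ge1.
- by rewrite mulrCA; apply: ler_wpM2l => //; exact: powR_scale_ge1.
- by rewrite mulrCA; apply: ler_wpM2l => //; exact: powR_scale_ge1.
Qed.

End at_point.

Section modular_theory.
Variables (Om : set V) (p q r a1 a2 : V -> R) (rM : R).
Local Notation T := (triple_phase p q r a1 a2).
Local Notation mu := (@lebesgue_rV R n.+1).
Hypothesis mO : measurable Om.
Hypothesis ok : forall x, Om x -> phase_at p q r a1 a2 rM x.
Hypotheses (mp : measurable_fun Om (p : V -> measurableTypeR R))
  (mq : measurable_fun Om (q : V -> measurableTypeR R))
  (mr : measurable_fun Om (r : V -> measurableTypeR R))
  (ma1 : measurable_fun Om (a1 : V -> measurableTypeR R))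
  (ma2 : measurable_fun Om (a2 : V -> measurableTypeR R)).

Lemma measurable_triple_phase (w : V -> R) : measurable_fun Om (w : V -> measurableTypeR R) ->
  measurable_fun Om ((fun x => T x `|w x|) : V -> measurableTypeR R).
Proof.
move=> mw; have mnw : measurable_fun Om ((fun x => `|w x|) : V -> measurableTypeR R).
  exact: measurableT_comp.
apply: measurable_funD; first apply: measurable_funD.
- exact: measurable_powR_fun.
- by apply: measurable_funM => //; exact: measurable_powR_fun.
- by apply: measurable_funM => //; exact: measurable_powR_fun.
Qed.

Lemma modular_ge0 (w : V -> R) : (0 <= modular Om T w)%E.
Proof. by apply: integral_ge0 => x Ox; rewrite lee_fin (triple_phase_ge0 (ok Ox)). Qed.

(** Used with c < 1, when v is a fraction of w, and with c > 1, when it is a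
    multiple. *)
Lemma modular_comparison (w v : V -> R) (c : R) : 0 <= c ->
  measurable_fun Om (w : V -> measurableTypeR R) ->
  (forall x, Om x -> T x `|v x| <= c * T x `|w x|) ->
  (modular Om T v <= c%:E * modular Om T w)%E.
Proof.
move=> c0 mw vw; rewrite /modular -ge0_integralZl_EFin//; first last.
- by apply/measurable_EFinP; exact: measurable_triple_phase.
- by move=> x Ox; rewrite lee_fin (triple_phase_ge0 (ok Ox)).
apply: integral_le_dominated => x Ox; first by rewrite lee_fin (triple_phase_ge0 (ok Ox)).
by rewrite -EFinM lee_fin vw.
Qed.

(** Dividing by L >= 1 divides the modular by at least L, since all exponents
    are at least 1. *)
Lemma luxemburg_set_nonempty (w : V -> R) : measurable_fun Om (w : V -> measurableTypeR R) ->
  (modular Om T w < +oo)%E ->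
  [set L : R | 0 < L /\ (modular Om T (fun x => w x / L)%R <= 1)%E] !=set0.
Proof.
move=> mw wfin; have mwf : modular Om T w \is a fin_num by rewrite ge0_fin_numE// modular_ge0.
pose L := fine (modular Om T w) + 1.
have f0 : 0 <= fine (modular Om T w) by rewrite fine_ge0// modular_ge0.
have L1 : 1 <= L by rewrite /L lerDr.
have L0 : 0 < L by lra.
exists L; split => //.
apply: (@le_trans _ _ ((L^-1)%:E * modular Om T w)%E).
  apply: modular_comparison => //; first by rewrite invr_ge0 ltW.
  move=> x Ox; rewrite normrM mulrC (ger0_norm (ltW _)) ?invr_gt0//.
  apply: (triple_phase_scale_le1 (ok Ox)) => //.
  by rewrite invr_ge0 (ltW L0) invf_le1.
by rewrite -(fineK mwf) -EFinM lee_fin mulrC ler_pdivrMr// mul1r /L lerDl.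
Qed.

Lemma luxemburg_ge0 (w : V -> R) : 0 <= luxemburg Om T w.
Proof.
rewrite /luxemburg; set S := [set L | _]; have [->|/set0P ne] := eqVneq S set0.
  by rewrite inf0.
by apply: lb_le_inf => // L [L0 _]; exact: ltW.
Qed.

(** Below 1 the modular is smaller than the norm. The hypothesis of finite
    modular matters because the infimum of the empty set is 0. *)
Lemma modular_lt_of_luxemburg (w : V -> R) (e : R) : measurable_fun Om (w : V -> measurableTypeR R) ->
  (modular Om T w < +oo)%E -> e <= 1 -> luxemburg Om T w < e ->
  (modular Om T w <= e%:E)%E.
Proof.
move=> mw wfin e1 /(inf_lt (luxemburg_set_nonempty mw wfin))[L [L0 mL] Le].
have mwL : measurable_fun Om ((fun x => w x / L) : V -> measurableTypeR R).
  by apply: measurable_funM => //; exact: measurable_cst.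
apply: (@le_trans _ _ (L%:E * modular Om T (fun x => w x / L)%R)%E).
  apply: modular_comparison => //; first exact: ltW.
  move=> x Ox; rewrite [in leLHS](_ : w x = L * (w x / L)); last by rewrite mulrC divfK// gt_eqF.
  rewrite normrM (ger0_norm (ltW L0)).
  by apply: (triple_phase_scale_le1 (ok Ox)) => //; rewrite (ltW L0)/=; lra.
apply: (@le_trans _ _ (L%:E * 1)%E); first by apply: lee_wpmul2l => //; rewrite lee_fin ltW.
by rewrite mule1 lee_fin ltW.
Qed.

Lemma modularD_le (w v z : V -> R) : measurable_fun Om (w : V -> measurableTypeR R) ->
  measurable_fun Om (v : V -> measurableTypeR R) ->
  (forall x, Om x -> `|z x| <= `|w x| + `|v x|) ->
  (modular Om T z <= (2 `^ rM)%:E * (modular Om T w + modular Om T v))%E.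
Proof.
move=> mw mv zwv.
have mTw := measurable_triple_phase mw; have mTv := measurable_triple_phase mv.
rewrite /modular -ge0_integralD//; first last.
- exact/measurable_EFinP.
- by move=> x Ox; rewrite lee_fin (triple_phase_ge0 (ok Ox)).
- exact/measurable_EFinP.
- by move=> x Ox; rewrite lee_fin (triple_phase_ge0 (ok Ox)).
rewrite -ge0_integralZl_EFin//; first last.
- by apply: emeasurable_funD; apply/measurable_EFinP; [exact: mTw|exact: mTv].
- by move=> x Ox; rewrite adde_ge0// lee_fin (triple_phase_ge0 (ok Ox)).
apply: integral_le_dominated => x Ox; first by rewrite lee_fin (triple_phase_ge0 (ok Ox)).
rewrite -EFinD -EFinM lee_fin.
apply: le_trans (triple_phaseD (ok Ox) (normr_ge0 _) (normr_ge0 _)).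
by apply: (triple_phase_mono (ok Ox)) => //; exact: zwv.
Qed.

Lemma modular_bounded_lty (v : V -> R) (A M : R) : (mu Om < +oo)%E ->
  (forall x, Om x -> a1 x <= A /\ a2 x <= A) ->
  (forall x, Om x -> `|v x| <= M) -> (modular Om T v < +oo)%E.
Proof.
move=> muO aA vM.
pose M1 := Num.max M 1.
have M11 : 1 <= M1 by rewrite /M1 le_max lexx orbT.
apply: (@le_lt_trans _ _ (\int[mu]_(x in Om) (M1 `^ rM * (1 + A + A))%:E)%E); last first.
  have muf : mu Om \is a fin_num by rewrite ge0_fin_numE.
  have -> : (\int[mu]_(x in Om) (M1 `^ rM * (1 + A + A))%:E =
      (M1 `^ rM * (1 + A + A))%:E * mu Om)%E by rewrite integral_cst.
  by rewrite -(fineK muf) -EFinM ltry.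
apply: integral_le_dominated => x Ox; first by rewrite lee_fin (triple_phase_ge0 (ok Ox)).
have [h1 h2] := aA _ Ox.
rewrite lee_fin; apply: (@le_trans _ _ (T x (M1 * 1))).
  by apply: (triple_phase_mono (ok Ox)) => //; rewrite mulr1 le_max vM.
apply: (le_trans (triple_phase_scale_ge1 (ok Ox) M11 ler01)).
by apply: ler_wpM2l; [exact: powR_ge0|rewrite /triple_phase !powR1 !mulr1; lra].
Qed.

End modular_theory.
End triple_phase_theory.

(** * Approximation by test functions *)

Section approximation.
Variables (R : realType) (n : nat).
Local Notation V := 'rV[R]_n.+1.
Local Notation mu := (@lebesgue_rV R n.+1).
Variables (Om : set V) (p q r a1 a2 : V -> R) (rM A B : R).
Local Notation T := (triple_phase p q r a1 a2).
Hypotheses (oOm : open Om) (OB : forall x, Om x -> forall i, `|x ord0 i| <= B).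
Hypothesis ok : forall x, Om x -> phase_at p q r a1 a2 rM x.
Hypothesis aA : forall x, Om x -> a1 x <= A /\ a2 x <= A.
Hypotheses (mp : measurable_fun Om (p : V -> measurableTypeR R))
  (mq : measurable_fun Om (q : V -> measurableTypeR R))
  (mr : measurable_fun Om (r : V -> measurableTypeR R))
  (ma1 : measurable_fun Om (a1 : V -> measurableTypeR R))
  (ma2 : measurable_fun Om (a2 : V -> measurableTypeR R)).

Lemma enorm_le_norm (v : V) : enorm v <= n.+1%:R * `|v|.
Proof.
have c0 : 0 <= n.+1%:R * `|v| by rewrite mulr_ge0.
rewrite -(ger0_norm c0) -sqrtr_sqr; apply: ler_wsqrtr.
apply: (@le_trans _ _ (\sum_(i < n.+1) `|v| ^+ 2)).
  apply: ler_sum => i _; rewrite -real_normK ?num_real// ler_pXn2r ?nnegrE//.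
  exact: coord_le_norm.
rewrite sumr_const card_ord -[leLHS]mulr_natl exprMn.
have n1 : 1 <= (n.+1%:R : R) by rewrite ler1n.
by apply: ler_wpM2r; [exact: sqr_ge0|rewrite expr2 ler_peMl// (le_trans ler01)].
Qed.

Lemma measurable_enorm (G : V -> V) : (forall i, loc_integrable Om (fun x => G x ord0 i)) ->
  measurable_fun Om ((fun x => enorm (G x)) : V -> measurableTypeR R).
Proof.
move=> lG; apply: (@measurableT_comp _ _ _ _ _ _ (@Num.sqrt R : measurableTypeR R -> measurableTypeR R)).
  by apply: continuous_measurable_fun; exact: sqrt_continuous.
apply: (@measurable_sum _ _ _ Om _ _ (fun i x => G x ord0 i ^+ 2)) => i.
by apply: measurable_funX; exact: loc_integrable_measurable (lG i).
Qed.

Lemma mule_EFinD_lty (c : R) (a b : \bar R) : (0 <= a -> 0 <= b -> a < +oo -> b < +oo ->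
  c%:E * (a + b) < +oo)%E.
Proof.
case: a b => [a| |] [b| |]//= _ _ _ _.
by rewrite -EFinD -EFinM ltry.
Qed.

(** Near u in norm means near in modular. The infimum in the Luxemburg norm of
    the gradient of the difference is meaningful because this gradient is almost
    everywhere the difference of that of u and of that of phi, which is bounded.
    The last clause bounds the classical derivatives of phi by quantities that
    do not depend on the choice of representatives. *)
Lemma W10_approximation (u : V -> R) (e : R) : W10 Om T u -> 0 < e <= 1 ->
  exists phi : V -> R, [/\ test_function Om phi,
    (modular Om T (u \- phi)%R <= e%:E)%E,
    measurable_fun Om (norm_wgrad Om (u \- phi)%R : V -> measurableTypeR R),
    (modular Om T (norm_wgrad Om (u \- phi)%R) <= e%:E)%E &
    {ae mu, forall x, Om x -> forall i,
      `|partial i phi x| <= norm_wgrad Om u x + norm_wgrad Om (u \- phi)%R x}].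
Proof.
move=> [[[mu_ ufin] exG [mg gfin]] dens] /andP[e0 e1].
have mO : measurable Om by exact: open_measurable_rV.
have muO : (mu Om < +oo)%E := lebesgue_bounded_lty mO OB.
have wu : weak_gradient Om u (wgrad Om u) by exact: xgetPex exG.
have [phi tphi phie] := dens _ e0; exists phi.
have phiC := test_function_C1c tphi.
have wphi := weak_gradient_C1c oOm OB phiC.
have wd := weak_gradientB oOm wu wphi.
have wd' : weak_gradient Om (u \- phi)%R (wgrad Om (u \- phi)%R).
  by apply: xgetPex; eexists; exact: wd.
have aeG := weak_gradient_unique oOm wd' wd.
have cphi := phiC; case: cphi => cphi dphi cdphi _.
have mphi : measurable_fun Om (phi : V -> measurableTypeR R).
  by apply: measurable_funTS; apply: open_continuous_measurable_rV => [|x _]; [exact: openT|exact: cphi].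
have mu_phi : measurable_fun Om ((u \- phi)%R : V -> measurableTypeR R).
  exact: measurable_funB.
have mng : measurable_fun Om (norm_wgrad Om (u \- phi)%R : V -> measurableTypeR R).
  by apply: measurable_enorm; case: wd'.
have [M hM] := C1c_boxed OB phiC.
have [M' hM'] : exists M', 0 <= M' /\ forall x, `|grad phi x| <= M'.
  have H i : exists M, forall x, `|partial i phi x| <= M.
    by have [M1 [_ h _]] := C1c_partial_boxed OB i phiC; exists M1.
  have [F hF] := choice H; exists (\sum_i `|F i|); split; first exact: sumr_ge0.
  move=> x; rewrite [leLHS]mx_normrE; apply: bigmax_le; first exact: sumr_ge0.
  move=> [k i] _ /=; rewrite mxE; apply: (le_trans (hF i x)); apply: (le_trans (ler_norm _)).
  by rewrite (bigD1 i)//= lerDl sumr_ge0.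
have [M'0 gM'] := hM'.
have ephi : luxemburg Om T (u \- phi)%R < e /\ luxemburg Om T (norm_wgrad Om (u \- phi)%R) < e.
  have l1 := luxemburg_ge0 Om p q r a1 a2 (u \- phi)%R.
  have l2 := luxemburg_ge0 Om p q r a1 a2 (norm_wgrad Om (u \- phi)%R).
  have aux (a b : R) : 0 <= a -> 0 <= b -> a + b < e -> a < e /\ b < e.
    by move=> a0 b0 ab; split; apply: le_lt_trans ab; rewrite ?lerDl ?lerDr.
  exact: aux l1 l2 phie.
have [phie1 phie2] := ephi.
have aeE : {ae mu, forall x, Om x -> wgrad Om (u \- phi)%R x = wgrad Om u x - grad phi x} by exact: aeG.
have fin1 : (modular Om T (u \- phi)%R < +oo)%E.
  apply: le_lt_trans (modularD_le mO ok mp mq mr ma1 ma2 mu_ mphi _) _.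
    by move=> x _; exact: ler_normB.
  have phifin : (modular Om T phi < +oo)%E.
    by apply: (@modular_bounded_lty _ _ Om p q r a1 a2 rM mO ok phi A M muO aA) => x _; case: hM.
  exact: (mule_EFinD_lty _ (modular_ge0 ok u) (modular_ge0 ok phi) ufin phifin).
(* The dimension n.+1 bounds the ratio of the Euclidean and the sup norm. *)
pose w x := n.+1%:R * norm_wgrad Om u x + n.+1%:R * M'.
have mw1 : measurable_fun Om ((fun x => n.+1%:R * norm_wgrad Om u x) : V -> measurableTypeR R).
  by apply: measurable_funM; [exact: measurable_cst|exact: mg].
have mw2 : measurable_fun Om ((fun x => n.+1%:R * M') : V -> measurableTypeR R).
  exact: measurable_cst.
have mw : measurable_fun Om (w : V -> measurableTypeR R) by exact: measurable_funD.
have wfin : (modular Om T w < +oo)%E.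
  apply: le_lt_trans (modularD_le mO ok mp mq mr ma1 ma2 mw1 mw2 _) _.
    by move=> x _; exact: ler_normD.
  have g1 : (modular Om T (fun x => n.+1%:R * norm_wgrad Om u x)%R < +oo)%E.
    apply: (@le_lt_trans _ _ ((n.+1%:R `^ rM)%:E * modular Om T (norm_wgrad Om u))%E).
      apply: (modular_comparison mO ok mp mq mr ma1 ma2 (powR_ge0 _ _) mg) => x Ox.
      rewrite normrM ger0_norm//.
      by apply: (triple_phase_scale_ge1 (ok Ox)) => //; rewrite ler1n.
    have := mule_EFinD_lty (n.+1%:R `^ rM) (modular_ge0 ok (norm_wgrad Om u)) (lexx 0%E) gfin (ltry 0).
    by rewrite adde0.
  have g2 : (modular Om T (fun=> n.+1%:R * M')%R < +oo)%E.
    apply: (@modular_bounded_lty _ _ Om p q r a1 a2 rM mO ok _ A (n.+1%:R * M') muO aA) => x _.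
    by rewrite ger0_norm// mulr_ge0.
  exact: (mule_EFinD_lty _ (modular_ge0 ok _) (modular_ge0 ok _) g1 g2).
have fin2 : (modular Om T (norm_wgrad Om (u \- phi)%R) < +oo)%E.
  apply: le_lt_trans wfin; apply: ae_ge0_le_integral => //.
  - by move=> x Ox; rewrite lee_fin (triple_phase_ge0 (ok Ox)).
  - by apply/measurable_EFinP; exact: measurable_triple_phase.
  - by move=> x Ox; rewrite lee_fin (triple_phase_ge0 (ok Ox)).
  - by apply/measurable_EFinP; exact: measurable_triple_phase.
  apply: filterS aeE => x h Ox; rewrite lee_fin.
  apply: (triple_phase_mono (ok Ox)) => //.
  have w0 : 0 <= w x by rewrite /w addr_ge0// mulr_ge0// sqrtr_ge0.
  rewrite (ger0_norm w0) ger0_norm ?sqrtr_ge0// /norm_wgrad h//.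
  apply: (le_trans (enorm_le_norm _)); rewrite /w -mulrDr ler_pM2l//.
  apply: (le_trans (ler_normB _ _)); apply: lerD => //; exact: norm_le_enorm.
split => //.
- exact: (modular_lt_of_luxemburg mO ok mp mq mr ma1 ma2).
- exact: (modular_lt_of_luxemburg mO ok mp mq mr ma1 ma2).
apply: filterS aeE => x h Ox i.
have -> : partial i phi x = wgrad Om u x ord0 i - wgrad Om (u \- phi)%R x ord0 i.
  by rewrite h// !mxE opprB addrC subrK.
apply: (le_trans (ler_normB _ _)); apply: lerD; exact: coord_le_enorm.
Qed.

End approximation.

(** * Passage to the limit *)

Section sequences_of_powers.
Variable R : realType.

Lemma powR_lt_cvg0 (u : nat -> R) (s : R) : 0 < s -> (forall k, 0 <= u k) ->
  u k @[k --> \oo] --> 0 -> u k `^ s @[k --> \oo] --> 0.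
Proof.
move=> s0 u0 cu; apply/cvgrPdist_lt => e e0.
have e1 : 0 < e `^ s^-1 by rewrite powR_gt0.
move/cvgrPdist_lt : cu => /(_ _ e1); apply: filterS => k.
rewrite !sub0r !normrN !ger0_norm ?powR_ge0// => h.
have -> : e = (e `^ s^-1) `^ s by rewrite -powRrM mulVf ?powRr1 ?gt_eqF// ltW.
by apply: gt0_ltr_powR; rewrite ?nnegrE// ltW.
Qed.

Lemma cvg_powR (u : nat -> R) (t s : R) : 0 < s -> (forall k, 0 <= u k) -> 0 <= t ->
  u k @[k --> \oo] --> t -> u k `^ s @[k --> \oo] --> t `^ s.
Proof.
move=> s0 u0; rewrite le_eqVlt => /predU1P[<- cu|t0 cu].
  by rewrite powR0 ?gt_eqF//; exact: powR_lt_cvg0.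
rewrite [X in _ --> X]/powR gt_eqF//.
have H : expR (s * ln (u k)) @[k --> \oo] --> expR (s * ln t).
  apply: (@cvg_comp _ _ _ (fun k => s * ln (u k)) expR _ (nbhs (s * ln t))).
    apply: cvgMr; apply: cvg_comp cu _; exact: continuous_ln.
  exact: continuous_expR.
apply: cvg_trans H; apply: near_eq_cvg.
have /cvgrPdist_lt/(_ _ t0) := cu; apply: filterS => k; rewrite ltr_norml => /andP[_ h].
by rewrite /powR gt_eqF//; lra.
Qed.

End sequences_of_powers.

(** The sum of the f k has a finite integral, hence is finite almost everywhere. *)
Lemma ae_cvg0_of_geometric d (T : measurableType d) (R : realType)
    (m : {measure set T -> \bar R}) (D : set T) (f : nat -> T -> R) : measurable D ->
  (forall k, measurable_fun D (f k : T -> measurableTypeR R)) ->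
  (forall k x, D x -> 0 <= f k x) ->
  (forall k, (\int[m]_(x in D) (f k x)%:E <= (2^-1 ^+ k)%:E)%E) ->
  {ae m, forall x, D x -> f k x @[k --> \oo] --> (0 : R)}.
Proof.
move=> mD mf f0 fk.
pose S x := (\sum_(k <oo) (f k x)%:E)%E.
have mS : measurable_fun D S.
  apply: (@ge0_emeasurable_sum _ _ _ D (fun k x => (f k x)%:E) xpredT).
    by move=> k x Dx _; rewrite lee_fin f0.
  by move=> k _; apply/measurable_EFinP; exact: mf.
have S0 x : D x -> (0 <= S x)%E.
  by move=> Dx; apply: nneseries_ge0 => k _ _; rewrite lee_fin f0.
have h0 : 0 <= 2^-1 :> R by rewrite invr_ge0.
have h1 : 2^-1 < 1 :> R by rewrite invf_lt1// ltr1n.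
have intS : (\int[m]_(x in D) S x < +oo)%E.
  rewrite integral_nneseries//; last by move=> k; apply/measurable_EFinP; exact: mf.
  apply: (@le_lt_trans _ _ (\sum_(k <oo) (1 * 2^-1 ^+ k)%:E)%E).
    apply: lee_nneseries => k _; first by move=> _; apply: integral_ge0 => x Dx; rewrite lee_fin f0.
    by rewrite mul1r; exact: fk.
  by apply: le_lt_trans (nneseries_geometric_le ler01 h0 h1) _; rewrite ltry.
have : m.-integrable D S.
  apply/integrableP; split => //; rewrite (eq_integral S)// => x /set_mem Dx.
  by rewrite gee0_abs// S0.
move=> /(integrable_ae mD); apply: filterS => x fin Dx.
have {}fin := fin Dx.
apply: cvg_series_cvg_0; apply: nondecreasing_is_cvgn.
  by apply: nondecreasing_series => k _ _; exact: f0.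
exists (fine (S x)) => _ [k _ <-]; rewrite -lee_fin fineK//.
rewrite /series/= -sumEFin.
apply: (@nneseries_lim_ge R (fun k => (f k x)%:E) xpredT 0 k) => j _ _.
by rewrite lee_fin f0.
Qed.

(** Fatou's lemma when the limit is only known almost everywhere. *)
Lemma ae_fatou_le d (T : measurableType d) (R : realType)
    (m : {measure set T -> \bar R}) (D : set T) (f : nat -> T -> R) (g : T -> R) (C : R) :
  measurable D ->
  (forall k, measurable_fun D (f k : T -> measurableTypeR R)) ->
  measurable_fun D (g : T -> measurableTypeR R) ->
  (forall k x, D x -> 0 <= f k x) -> (forall x, D x -> 0 <= g x) ->
  {ae m, forall x, D x -> f k x @[k --> \oo] --> g x} ->
  (forall k, (\int[m]_(x in D) (f k x)%:E <= C%:E)%E) ->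
  (\int[m]_(x in D) (g x)%:E <= C%:E)%E.
Proof.
move=> mD mf mg f0 g0 fg fC.
have mfE k : measurable_fun D (EFin \o f k) by apply/measurable_EFinP; exact: mf.
have fat := @fatou _ T R m D mD (fun k x => (f k x)%:E) mfE f0.
have lC : (limn_einf (fun k => \int[m]_(x in D) (f k x)%:E) <= C%:E)%E.
  rewrite limn_einf_lim; apply: lime_le; first exact: is_cvg_einfs.
  apply: nearW => k; apply: le_trans (fC k).
  by apply: ereal_inf_lbound; exists k => /=.
apply: le_trans lC; apply: le_trans fat.
apply: ae_ge0_le_integral => //.
- exact/measurable_EFinP.
- move=> x Dx; rewrite limn_einf_lim; apply: lime_ge; first exact: is_cvg_einfs.
  apply: nearW => k; apply: le_ereal_inf_tmp => _ [j _ <-].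
  by rewrite lee_fin f0.
- rewrite (_ : (fun x => _) = (fun x => - limn_esup (fun k => - (f k x)%:E))%E).
    apply: measurableT_comp => //; apply: measurable_fun_limn_esup => k.
    by apply: measurableT_comp => //; exact: mfE.
  by apply/funext => x; rewrite -[RHS]limn_einfN; congr limn_einf; apply/funext => k /=; rewrite opprK.
apply: filterS fg => x h Dx.
have cv : (f k x)%:E @[k --> \oo] --> (g x)%:E.
  by apply: cvg_EFin; [exact: nearW|exact: h].
by rewrite (cvg_limn_einf_sup cv).1.
Qed.

Section energy.
Variables (R : realType) (n : nat).
Local Notation V := 'rV[R]_n.+2.
Local Notation mu := (@lebesgue_rV R n.+2).
Local Notation N := (@GRing.natmul R 1 n.+2).

Lemma C1c_scale (Om : set V) (phi : V -> R) (c : R) : C1c Om phi ->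
  C1c Om (fun x => c * phi x) /\ forall i x, partial i (fun x => c * phi x) x = c * partial i phi x.
Proof.
move=> [cphi dphi cdphi [K KP phiK]].
have E i x : partial i (fun x => c * phi x) x = c * partial i phi x.
  exact: (deriveZ c (dphi i x)).
split; last exact: E.
split.
- by move=> x; apply: (@contM R V x (fun=> c)); [exact: cont_cst|exact: cphi].
- by move=> i x; exact: (derivableZ (k := c) (dphi i x)).
- move=> i x; rewrite (_ : partial i _ = fun x => c * partial i phi x).
    by apply: (@contM R V x (fun=> c)); [exact: cont_cst|exact: cdphi].
  by apply/funext => y; exact: E.
- by exists K => // x /phiK ->; rewrite mulr0.
Qed.

Lemma cvg_conj_energy (kap : R) (p q r a1 a2 : V -> R) (x : V) (u : nat -> R) (t : R) :
  0 < kap -> 0 < p x < N -> 0 < q x < N -> 0 < r x < N ->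
  (forall k, 0 <= u k) -> 0 <= t -> u k @[k --> \oo] --> t ->
  conj_energy kap p q r a1 a2 x (u k) @[k --> \oo] --> conj_energy kap p q r a1 a2 x t.
Proof.
move=> k0 pN qN rN u0 t0 ut.
have c0 s : 0 < s x < N -> 0 < kap * sobolev_conj s x.
  move=> /andP[s0 sN]; rewrite mulr_gt0// /sobolev_conj divr_gt0 ?subr_gt0//.
  by rewrite mulr_gt0// ltr0n.
have H (w : R) s : 0 <= w -> 0 < s x < N ->
    (w * u k) `^ (kap * sobolev_conj s x) @[k --> \oo] -->
    (w * t) `^ (kap * sobolev_conj s x).
  move=> w0 sN; apply: cvg_powR; [exact: c0|by move=> k; rewrite mulr_ge0|by rewrite mulr_ge0|].
  exact: cvgMr.
apply: cvgD; first apply: cvgD.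
- by apply: cvg_powR => //; exact: c0.
- by apply: H => //; exact: powR_ge0.
- by apply: H => //; exact: powR_ge0.
Qed.

(** The bound of phases_bound extends from test functions to W10 by Fatou's
    lemma. Approximating with errors that decrease geometrically makes the
    approximations converge almost everywhere, and the fixed factor K `^ rM
    ensures that the gradients of phi k / L still have modular at most 1 up to a
    constant, however small L is. *)
Lemma integral_conj_energy_le (Om : set V) (p q r a1 a2 : V -> R)
    (kap pm rM A La1 La2 Lp Lq Lr e B : R) :
  phase_range n kap pm rM ->
  open Om -> (forall x, Om x -> forall i, `|x ord0 i| <= B) ->
  1 <= A -> 0 <= La1 -> 0 <= La2 -> 0 <= Lp -> 0 <= Lq -> 0 <= Lr -> 0 < e ->
  (forall x, Om x -> [/\ pm <= p x, p x <= q x, q x <= r x & r x <= rM]) ->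
  (forall x, Om x -> 0 <= a1 x <= A) -> (forall x, Om x -> 0 <= a2 x <= A) ->
  lip_on Om p Lp -> lip_on Om q Lq -> lip_on Om r Lr ->
  lip_on Om a1 La1 -> lip_on Om a2 La2 ->
  N * (rM / pm - 1) + N * e <= kap ->
  exists2 C : R, 0 <= C & forall (u : V -> R) (L : R), W10 Om (triple_phase p q r a1 a2) u ->
    0 < L -> (modular Om (triple_phase p q r a1 a2)
      (fun x => norm_wgrad Om u x / L)%R <= 1)%E ->
    (\int[mu]_(x in Om) (conj_energy kap p q r a1 a2 x `|u x / L|)%:E <= C%:E)%E.
Proof.
move=> rng oOm OB A1 La10 La20 Lp0 Lq0 Lr0 e0 bnd a1b a2b pL qL rL a1L a2L kape.
have [/andP[kap0 kap1] pm1 rMN kap_pm] := rng.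
have mO : measurable Om by exact: open_measurable_rV.
have pqrN x : Om x -> [/\ 0 < p x < N, 0 < q x < N & 0 < r x < N].
  by move=> /bnd[b1 b2 b3 b4]; split; apply/andP; split; lra.
have ok x : Om x -> phase_at p q r a1 a2 rM x.
  move=> Ox; have [b1 b2 b3 b4] := bnd _ Ox.
  have /andP[h1 _] := a1b _ Ox; have /andP[h2 _] := a2b _ Ox.
  by split => //; apply/andP; split; lra.
have aA x : Om x -> a1 x <= A /\ a2 x <= A.
  by move=> Ox; have /andP[_ h1] := a1b _ Ox; have /andP[_ h2] := a2b _ Ox.
have mlip s L : lip_on Om s L -> measurable_fun Om (s : V -> measurableTypeR R).
  by move=> sL; apply: open_continuous_measurable_rV => // x; exact: lip_on_continuous sL.
have mp := mlip _ _ pL; have mq := mlip _ _ qL; have mr := mlip _ _ rL.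
have ma1 := mlip _ _ a1L; have ma2 := mlip _ _ a2L.
pose T := triple_phase p q r a1 a2.
pose C2 : R := 2 `^ rM * 2.
have C20 : 0 <= C2 by rewrite /C2 mulr_ge0// powR_ge0.
have [C HC] := phases_bound rng oOm OB A1 La10 La20 Lp0 Lq0 Lr0 e0 bnd a1b a2b pL qL rL
  a1L a2L kape C20.
exists (Num.max C 0) => [|u L uW L0 gL]; first by rewrite le_max lexx orbT.
have [[[mu_ ufin] exG [mg gfin]] _] := uW.
pose K := Num.max 1 L^-1.
have K1 : 1 <= K by rewrite /K le_max lexx.
have KL : L^-1 <= K by rewrite /K le_max lexx orbT.
have L10 : 0 < L^-1 by rewrite invr_gt0.
have rM0 : 0 <= rM \/ Om = set0.
  have [->|/set0P[x Ox]] := eqVneq Om set0; [by right|left].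
  by have [b1 b2 b3 b4] := bnd _ Ox; lra.
case: rM0 => [rM0|Om0]; last by rewrite Om0 integral_set0 lee_fin le_max lexx orbT.
have c1 : 1 <= K `^ rM by rewrite -(powRr0 K); apply: ler_powR.
have c0 : 0 < K `^ rM by lra.
(* Dividing a gradient by L multiplies its modular by at most K `^ rM. *)
pose ep k : R := 2^-1 ^+ k / K `^ rM.
have h0 : 0 < 2^-1 :> R by rewrite invr_gt0.
have h1 : 2^-1 <= 1 :> R by rewrite invf_le1// ler1n.
have ep_le k : ep k <= 2^-1 ^+ k.
  by rewrite /ep ler_pdivrMr// ler_peMr// exprn_ge0// ltW.
have ep01 k : 0 < ep k <= 1.
  apply/andP; split; first by rewrite /ep divr_gt0// exprn_gt0.
  by apply: (le_trans (ep_le k)); rewrite exprn_ile1// ltW.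
have [phi hphi] := choice (fun k => W10_approximation oOm OB ok aA mp mq mr ma1 ma2 uW (ep01 k)).
pose psi k x := L^-1 * phi k x.
have phiC k : C1c Om (phi k) by have [tphi _ _ _ _] := hphi k; exact: test_function_C1c.
have mphi k : measurable_fun Om (phi k : V -> measurableTypeR R).
  have [cphi _ _ _] := phiC k; apply: measurable_funTS.
  by apply: open_continuous_measurable_rV => [|x _]; [exact: openT|exact: cphi].
have bound k : (\int[mu]_(x in Om) (conj_energy kap p q r a1 a2 x `|psi k x|)%:E <= C%:E)%E.
  have [psiC dpsi] := C1c_scale L^-1 (phiC k).
  apply: HC => // i.
  have [_ _ mgk gk aek] := hphi k.
  have mw1 : measurable_fun Om ((fun x => norm_wgrad Om u x / L) : V -> measurableTypeR R).
    by apply: measurable_funM; [exact: mg|exact: measurable_cst].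
  have mw2 : measurable_fun Om ((fun x => norm_wgrad Om (u \- phi k) x / L) : V -> measurableTypeR R).
    by apply: measurable_funM; [exact: mgk|exact: measurable_cst].
  pose w x := norm_wgrad Om u x / L + norm_wgrad Om (u \- phi k) x / L.
  have mw : measurable_fun Om (w : V -> measurableTypeR R).
    by apply: measurable_funD; [exact: mw1|exact: mw2].
  have wC2 : (modular Om T w <= C2%:E)%E.
    apply: (le_trans (modularD_le mO ok mp mq mr ma1 ma2 mw1 mw2 (fun x _ => ler_normD _ _))).
    rewrite /C2 EFinM; apply: lee_wpmul2l; first by rewrite lee_fin powR_ge0.
    rewrite (_ : 2%:E = 1 + 1)%E//; apply: leeD; first exact: gL.
    apply: (@le_trans _ _ ((K `^ rM)%:E * modular Om T (norm_wgrad Om (u \- phi k)%R))%E).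
      apply: (modular_comparison mO ok mp mq mr ma1 ma2 (powR_ge0 _ _) mgk) => x Ox.
      apply: le_trans (triple_phase_scale_ge1 (ok _ Ox) K1 (normr_ge0 _)).
      apply: (triple_phase_mono (ok _ Ox)) => //.
      by rewrite normrM mulrC (ger0_norm (ltW L10)); apply: ler_wpM2r.
    apply: (@le_trans _ _ ((K `^ rM)%:E * (ep k)%:E)%E).
      by apply: lee_wpmul2l => //; rewrite lee_fin ltW.
    rewrite -EFinM lee_fin /ep mulrCA divff ?mulr1 ?gt_eqF//.
    by rewrite exprn_ile1// ltW.
  apply: le_trans wC2; apply: ae_ge0_le_integral => //.
  - by move=> x Ox; rewrite lee_fin (triple_phase_ge0 (ok _ Ox)).
  - apply/measurable_EFinP; apply: (measurable_triple_phase mO mp mq mr ma1 ma2).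
    have [_ _ cdpsi _] := psiC; apply: measurable_funTS.
    by apply: open_continuous_measurable_rV => [|x _]; [exact: openT|exact: cdpsi].
  - by move=> x Ox; rewrite lee_fin (triple_phase_ge0 (ok _ Ox)).
  - by apply/measurable_EFinP; exact: (measurable_triple_phase mO mp mq mr ma1 ma2).
  apply: filterS aek => x h Ox; rewrite lee_fin; apply: (triple_phase_mono (ok _ Ox)) => //.
  rewrite dpsi normrM (ger0_norm (ltW L10)) /w -mulrDl mulrC.
  rewrite normrM (ger0_norm (ltW L10)); apply: ler_wpM2r; first exact: ltW.
  by apply: le_trans (h Ox i) _; exact: ler_norm.
have conv : {ae mu, forall x, Om x -> phi k x @[k --> \oo] --> u x}.
  have mup k : measurable_fun Om ((fun x => `|u x - phi k x| `^ p x) : V -> measurableTypeR R).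
    have mB : measurable_fun Om ((u \- phi k) : V -> measurableTypeR R).
      by apply: measurable_funB; [exact: mu_|exact: mphi].
    by apply: measurable_powR_fun => //; apply: measurableT_comp => //; exact: mB.
  have small k : (\int[mu]_(x in Om) (`|u x - phi k x| `^ p x)%:E <= (2^-1 ^+ k)%:E)%E.
    have [_ uk _ _ _] := hphi k.
    apply: le_trans (_ : (modular Om T (u \- phi k)%R <= _)%E); last first.
      by apply: (le_trans uk); rewrite lee_fin.
    apply: integral_le_dominated => x Ox; first by rewrite lee_fin powR_ge0.
    by rewrite lee_fin (powR_le_triple_phase (ok _ Ox)).
  apply: filterS (ae_cvg0_of_geometric mO mup (fun k x _ => powR_ge0 _ _) small) => x h Ox.
  have px : 0 < p x by have [/andP[]] := pqrN _ Ox.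
  have := powR_lt_cvg0 _ (fun k => powR_ge0 _ _) (h Ox) => /(_ (p x)^-1).
  rewrite invr_gt0 => /(_ px) H.
  have {}H : `|u x - phi k x| @[k --> \oo] --> 0.
    apply: cvg_trans H; apply: near_eq_cvg; apply: nearW => k.
    by rewrite -powRrM mulfV ?gt_eqF// powRr1.
  apply/cvgrPdist_lt => ee ee0; move/cvgrPdist_lt : H => /(_ _ ee0); apply: filterS => k.
  by rewrite sub0r normrN normr_id.
have mpsi k : measurable_fun Om (psi k : V -> measurableTypeR R).
  by apply: measurable_funM; [exact: measurable_cst|exact: mphi].
apply: (ae_fatou_le mO (fun k => measurable_conj_energy kap oOm pqrN pL qL rL a1L a2L (mpsi k)) _ (fun k x _ => conj_energy_ge0 _ _ _ _ _ _ _ _)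
  (fun x _ => conj_energy_ge0 _ _ _ _ _ _ _ _) _ (fun k => le_trans (bound k) _)).
- apply: (measurable_conj_energy _ oOm pqrN pL qL rL a1L a2L).
  by apply: measurable_funM; [exact: mu_|exact: measurable_cst].
- apply: filterS conv => x h Ox; have [pN qN rN] := pqrN _ Ox.
  apply: cvg_conj_energy => //; apply: cvg_norm; rewrite mulrC.
  by apply: cvgMr; exact: h.
by rewrite lee_fin le_max lexx.
Qed.

End energy.

(** * Growth of the primitive *)

Section growth.
Variable R : realType.

(** The crude bound by the supremum of the integrand is enough, since all terms
    of the growth condition are nondecreasing powers. *)
Lemma norm_primitive_le (m : nat) (f : 'rV[R]_m -> R -> R) (x : 'rV[R]_m) (t b : R) :
  0 <= b -> (forall s, `|s| <= `|t| -> `|f x s| <= b) -> `|primitive f x t| <= b * `|t|.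
Proof.
move=> b0 fb.
have H (l u : R) : l <= u -> (forall s, s \in `[l, u] -> `|f x s| <= b) ->
    `|\int[lebesgue_measure]_(s in `[l, u]) f x s| <= b * (u - l).
  move=> lu h; rewrite /Rintegral.
  have c0 : 0 <= b * (u - l) by rewrite mulr_ge0// subr_ge0.
  have : (`|\int[lebesgue_measure]_(s in `[l, u]) (f x s)%:E| <= (b * (u - l))%:E)%E.
    apply: (@abse_integral_le_dominated _ _ _ _ _ _ (fun=> b)) => [s sl|]; first exact: h.
    rewrite integral_cst//= lebesgue_measure_itv/= lte_fin.
    case: ltP => _; first by rewrite -EFinD -EFinM.
    by rewrite mule0 lee_fin.
  by case: (\int[_]_(_ in _) _)%E => [y| |] //=; rewrite ?normr0// abse_EFin lee_fin.
rewrite /primitive; case: ifPn => t0.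
  rewrite (ger0_norm t0) -[X in b * X]subr0; apply: H => // s; rewrite in_itv/= => /andP[s0 st].
  by apply: fb; rewrite !ger0_norm.
have {}t0 : t < 0 by rewrite ltNge.
rewrite normrN (ltr0_norm t0) -(sub0r t); apply: H; first exact: ltW.
move=> s; rewrite in_itv/= => /andP[ts s0].
by apply: fb; rewrite ler0_norm// (ltr0_norm t0) lerN2.
Qed.

(** The primitive of the bound in the growth condition, up to constants:
    w2 and w3 stand for the weights at a point and e1, e2, e3 for the exponents. *)
Definition growth (w2 w3 e1 e2 e3 t : R) : R := t `^ e1 + w2 * t `^ e2 + w3 * t `^ e3.

Lemma growth_ge0 w2 w3 e1 e2 e3 t : 0 <= w2 -> 0 <= w3 -> 0 <= growth w2 w3 e1 e2 e3 t.
Proof. by move=> *; rewrite /growth !addr_ge0 ?mulr_ge0 ?powR_ge0. Qed.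

Lemma powR_scale_max (am aM e L t : R) : am <= e <= aM -> 0 < L -> 0 <= t ->
  (L * t) `^ e <= Num.max (L `^ am) (L `^ aM) * t `^ e.
Proof.
move=> /andP[ame eaM] L0 t0; rewrite (powRM _ (ltW L0) t0); apply: ler_wpM2r; first exact: powR_ge0.
rewrite le_max; have [L1|L1] := leP 1 L; apply/orP; [right|left].
  exact: ler_powR.
by apply: ger_powR => //; rewrite L0 ltW.
Qed.

(** The two powers of the norm in the theorem arise here: L `^ e is
    largest at one end of the range of e, depending on whether L is less than 1. *)
Lemma growth_scale_max (w2 w3 am aM e1 e2 e3 L t : R) : 0 <= w2 -> 0 <= w3 ->
  am <= e1 <= aM -> am <= e2 <= aM -> am <= e3 <= aM -> 0 < L -> 0 <= t ->
  growth w2 w3 e1 e2 e3 (L * t) <= Num.max (L `^ am) (L `^ aM) * growth w2 w3 e1 e2 e3 t.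
Proof.
move=> w20 w30 h1 h2 h3 L0 t0; rewrite /growth !mulrDr.
apply: lerD; first apply: lerD.
- exact: powR_scale_max.
- by rewrite (mulrCA _ w2); apply: ler_wpM2l => //; exact: powR_scale_max.
- by rewrite (mulrCA _ w3); apply: ler_wpM2l => //; exact: powR_scale_max.
Qed.

Lemma powR_le_add1 (y s s' : R) : 0 <= y -> 0 <= s <= s' -> y `^ s <= 1 + y `^ s'.
Proof.
move=> y0 /andP[s0 ss]; have [y1|y1] := leP y 1.
  apply: (@le_trans _ _ 1); last by rewrite lerDl powR_ge0.
  have -> : 1 = 1 `^ s :> R by rewrite powR1.
  by apply: ge0_ler_powR; rewrite ?nnegrE.
by apply: ler_wpDl => //; apply: ler_powR => //; exact: ltW.
Qed.

Lemma powR_add3_le (t x y z : R) : 0 <= t -> 0 <= x -> 0 <= y -> 0 <= z ->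
  (x + y + z) `^ t <= 3 `^ t * (x `^ t + y `^ t + z `^ t).
Proof.
move=> t0 x0 y0 z0.
have key m : 0 <= m -> x <= m -> y <= m -> z <= m -> m `^ t <= x `^ t + y `^ t + z `^ t ->
    (x + y + z) `^ t <= 3 `^ t * (x `^ t + y `^ t + z `^ t).
  move=> m0 xm ym zm h; apply: (@le_trans _ _ ((3 * m) `^ t)).
    by apply: ge0_ler_powR; rewrite ?nnegrE ?addr_ge0 ?mulr_ge0//; lra.
  by rewrite powRM//; apply: ler_wpM2l; [exact: powR_ge0|].
have hx := powR_ge0 x t; have hy := powR_ge0 y t; have hz := powR_ge0 z t.
have [xy|xy] := leP x y; [have [yz|yz] := leP y z|have [xz|xz] := leP x z].
- by apply: (key z) => //; lra.
- by apply: (key y) => //; lra.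
- by apply: (key z) => //; lra.
- by apply: (key x) => //; lra.
Qed.

End growth.

(** The power of the weight in the growth condition is exactly what makes each
    term a power of the corresponding a `^ s^-1 * y; a smaller power is then
    dominated by 1 plus a larger one. *)
Lemma growth_le_conj_energy (R : realType) (n : nat) (p q r a1 a2 al1 al2 al3 : 'rV[R]_n.+2 -> R)
    (kap t : R) (x : 'rV[R]_n.+2) (y : R) : 0 <= t -> 0 <= y ->
  0 < q x -> 0 < r x ->
  0 <= al1 x * t <= kap * sobolev_conj p x ->
  0 <= al2 x * t <= kap * sobolev_conj q x ->
  0 <= al3 x * t <= kap * sobolev_conj r x ->
  growth (a1 x `^ (al2 x / q x)) (a2 x `^ (al3 x / r x)) (al1 x) (al2 x) (al3 x) y `^ t <=
  3 `^ t * (3 + conj_energy kap p q r a1 a2 x y).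
Proof.
move=> t0 y0 q0 r0 h1 h2 h3; rewrite /growth.
apply: (le_trans (powR_add3_le t0 (powR_ge0 _ _) _ _)); rewrite ?mulr_ge0 ?powR_ge0//.
apply: ler_wpM2l; first exact: powR_ge0.
have e2 : (a1 x `^ (al2 x / q x) * y `^ al2 x) `^ t = (a1 x `^ (q x)^-1 * y) `^ (al2 x * t).
  by rewrite !(powRM _ (powR_ge0 _ _)) ?powR_ge0// -!powRrM; congr (_ `^ _ * _); ring.
have e3 : (a2 x `^ (al3 x / r x) * y `^ al3 x) `^ t = (a2 x `^ (r x)^-1 * y) `^ (al3 x * t).
  by rewrite !(powRM _ (powR_ge0 _ _)) ?powR_ge0// -!powRrM; congr (_ `^ _ * _); ring.
rewrite e2 e3 -powRrM.
have k1 := powR_le_add1 y0 h1.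
have k2 := powR_le_add1 (mulr_ge0 (powR_ge0 (a1 x) (q x)^-1) y0) h2.
have k3 := powR_le_add1 (mulr_ge0 (powR_ge0 (a2 x) (r x)^-1) y0) h3.
have aux (X Y Z : R) : 1 + X + (1 + Y) + (1 + Z) = 3 + (X + Y + Z) by ring.
by apply: (le_trans (lerD (lerD k1 k2) k3)); rewrite aux.
Qed.

(** * The double integral for given exponents *)

Section passage_to_norm.
Variable R : realType.

Lemma inf_cvg (S : set R) : S !=set0 -> (forall L, S L -> 0 <= L) ->
  exists2 l : nat -> R, forall k, S (l k) & l k @[k --> \oo] --> inf S.
Proof.
move=> S0 Sge; have lbS : has_lbound S by exists 0 => L /Sge.
have hS : has_inf S by split.
have H k : exists L, S L /\ L < inf S + (k.+1%:R)^-1.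
  have k0 : 0 < (k.+1%:R : R)^-1 by rewrite invr_gt0.
  have [L SL lt] := inf_adherent k0 hS.
  by exists L.
have [l hl] := choice H; exists l => [k|]; first by have [] := hl k.
apply: (@squeeze_cvgr _ _ _ _ (fun=> inf S) (fun k => inf S + (k.+1%:R)^-1)).
- apply: nearW => k; have [Sk lk] := hl k; rewrite (ltW lk) andbT.
  exact: ge_inf.
- exact: cvg_cst.
- rewrite -[X in _ --> X]addr0; apply: cvgD; first exact: cvg_cst.
  exact: cvg_harmonic.
Qed.

(** Powers with positive exponent are continuous up to 0, so a bound valid for
    all elements of S passes to the infimum, even when it is 0. *)
Lemma le_max_powR_inf (S : set R) (i C am aM : R) : S !=set0 -> (forall L, S L -> 0 < L) ->
  0 < C -> 0 < am -> 0 < aM ->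
  (forall L, S L -> i <= C * Num.max (L `^ am) (L `^ aM)) ->
  i <= C * Num.max (inf S `^ am) (inf S `^ aM).
Proof.
move=> S0 Sgt C0 am0 aM0 h.
have [l Sl lS] := inf_cvg S0 (fun L SL => ltW (Sgt L SL)).
have l0 k : 0 <= l k by exact/ltW/Sgt.
have inf0 : 0 <= inf S by apply: lb_le_inf => // L /Sgt/ltW.
have c1 := cvg_powR am0 l0 inf0 lS; have c2 := cvg_powR aM0 l0 inf0 lS.
rewrite leNgt; apply/negP; rewrite -ltr_pdivlMl// gt_max => /andP[lt1 lt2].
have : \forall k \near \oo, l k `^ am < C^-1 * i by exact: (cvgr_lt _ c1).
have : \forall k \near \oo, l k `^ aM < C^-1 * i by exact: (cvgr_lt _ c2).
move=> n2 n1; have [k [k1 k2]] := @filter_ex _ _ _ _ (filterI n1 n2).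
have := h _ (Sl k); apply/negP; rewrite -ltNge -ltr_pdivlMl// gt_max.
by apply/andP; split.
Qed.

End passage_to_norm.

Section core.
Variables (R : realType) (n : nat).
Local Notation V := 'rV[R]_n.+2.
Local Notation mu := (@lebesgue_rV R n.+2).
Local Notation N := (@GRing.natmul R 1 n.+2).

Lemma norm_primitive_growth_le (f : V -> R -> R) (x : V) (c w2 w3 e1 e2 e3 t : R) :
  0 <= c -> 0 <= w2 -> 0 <= w3 -> 1 <= e1 -> 1 <= e2 -> 1 <= e3 ->
  (forall s, `|f x s| <= c * (`|s| `^ (e1 - 1) + w2 * `|s| `^ (e2 - 1) + w3 * `|s| `^ (e3 - 1))) ->
  `|primitive f x t| <= c * growth w2 w3 e1 e2 e3 `|t|.
Proof.
move=> c0 w20 w30 h1 h2 h3 fb.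
pose b := c * (`|t| `^ (e1 - 1) + w2 * `|t| `^ (e2 - 1) + w3 * `|t| `^ (e3 - 1)).
have b0 : 0 <= b by rewrite /b mulr_ge0// !addr_ge0// ?mulr_ge0 ?powR_ge0.
have st (e s : R) : 1 <= e -> `|s| <= `|t| -> `|s| `^ (e - 1) <= `|t| `^ (e - 1).
  by move=> e1' s1; apply: ge0_ler_powR; rewrite ?nnegrE// subr_ge0.
have tt (e : R) : 1 <= e -> `|t| `^ (e - 1) * `|t| = `|t| `^ e.
  move=> e1'; have [->|t0] := eqVneq `|t| 0.
    by rewrite mulr0 powR0// gt_eqF//; exact: lt_le_trans e1'.
  rewrite -{2}(powRr1 (normr_ge0 t)) -powRD ?subrK//.
  by rewrite t0 implybT.
have -> : c * growth w2 w3 e1 e2 e3 `|t| = b * `|t|.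
  by rewrite /b /growth -mulrA !mulrDl -!mulrA !tt.
apply: norm_primitive_le => // s hs; apply: (le_trans (fb s)); rewrite /b.
apply: ler_wpM2l => //; apply: lerD; first apply: lerD.
- exact: st.
- by apply: ler_wpM2l => //; exact: st.
- by apply: ler_wpM2l => //; exact: st.
Qed.

(** For each L that is admissible in the definition of the Luxemburg norm of the
    gradient, u / L has a bounded conjugate energy, hence the function h below
    has a bounded t-th power and double_integral_riesz_le applies. The integrand
    of the theorem is dominated pointwise by k0 * M ^+ 2 times the product h h k,
    where M carries the dependence on L. *)
Lemma choquard_bound (Om : set V) (p q r a1 a2 al1 al2 al3 : V -> R)
    (f : V -> R -> R) (d : V -> V -> R)
    (kap pm rM A La1 La2 Lp Lq Lr e B c dM t am aM : R) :
  phase_range n kap pm rM ->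
  open Om -> (forall x, Om x -> forall i, `|x ord0 i| <= B) ->
  1 <= A -> 0 <= La1 -> 0 <= La2 -> 0 <= Lp -> 0 <= Lq -> 0 <= Lr -> 0 < e ->
  (forall x, Om x -> [/\ pm <= p x, p x <= q x, q x <= r x & r x <= rM]) ->
  (forall x, Om x -> 0 <= a1 x <= A) -> (forall x, Om x -> 0 <= a2 x <= A) ->
  lip_on Om p Lp -> lip_on Om q Lq -> lip_on Om r Lr ->
  lip_on Om a1 La1 -> lip_on Om a2 La2 ->
  N * (rM / pm - 1) + N * e <= kap ->
  measurable_fun Om (al1 : V -> measurableTypeR R) ->
  measurable_fun Om (al2 : V -> measurableTypeR R) ->
  measurable_fun Om (al3 : V -> measurableTypeR R) ->
  1 <= am -> am <= aM ->
  (forall x, Om x -> [/\ am <= al1 x <= aM, am <= al2 x <= aM & am <= al3 x <= aM]) ->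
  (forall x, Om x -> [/\ al1 x * t <= kap * sobolev_conj p x,
    al2 x * t <= kap * sobolev_conj q x & al3 x * t <= kap * sobolev_conj r x]) ->
  0 < dM < N -> 2 * N / (2 * N - dM) < t < 2 ->
  (forall x y, Om x -> Om y -> 0 < d x y <= dM) ->
  0 < c -> (forall x s, Om x -> `|f x s| <= c * (`|s| `^ (al1 x - 1)
    + a1 x `^ (al2 x / q x) * `|s| `^ (al2 x - 1) + a2 x `^ (al3 x / r x) * `|s| `^ (al3 x - 1))) ->
  exists2 C : R, 0 < C & forall u : V -> R, W10 Om (triple_phase p q r a1 a2) u ->
    (`| \int[(mu \x mu)]_(z in Om `*` Om) (choquard (primitive f) d u z)%:E | <=
     (C * Num.max (W10_norm Om (triple_phase p q r a1 a2) u `^ (2 * am))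
                  (W10_norm Om (triple_phase p q r a1 a2) u `^ (2 * aM)))%:E)%E.
Proof.
move=> rng oOm OB A1 La10 La20 Lp0 Lq0 Lr0 e0 bnd a1b a2b pL qL rL a1L a2L kape
  mal1 mal2 mal3 am1 amM al_bnd al_t dN tb d_bnd c0 fb.
have [/andP[kap0 kap1] pm1 rMN kap_pm] := rng.
have mO : measurable Om by exact: open_measurable_rV.
have qr0 x : Om x -> [/\ 0 < p x < N, 0 < q x < N & 0 < r x < N].
  by move=> /bnd[b1 b2 b3 b4]; split; apply/andP; split; lra.
have ok x : Om x -> phase_at p q r a1 a2 rM x.
  move=> Ox; have [b1 b2 b3 b4] := bnd _ Ox.
  have /andP[h1 _] := a1b _ Ox; have /andP[h2 _] := a2b _ Ox.
  by split => //; apply/andP; split; lra.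
have /andP[dM0 dMN] := dN; have /andP[tb1 t2] := tb.
have t0 : 0 <= t.
  have h : 0 <= 2 * N / (2 * N - dM) by rewrite divr_ge0 ?mulr_ge0//; lra.
  by apply: ltW; exact: le_lt_trans h tb1.
have [C C0 HC] := integral_conj_energy_le rng oOm OB A1 La10 La20 Lp0 Lq0 Lr0 e0 bnd a1b a2b
  pL qL rL a1L a2L kape.
have [C' C'0 HC'] := double_integral_riesz_le mO OB dN tb.
pose H x y := growth (a1 x `^ (al2 x / q x)) (a2 x `^ (al3 x / r x)) (al1 x) (al2 x) (al3 x) y.
have H0 x y : 0 <= H x y by rewrite growth_ge0// powR_ge0.
have muf : mu Om \is a fin_num by rewrite ge0_fin_numE// (lebesgue_bounded_lty mO OB).
pose v := fine (mu Om); have v0 : 0 <= v by rewrite fine_ge0.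
have lip_meas s L : lip_on Om s L -> measurable_fun Om (s : V -> measurableTypeR R).
  by move=> sL; apply: open_continuous_measurable_rV => // x; exact: lip_on_continuous sL.
have minv s L : (forall x, Om x -> 0 < s x) -> lip_on Om s L ->
    measurable_fun Om ((fun x => (s x)^-1) : V -> measurableTypeR R).
  move=> s0 sL; apply: open_continuous_measurable_rV => // x Ox; apply: (@contV R V x).
    by rewrite gt_eqF// s0.
  exact: lip_on_continuous sL Ox.
have mw a s al La Ls : (forall x, Om x -> 0 < s x) -> lip_on Om a La -> lip_on Om s Ls ->
    measurable_fun Om (al : V -> measurableTypeR R) ->
    measurable_fun Om ((fun x => a x `^ (al x / s x)) : V -> measurableTypeR R).
  move=> s0 aL sL mal; apply: measurable_powR_fun => //; first exact: lip_meas aL.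
  by apply: measurable_funM => //; exact: minv sL.
have mw2 : measurable_fun Om ((fun x => a1 x `^ (al2 x / q x)) : V -> measurableTypeR R).
  by apply: mw a1L qL mal2 => x /qr0[_ /andP[]].
have mw3 : measurable_fun Om ((fun x => a2 x `^ (al3 x / r x)) : V -> measurableTypeR R).
  by apply: mw a2L rL mal3 => x /qr0[_ _ /andP[]].
have mH (u : V -> R) : measurable_fun Om (u : V -> measurableTypeR R) ->
    measurable_fun Om ((fun x => H x `|u x|) : V -> measurableTypeR R).
  move=> mu_; have mnu : measurable_fun Om ((fun x => `|u x|) : V -> measurableTypeR R).
    exact: measurableT_comp.
  apply: measurable_funD; first apply: measurable_funD.
  - exact: measurable_powR_fun.
  - by apply: measurable_funM => //; exact: measurable_powR_fun.
  - by apply: measurable_funM => //; exact: measurable_powR_fun.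
pose D := 3 `^ t * (3 * v + C).
have D0 : 0 <= D by rewrite /D mulr_ge0 ?powR_ge0// addr_ge0// mulr_ge0.
pose B1 := 1 + 2 * `|B|.
have B11 : 1 <= B1 by rewrite /B1 lerDl mulr_ge0.
pose E := D * D + D * C' + D * C'.
have E0 : 0 <= E by rewrite /E !addr_ge0// mulr_ge0.
pose k0 := c * c * B1 `^ dM.
have k00 : 0 <= k0 by rewrite /k0 mulr_ge0 ?powR_ge0// mulr_ge0// ltW.
(* The summand 1 only makes the constant positive. *)
exists (k0 * E + 1) => [|u uW]; first by rewrite ltr_wpDl// mulr_ge0.
have [[[mu_ ufin] exG [mg gfin]] _] := uW.
pose S := [set L : R | 0 < L /\ (modular Om (triple_phase p q r a1 a2)
  (fun x => norm_wgrad Om u x / L)%R <= 1)%E].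
have S0 : S !=set0.
  exact: (luxemburg_set_nonempty mO ok (lip_meas _ _ pL) (lip_meas _ _ qL) (lip_meas _ _ rL)
    (lip_meas _ _ a1L) (lip_meas _ _ a2L) mg gfin).
pose I := (\int[(mu \x mu)]_(z in Om `*` Om) (choquard (primitive f) d u z)%:E)%E.
have bound L : S L -> (`|I| <= (k0 * E * Num.max (L `^ (2 * am)) (L `^ (2 * aM)))%:E)%E.
  move=> [L0 gL].
  pose w x := u x / L.
  have mw_ : measurable_fun Om (w : V -> measurableTypeR R).
    by apply: measurable_funM; [exact: mu_|exact: measurable_cst].
  have uE x : `|u x| = L * `|w x|.
    by rewrite /w normrM normfV (gtr0_norm L0) mulrC divfK// gt_eqF.
  pose M := Num.max (L `^ am) (L `^ aM).
  have M0 : 0 <= M by rewrite /M le_max powR_ge0.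
  have Iw : (\int[mu]_(x in Om) (H x `|w x| `^ t)%:E <= D%:E)%E.
    have Hx x : Om x -> H x `|w x| `^ t <= 3 `^ t * (3 + conj_energy kap p q r a1 a2 x `|w x|).
      move=> Ox; have [/andP[qx0 _] /andP[rx0 _]] : 0 < q x < N /\ 0 < r x < N.
        by have [_ h2 h3] := qr0 _ Ox.
      have [/andP[l1 _] /andP[l2 _] /andP[l3 _]] := al_bnd _ Ox.
      have [u1 u2 u3] := al_t _ Ox.
      have al0 (y : R) : am <= y -> 0 <= y by apply: le_trans; exact: le_trans am1.
      by apply: growth_le_conj_energy => //; rewrite ?u1 ?u2 ?u3 mulr_ge0// al0.
    apply: (@le_trans _ _ (\int[mu]_(x in Om)
        (3 `^ t * (3 + conj_energy kap p q r a1 a2 x `|w x|))%:E)%E).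
      by apply: integral_le_dominated => x Ox; rewrite lee_fin ?powR_ge0 ?Hx.
    have mZ := measurable_conj_energy kap oOm qr0 pL qL rL a1L a2L mw_.
    under eq_integral do rewrite EFinM.
    rewrite ge0_integralZl_EFin//; last 2 first.
    - by move=> x _; rewrite lee_fin addr_ge0// conj_energy_ge0.
    - by apply/measurable_EFinP; apply: measurable_funD; [exact: measurable_cst|exact: mZ].
    rewrite /D EFinM; apply: lee_wpmul2l; first by rewrite lee_fin powR_ge0.
    under eq_integral do rewrite EFinD.
    rewrite ge0_integralD//; last 2 first.
    - by move=> x _; rewrite lee_fin conj_energy_ge0.
    - by apply/measurable_EFinP; exact: mZ.
    have I3 : (\int[mu]_(x in Om) 3%:E <= (3 * v)%:E)%E.
      have -> : (\int[mu]_(x in Om) 3%:E = 3%:E * mu Om)%E by rewrite integral_cst.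
      by rewrite EFinM /v fineK.
    have IZ := HC u L uW L0 gL.
    rewrite (EFinD (3 * v) C); exact: (leeD I3 IZ).
  pose h x := H x `|w x|.
  have HH := HC' h D D0 (fun x _ => H0 x _) (mH _ mw_) Iw.
  pose g z := k0 * M ^+ 2 * (h z.1 * h z.2 * `|z.1 - z.2| `^ (- dM)).
  have gint : (\int[(mu \x mu)]_(z in Om `*` Om) (g z)%:E <= (k0 * M ^+ 2 * E)%:E)%E.
    have mOO : measurable (Om `*` Om) by exact: measurableX.
    have kM0 : 0 <= k0 * M ^+ 2 by rewrite mulr_ge0// sqr_ge0.
    rewrite /g; under eq_integral do rewrite EFinM.
    rewrite ge0_integralZl_EFin//; last 2 first.
    - by move=> z _; rewrite lee_fin !mulr_ge0 ?powR_ge0 /h.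
    - apply/measurable_EFinP; apply: measurable_funM; first apply: measurable_funM.
      + apply: (@measurable_comp _ _ _ _ _ _ Om) => //; [by move=> _ [z [Dz _] <-]|exact: mH|].
        exact: measurable_funTS.
      + apply: (@measurable_comp _ _ _ _ _ _ Om) => //; [by move=> _ [z [_ Dz] <-]|exact: mH|].
        exact: measurable_funTS.
      + apply: measurable_powR_fun => //.
        by apply: measurable_funTS; exact: measurable_norm_sub.
    by rewrite (EFinM (k0 * M ^+ 2) E); apply: lee_wpmul2l; [rewrite lee_fin|exact: HH].
  have -> : k0 * E * Num.max (L `^ (2 * am)) (L `^ (2 * aM)) = k0 * M ^+ 2 * E.
    have sq (y : R) : L `^ (2 * y) = (L `^ y) ^+ 2.
      by rewrite mulrC powRrM powR_mulrn// powR_ge0.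
    rewrite mulrAC !sq /M; congr (_ * _ * _).
    have [h1|h1] := leP (L `^ am) (L `^ aM).
      by apply/max_idPr; rewrite ler_pXn2r ?nnegrE ?powR_ge0.
    by apply/max_idPl; rewrite ler_pXn2r ?nnegrE ?powR_ge0// ltW.
  apply: abse_integral_le_dominated gint => -[x y] [/= Ox Oy].
  have prim z : Om z -> `|primitive f z (u z)| <= c * (M * h z).
    move=> Oz; have [l1 l2 l3] := al_bnd _ Oz.
    have [/andP[m1 _] /andP[m2 _] /andP[m3 _]] := al_bnd _ Oz.
    apply: (le_trans (@norm_primitive_growth_le f z c (a1 z `^ (al2 z / q z))
      (a2 z `^ (al3 z / r z)) (al1 z) (al2 z) (al3 z) (u z) (ltW c0) (powR_ge0 _ _)
      (powR_ge0 _ _) (le_trans am1 m1) (le_trans am1 m2) (le_trans am1 m3)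
      (fun s => fb z s Oz))).
    apply: ler_wpM2l; first exact: ltW.
    by rewrite uE /h /H; apply: growth_scale_max; rewrite ?powR_ge0.
  have ker : (enorm (x - y) `^ d x y)^-1 <= B1 `^ dM * `|x - y| `^ (- dM).
    by apply: enorm_kernel_le; [exact: d_bnd|exact: norm_lt_diam OB Ox Oy|].
  rewrite /choquard /g /= normrM normrM (ger0_norm (_ : 0 <= (enorm _ `^ _)^-1)); last first.
    by rewrite invr_ge0 powR_ge0.
  have -> : k0 * M ^+ 2 * (h x * h y * `|x - y| `^ (- dM)) =
     (c * (M * h x)) * (c * (M * h y)) * (B1 `^ dM * `|x - y| `^ (- dM)).
    by rewrite /k0; move: (B1 `^ dM) (`|x - y| `^ (- dM)) (h x) (h y) => X1 X2 X3 X4; ring.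
  have cM0 z : 0 <= c * (M * h z) by rewrite mulr_ge0 ?(ltW c0)// mulr_ge0 ?M0// H0.
  apply: ler_pM; [by rewrite mulr_ge0|by rewrite invr_ge0 powR_ge0| |exact: ker].
  by apply: ler_pM; [exact: normr_ge0|exact: normr_ge0|exact: prim|exact: prim].
have [i Ii] : exists i, `|I|%E = i%:E.
  have [L SL] := S0; have := bound _ SL; move: (abse_ge0 I).
  by case: (`|I|)%E => // i _ _; exists i.
rewrite -/I Ii lee_fin; apply: le_max_powR_inf => //.
- by move=> L [].
- by rewrite ltr_wpDl// mulr_ge0.
- by lra.
- by lra.
move=> L SL; have := bound _ SL; rewrite Ii lee_fin => /le_trans; apply.
by apply: ler_wpM2r; [rewrite le_max powR_ge0|rewrite lerDl].
Qed.

End core.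

(** * Compactness and choice of the exponents *)

Section compactness.
Variable R : realType.

Lemma minf_attained (T : topologicalType) (K : set T) (s : T -> R) : compact K -> K !=set0 ->
  {within K, continuous s} ->
  exists2 x0, K x0 & minf K s = s x0 /\ forall x, K x -> minf K s <= s x.
Proof.
move=> cK K0 cs; have [x0 /set_mem Kx0 hx0] := compact_EVT_min K0 cK cs.
have low y : [set s x | x in K] y -> s x0 <= y.
  by move=> [x Kx <-]; apply: hx0; rewrite inE.
have E : minf K s = s x0.
  apply/le_anti/andP; split.
    by apply: ge_inf; [exists (s x0)|exists x0].
  by apply: lb_le_inf => //; exists (s x0), x0.
by exists x0 => //; split => // x Kx; rewrite E; apply: hx0; rewrite inE.
Qed.

Lemma maxf_attained (T : topologicalType) (K : set T) (s : T -> R) : compact K -> K !=set0 ->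
  {within K, continuous s} ->
  exists2 x0, K x0 & maxf K s = s x0 /\ forall x, K x -> s x <= maxf K s.
Proof.
move=> cK K0 cs; have [x0 /set_mem Kx0 hx0] := compact_EVT_max K0 cK cs.
have up y : [set s x | x in K] y -> y <= s x0.
  by move=> [x Kx <-]; apply: hx0; rewrite inE.
have E : maxf K s = s x0.
  apply/le_anti/andP; split.
    by apply: ge_sup => //; exists (s x0), x0.
  by apply: ub_le_sup; [exists (s x0)|exists x0].
by exists x0 => //; split => // x Kx; rewrite E; apply: hx0; rewrite inE.
Qed.

Lemma bounded_closure n (Om : set 'rV[R]_n.+1) : bounded_set Om ->
  exists2 B : R, 0 <= B & forall x, closure Om x -> `|x| <= B.
Proof.
move=> bO.
have [M [M0 hM]] := filter_ex (filterI (nbhs_pinfty_ge (num_real (0 : R))) bO).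
exists M => // x; have cl : closed [set x : 'rV[R]_n.+1 | `|x| <= M].
  rewrite (_ : [set x | _] = (fun x => `|x|) @^-1` [set y | y <= M])//.
  by apply: closed_comp => [y _|]; [exact: norm_continuous|exact: closed_le].
move=> Ox; have := closure_subset hM Ox; rewrite -((closure_id _).1 cl).
exact.
Qed.

Lemma C01_lip n (Om : set 'rV[R]_n) (s : 'rV[R]_n -> R) : C01 Om s ->
  exists2 L : R, 0 <= L & lip_on (closure Om) s L.
Proof.
move=> sL.
have [M [M0 hM]] := filter_ex (filterI (nbhs_pinfty_ge (num_real (0 : R))) sL).
by exists M => // x y Kx Ky; exact: (hM (x, y)).
Qed.

(** The strict inequality al * t0 < sobolev_conj s between continuous functions
    on a compact set leaves a uniform gap, here measured after multiplication by
    the denominator of sobolev_conj s. *)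
Lemma subcritical_ratio n (K : set 'rV[R]_n.+1) (s al : 'rV[R]_n.+1 -> R) (t0 : R) :
  compact K -> K !=set0 -> 0 < t0 ->
  {within K, continuous s} -> {within K, continuous al} ->
  (forall x, K x -> 0 < s x < n.+1%:R /\ 0 < al x) ->
  (forall x, K x -> al x * t0 < sobolev_conj s x) ->
  exists2 tau : R, 0 < tau < 1 & forall x, K x -> al x * t0 <= tau * sobolev_conj s x.
Proof.
move=> cK K0 t00 cs cal pos h.
pose g x := n.+1%:R * s x + (-1) * (al x * t0 * (n.+1%:R + (-1) * s x)).
have cg : {within K, continuous g}.
  move=> x.
  apply: (@contD R (subspace K) x (fun y => n.+1%:R * s y)).
    by apply: (@contM R (subspace K) x (fun=> n.+1%:R)); [exact: cont_cst|exact: cs].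
  apply: (@contM R (subspace K) x (fun=> -1)); first exact: cont_cst.
  apply: (@contM R (subspace K) x (fun y => al y * t0)).
    by apply: (@contM R (subspace K) x al); [exact: cal|exact: cont_cst].
  apply: (@contD R (subspace K) x (fun=> n.+1%:R)); first exact: cont_cst.
  by apply: (@contM R (subspace K) x (fun=> -1)); [exact: cont_cst|exact: cs].
have [x0 Kx0 [gE gm]] := minf_attained cK K0 cg.
have [x1 Kx1 [sE sm]] := maxf_attained cK K0 cs.
have N0 : 0 < (n.+1%:R : R) by rewrite ltr0n.
have cj x : K x -> [/\ 0 < n.+1%:R - s x, 0 < s x, 0 < al x & al x * t0 * (n.+1%:R - s x) < n.+1%:R * s x].
  move=> Kx; have [/andP[s0 sN] a0] := pos _ Kx; have hN : 0 < n.+1%:R - s x by rewrite subr_gt0.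
  by split => //; rewrite -ltr_pdivlMr//; exact: h.
have gdef x : g x = n.+1%:R * s x - al x * t0 * (n.+1%:R - s x) by rewrite /g !mulN1r.
have e0 : 0 < minf K g.
  by rewrite gE gdef subr_gt0; have [] := cj _ Kx0.
have sM0 : 0 < maxf K s by rewrite sE; have [] := cj _ Kx1.
have NsM : 0 < n.+1%:R * maxf K s by rewrite mulr_gt0.
have eNs : minf K g < n.+1%:R * maxf K s.
  apply: (le_lt_trans (gm _ Kx0)); rewrite gdef; have [h1 h2 h3 h4] := cj _ Kx0.
  apply: (@lt_le_trans _ _ (n.+1%:R * s x0)); first by rewrite gtrBl !mulr_gt0.
  by rewrite ler_pM2l// sm.
exists (1 - minf K g / (n.+1%:R * maxf K s)) => [|x Kx].
  by rewrite subr_gt0 gtrBl ltr_pdivrMr// mul1r eNs divr_gt0.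
have [h1 h2 h3 h4] := cj _ Kx; rewrite /sobolev_conj mulrA ler_pdivlMr//.
rewrite mulrBl mul1r lerBrDr -lerBrDl -gdef; apply: le_trans (gm _ Kx).
rewrite mulrAC ler_pdivrMr//; apply: ler_wpM2l; first exact: ltW.
by rewrite ler_pM2l// sm.
Qed.

(** Each of the lower bounds on kap is less than 1. The factor lam leaves room to
    increase t0 while remaining below 2 and below the gap tau. *)
Lemma exponent_choice (nu pm rM tau t0 : R) : 1 < nu -> 1 < pm -> 0 < rM ->
  rM / pm < 1 + nu^-1 -> 0 < tau < 1 -> 1 <= t0 < 2 ->
  exists kap e lam : R,
    [/\ 0 < kap <= 1, nu - pm <= kap * (nu - 1), 0 < e & nu * (rM / pm - 1) + nu * e <= kap] /\
    [/\ 1 < lam, t0 * lam < 2 & tau * lam <= kap].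
Proof.
move=> nu1 pm1 rM0 rat /andP[tau0 tau1] /andP[t01 t02].
have nu0 : 0 < nu by lra.
(* k1 makes mexp at least 1, k2 leaves room for e > 0, k3 for lam > 1. *)
pose k1 := (nu - pm) / (nu - 1).
have k11 : k1 < 1 by rewrite /k1 ltr_pdivrMr; lra.
pose rho := nu * (rM / pm - 1).
have rho1 : rho < 1 by rewrite /rho -ltr_pdivlMl// mulr1; lra.
pose k2 := (rho + 1) / 2; pose k3 := (1 + tau) / 2.
pose kap := Num.max (Num.max k1 k2) k3.
have kap1 : k1 <= kap by rewrite /kap !le_max lexx.
have kap2 : k2 <= kap by rewrite /kap !le_max lexx orbT.
have kap3 : k3 <= kap by rewrite /kap !le_max lexx !orbT.
have kapl : kap < 1 by rewrite /kap !gt_max k11/= /k2 /k3; apply/andP; split; lra.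
pose l1 := (1 + tau) / (2 * tau); pose l2 := (1 + 2 / t0) / 2.
have t20 : 1 < 2 / t0 by rewrite ltr_pdivlMr; lra.
have l11 : 1 < l1 by rewrite /l1 ltr_pdivlMr; lra.
have l21 : 1 < l2 by rewrite /l2; lra.
exists kap, ((kap - rho) / nu), (Num.min l1 l2); split; split.
- by apply/andP; split; [move: kap3; rewrite /k3; lra|exact: ltW].
- by move: kap1; rewrite /k1 ler_pdivrMr//; lra.
- by rewrite divr_gt0//; move: kap2; rewrite /k2; lra.
- by rewrite -/rho mulrCA divff ?gt_eqF// mulr1; lra.
- by rewrite lt_min l11.
- apply: (@le_lt_trans _ _ (t0 * l2)).
    by apply: ler_wpM2l; [lra|rewrite ge_min lexx orbT].
  have -> : t0 * l2 = (t0 + 2) / 2 by rewrite /l2; field; rewrite gt_eqF//; lra.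
  by lra.
- apply: le_trans kap3; apply: (@le_trans _ _ (tau * l1)).
    by apply: ler_wpM2l; [exact: ltW|rewrite ge_min lexx].
  by rewrite le_eqVlt /l1 /k3; apply/orP; left; apply/eqP; field; rewrite gt_eqF.
Qed.

End compactness.

(** * The theorem *)

(** Minima and maxima over the compact closure supply all constants required by
    choquard_bound: kap, e and lam by exponent_choice, and the exponent
    t = t0 * lam, where t0 = 2 * N / (2 * N - dM) is the critical one. *)
Lemma choquard_bound_domain (R : realType) (n : nat) (Omega : set 'rV[R]_n.+2)
    (p q r a1 a2 : 'rV[R]_n.+2 -> R) (f : 'rV[R]_n.+2 -> R -> R)
    (d : 'rV[R]_n.+2 -> 'rV[R]_n.+2 -> R)
    (c : R) (alpha1 alpha2 alpha3 : 'rV[R]_n.+2 -> R) (K : set 'rV[R]_n.+2) (dm dM : R) :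
  K = closure Omega ->
  dm = minf (K `*` K) (fun z => d z.1 z.2) -> dM = maxf (K `*` K) (fun z => d z.1 z.2) ->
  open Omega -> Omega !=set0 -> bounded_set Omega ->
  C_plus Omega p -> C_plus Omega q -> C_plus Omega r ->
  {within K `*` K, continuous (fun z => d z.1 z.2)} ->
  0 < dm -> dm <= dM -> dM < n.+2%:R ->
  C01 Omega p -> C01 Omega q -> C01 Omega r ->
  (forall x, K x -> [/\ p x < q x, q x < r x & r x < n.+2%:R]) ->
  C01 Omega a1 -> C01 Omega a2 ->
  (forall x, K x -> 0 <= a1 x /\ 0 <= a2 x) ->
  maxf K r / minf K p < 1 + n.+2%:R^-1 ->
  0 < c ->
  C_plus Omega alpha1 -> C_plus Omega alpha2 -> C_plus Omega alpha3 ->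
  (forall x t, Omega x ->
    `|f x t| <= c * (`|t| `^ (alpha1 x - 1)
                     + a1 x `^ (alpha2 x / q x) * `|t| `^ (alpha2 x - 1)
                     + a2 x `^ (alpha3 x / r x) * `|t| `^ (alpha3 x - 1))) ->
  (forall x, K x -> [/\ 1 < alpha1 x, alpha1 x < alpha2 x & alpha2 x < alpha3 x]) ->
  exponent_class Omega dm dM p alpha1 ->
  exponent_class Omega dm dM q alpha2 ->
  exponent_class Omega dm dM r alpha3 ->
  exists2 C : R, 0 < C & forall u : 'rV[R]_n.+2 -> R, W10 Omega (triple_phase p q r a1 a2) u ->
    (`| \int[(@lebesgue_rV R n.+2 \x @lebesgue_rV R n.+2)]_(z in Omega `*` Omega)
        (choquard (primitive f) d u z)%:E | <=
     (C * Num.max (W10_norm Omega (triple_phase p q r a1 a2) u `^ (2 * minf K alpha1))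
                  (W10_norm Omega (triple_phase p q r a1 a2) u `^ (2 * maxf K alpha3)))%:E)%E.
Proof.
move=> KE dmE dME oOm Om0 bOm [cp p1] [cq q1] [cr r1] cd dm0 dmM dMN pL qL rL pqr a1L a2L a0 rat c0
  [cal1 al11] [cal2 al21] [cal3 al31] fb al_lt [_ ex1] [_ ex2] [_ ex3].
have OK : Omega `<=` K by rewrite KE; exact: subset_closure.
have [B B0 KB] := bounded_closure bOm.
have K0 : K !=set0 by have [x Ox] := Om0; exists x; exact: OK.
have cK : compact K.
  apply: bounded_closed_compact; last by rewrite KE; exact: closed_closure.
  exists B; split; first exact: num_real.
  by move=> M BM x; rewrite KE => /KB xB; exact: le_trans xB (ltW BM).
have OB x : Omega x -> forall i, `|x ord0 i| <= B.
  move=> /OK; rewrite KE => /KB xB i; apply: le_trans xB.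
  exact: coord_le_norm.
have [Lp Lp0 lp] := C01_lip pL; have [Lq Lq0 lq] := C01_lip qL; have [Lr Lr0 lr] := C01_lip rL.
have [La1 La10 la1] := C01_lip a1L; have [La2 La20 la2] := C01_lip a2L.
rewrite -KE in cp p1 cq q1 cr r1 cal1 al11 cal2 al21 cal3 al31 ex1 ex2 ex3 KB lp lq lr la1 la2.
have lipO (s : 'rV[R]_n.+2 -> R) L : lip_on K s L -> lip_on Omega s L.
  by move=> sL x y /OK Kx /OK Ky; exact: sL.
have [xp Kxp [pE pm]] := minf_attained cK K0 cp.
have [xr Kxr [rE rM]] := maxf_attained cK K0 cr.
have [x1 Kx1 [alE alm]] := minf_attained cK K0 cal1.
have [x3 Kx3 [arE arM]] := maxf_attained cK K0 cal3.
have KK : compact (K `*` K) by exact: compact_setX.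
have KK0 : K `*` K !=set0 by have [x Kx] := K0; exists (x, x).
have [zm _ [_ dmin]] := minf_attained KK KK0 cd.
have [zM _ [_ dmax]] := maxf_attained KK KK0 cd.
rewrite -dmE in dmin; rewrite -dME in dmax.
have pm1 : 1 < minf K p by rewrite pE p1.
have rMN : maxf K r < n.+2%:R by rewrite rE; have [] := pqr _ Kxr.
have rM0 : 0 < maxf K r by rewrite rE; apply: lt_trans (r1 _ Kxr).
pose t0 : R := 2 * n.+2%:R / (2 * n.+2%:R - dM).
have N2 : 2 <= (n.+2%:R : R) by rewrite ler_nat.
have den : 0 < 2 * n.+2%:R - dM by lra.
have dM0 : 0 < dM by exact: lt_le_trans dmM.
have t01 : 1 <= t0 < 2.
  by apply/andP; split; rewrite /t0 ?ler_pdivlMr ?ltr_pdivrMr//; lra.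
have t0p : 0 < t0 by have /andP[h _] := t01; exact: lt_le_trans h.
have pos (s al : 'rV[R]_n.+2 -> R) : (forall x, K x -> 1 < s x /\ s x < n.+2%:R) -> (forall x, K x -> 1 < al x) ->
    forall x, K x -> 0 < s x < n.+2%:R /\ 0 < al x.
  move=> h1 h2 x Kx; have [s1 sN] := h1 _ Kx; have a1' := h2 _ Kx.
  by rewrite sN (lt_trans ltr01 s1) (lt_trans ltr01 a1').
have sb1 x : K x -> 1 < p x /\ p x < n.+2%:R.
  by move=> Kx; have [h1 h2 h3] := pqr _ Kx; split; [exact: p1|exact: lt_trans h1 (lt_trans h2 h3)].
have sb2 x : K x -> 1 < q x /\ q x < n.+2%:R.
  by move=> Kx; have [h1 h2 h3] := pqr _ Kx; split; [exact: q1|exact: lt_trans h2 h3].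
have sb3 x : K x -> 1 < r x /\ r x < n.+2%:R.
  by move=> Kx; have [h1 h2 h3] := pqr _ Kx; split; [exact: r1|].
have ratio (s al : 'rV[R]_n.+2 -> R) : {within K, continuous s} -> {within K, continuous al} ->
    (forall x, K x -> 1 < s x /\ s x < n.+2%:R) -> (forall x, K x -> 1 < al x) ->
    (forall x, K x -> [/\ 1 < al x * (2 * n.+2%:R / (2 * n.+2%:R - dm)),
        al x * (2 * n.+2%:R / (2 * n.+2%:R - dm)) <= al x * t0 &
        al x * t0 < sobolev_conj s x]) ->
    exists2 tau : R, 0 < tau < 1 & forall x, K x -> al x * t0 <= tau * sobolev_conj s x.
  move=> cs cal sb alb ex; apply: (subcritical_ratio cK K0 t0p cs cal (pos _ _ sb alb)).
  by move=> x /ex[].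
have [t1 /andP[t10 t11] T1] := ratio _ _ cp cal1 sb1 al11 ex1.
have [t2 /andP[t20 t21] T2] := ratio _ _ cq cal2 sb2 al21 ex2.
have [t3 /andP[t30 t31] T3] := ratio _ _ cr cal3 sb3 al31 ex3.
pose tau := Num.max (Num.max t1 t2) t3.
have tau01 : 0 < tau < 1 by rewrite /tau !lt_max !gt_max t10 t11 t21 t31.
have nu1 : 1 < (n.+2%:R : R) by rewrite ltr1n.
have [kap [e [lam [[k01 kpm e0 ke] [lam1 lam2 taulam]]]]] := exponent_choice nu1 pm1 rM0 rat tau01 t01.
have rng : phase_range n kap (minf K p) (maxf K r).
  by split => //; have -> : n.+1%:R = n.+2%:R - 1 :> R by rewrite NE addrAC subrr add0r.
have [x0 Kx0] := K0.
pose A := Num.max 1 (Num.max (`|a1 x0| + La1 * (2 * B)) (`|a2 x0| + La2 * (2 * B))).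
have abnd (a : 'rV[R]_n.+2 -> R) L : 0 <= L -> lip_on K a L -> (forall x, K x -> 0 <= a x) ->
    `|a x0| + L * (2 * B) <= A -> forall x, Omega x -> 0 <= a x <= A.
  move=> L0 aL age aA x /OK Kx; rewrite age//=; apply: le_trans aA.
  have -> : a x = a x0 + (a x - a x0) by rewrite addrC subrK.
  apply: lerD; first exact: ler_norm.
  apply: (le_trans (ler_norm _)); apply: (le_trans (aL _ _ Kx Kx0)); apply: ler_wpM2l => //.
  apply: (le_trans (ler_normB _ _)); rewrite mulr2n mulrDl !mul1r.
  by apply: lerD; exact: KB.
have A1 : 1 <= A by rewrite /A le_max lexx.
have a1A := abnd a1 La1 La10 la1 (fun x Kx => proj1 (a0 x Kx)).
have a2A := abnd a2 La2 La20 la2 (fun x Kx => proj2 (a0 x Kx)).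
have {}a1A : forall x, Omega x -> 0 <= a1 x <= A by apply: a1A; rewrite /A !le_max lexx orbT.
have {}a2A : forall x, Omega x -> 0 <= a2 x <= A by apply: a2A; rewrite /A !le_max lexx !orbT.
have bnd x : Omega x -> [/\ minf K p <= p x, p x <= q x, q x <= r x & r x <= maxf K r].
  move=> /OK Kx; have [h1 h2 h3] := pqr _ Kx.
  by split; [exact: pm|exact: ltW|exact: ltW|exact: rM].
have mal (al : 'rV[R]_n.+2 -> R) : {within K, continuous al} -> measurable_fun Omega (al : 'rV[R]_n.+2 -> measurableTypeR R).
  move=> cal; have := continuous_subspaceW OK cal; rewrite continuous_open_subspace// => h.
  by apply: open_continuous_measurable_rV => // x Ox; apply: h; rewrite inE.
have al_bnd x : Omega x -> [/\ minf K alpha1 <= alpha1 x <= maxf K alpha3,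
    minf K alpha1 <= alpha2 x <= maxf K alpha3 & minf K alpha1 <= alpha3 x <= maxf K alpha3].
  move=> /OK Kx; have [h1 h2 h3] := al_lt _ Kx; have g1 := alm _ Kx; have g3 := arM _ Kx.
  by clear -h1 h2 h3 g1 g3; split; apply/andP; split; lra.
have conj_le (s al : 'rV[R]_n.+2 -> R) ti x : K x -> 1 < s x /\ s x < n.+2%:R -> ti <= tau ->
    al x * t0 <= ti * sobolev_conj s x -> al x * (t0 * lam) <= kap * sobolev_conj s x.
  move=> Kx [s1 sN] tt h.
  have cj : 0 < sobolev_conj s x.
    by rewrite /sobolev_conj divr_gt0 ?subr_gt0// mulr_gt0// ?ltr0n// (lt_trans ltr01).
  have lam0 : 0 <= lam by exact: ltW (lt_trans ltr01 lam1).
  rewrite mulrA; apply: (@le_trans _ _ (tau * sobolev_conj s x * lam)).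
    by apply: ler_wpM2r => //; apply: (le_trans h); rewrite ler_pM2r.
  by rewrite mulrAC ler_pM2r.
have al_t x : Omega x -> [/\ alpha1 x * (t0 * lam) <= kap * sobolev_conj p x,
    alpha2 x * (t0 * lam) <= kap * sobolev_conj q x & alpha3 x * (t0 * lam) <= kap * sobolev_conj r x].
  move=> /OK Kx; split.
  - by apply: (conj_le _ _ t1) => //; [exact: sb1|rewrite /tau !le_max lexx|exact: T1].
  - by apply: (conj_le _ _ t2) => //; [exact: sb2|rewrite /tau !le_max lexx orbT|exact: T2].
  - by apply: (conj_le _ _ t3) => //; [exact: sb3|rewrite /tau !le_max lexx !orbT|exact: T3].
have am1 : 1 <= minf K alpha1 by rewrite alE ltW// al11.
have amM : minf K alpha1 <= maxf K alpha3.
  by have [y Oy] := Om0; have [/andP[h1 h2] _ _] := al_bnd _ Oy; exact: le_trans h2.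
have dN : 0 < dM < n.+2%:R by rewrite dM0.
have tb : 2 * n.+2%:R / (2 * n.+2%:R - dM) < t0 * lam < 2 by rewrite lam2 andbT ltr_pMr.
have d_bnd x y : Omega x -> Omega y -> 0 < d x y <= dM.
  move=> /OK Kx /OK Ky; have h : (K `*` K) (x, y) by split.
  by apply/andP; split; [exact: lt_le_trans (dmin _ h)|exact: (dmax _ h)].
exact: (choquard_bound rng oOm OB A1 La10 La20 Lp0 Lq0 Lr0 e0 bnd a1A a2A (lipO _ _ lp) (lipO _ _ lq)
  (lipO _ _ lr) (lipO _ _ la1) (lipO _ _ la2) ke (mal _ cal1) (mal _ cal2) (mal _ cal3) am1 amM al_bnd
  al_t dN tb d_bnd c0 fb).
Qed.

Unset Implicit Arguments.
Set Strict Implicit.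

Theorem lemma2p12 (R : realType) (N : nat) (Omega : set 'rV[R]_N)
    (p q r gamma a1 a2 : 'rV[R]_N -> R) (f : 'rV[R]_N -> R -> R)
    (d : 'rV[R]_N -> 'rV[R]_N -> R)
    (c : R) (alpha1 alpha2 alpha3 : 'rV[R]_N -> R)
    (mu := @lebesgue_rV R N)
    (K := closure Omega)
    (dm := minf (K `*` K) (fun z => d z.1 z.2))
    (dM := maxf (K `*` K) (fun z => d z.1 z.2))
    (T := triple_phase p q r a1 a2)
    (F := primitive f)
    (nrm := W10_norm Omega T) :
  smooth_bounded_domain Omega ->
  C_plus Omega p -> C_plus Omega q -> C_plus Omega r -> C_plus Omega gamma ->
  (a1 \_ Omega : _ -> measurableTypeR R) \in Lfun mu +oo%E ->
  (a2 \_ Omega : _ -> measurableTypeR R) \in Lfun mu +oo%E ->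
  {ae mu, forall x, Omega x -> 0 <= a1 x /\ 0 <= a2 x} ->
  {within Omega `*` [set: R], continuous (fun z => f z.1 z.2)} ->
  {within K `*` K, continuous (fun z => d z.1 z.2)} ->
  0 < dm -> dm <= dM -> dM < N%:R ->
  (* (H1) *)
  (forall x, K x -> p x < N%:R /\
    [/\ gamma x < p x, p x < q x, q x < r x & r x < sobolev_conj p x]) ->
  (* (H2) *)
  C01 Omega p -> C01 Omega q -> C01 Omega r ->
  (forall x, K x -> [/\ p x < q x, q x < r x & r x < N%:R]) ->
  C01 Omega a1 -> C01 Omega a2 ->
  (forall x, K x -> 0 <= a1 x /\ 0 <= a2 x) ->
  maxf K r / minf K p < 1 + N%:R^-1 ->
  (* (L1) *)
  0 < c ->
  C_plus Omega alpha1 -> C_plus Omega alpha2 -> C_plus Omega alpha3 ->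
  (forall x t, Omega x ->
    `|f x t| <= c * (`|t| `^ (alpha1 x - 1)
                     + a1 x `^ (alpha2 x / q x) * `|t| `^ (alpha2 x - 1)
                     + a2 x `^ (alpha3 x / r x) * `|t| `^ (alpha3 x - 1))) ->
  (forall x, K x ->
    [/\ 1 < alpha1 x, alpha1 x < alpha2 x & alpha2 x < alpha3 x]) ->
  minf K alpha1 > maxf K r / 2 ->
  exponent_class Omega dm dM p alpha1 ->
  exponent_class Omega dm dM q alpha2 ->
  exponent_class Omega dm dM r alpha3 ->
  exists2 C : R, 0 < C & forall u : 'rV[R]_N -> R, W10 Omega T u ->
    (`| \int[(mu \x mu)]_(z in Omega `*` Omega) (choquard F d u z)%:E | <=
     (C * Num.max (nrm u `^ (2 * minf K alpha1))
                  (nrm u `^ (2 * maxf K alpha3)))%:E)%E.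
Proof.
move=> [oOm _ Om0 bOm _] cp cq cr _ _ _ _ _ cd dm0 dmM dMN h1 pL qL rL pqr a1L a2L a0 rat c0
  cal1 cal2 cal3 fb al_lt _ ex1 ex2 ex3.
have [x0 Ox0] := Om0; have Kx0 : K x0 by exact: subset_closure.
have [pN _] := h1 _ Kx0; have p1 : 1 < p x0 by case: cp => _; exact.
have N1 : (1 < N)%N by rewrite -(ltr_nat R); exact: lt_trans p1 pN.
case: N N1 => [|[|n]] // _ in Omega p q r gamma a1 a2 f d alpha1 alpha2 alpha3 mu K dm dM T F nrm oOm Om0 bOm cp cq cr cd dm0 dmM dMN h1 pL qL rL pqr a1L a2L a0 rat cal1 cal2 cal3 fb al_lt ex1 ex2 ex3 x0 Ox0 Kx0 pN p1 *.
exact: (@choquard_bound_domain R n Omega p q r a1 a2 f d c alpha1 alpha2 alpha3 K dm dM).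
Qed.
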